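(* Let $\rho\in L^1_{loc}(\mathbb{R})$ vanish on $(-\infty,0)$ and satisfy $M:=\limsup_{x\to\infty}|\rho(x)|<\infty$. Suppose there are $\lambda>0$ and a closed null set $E\subset\mathbb{R}$ with $0\notin E$ such that for each $t\in E\cap(-\lambda,\lambda)$ there is $M_t<\infty$ with $\sup_{x>0}\left|\int_0^x\rho(u)e^{-itu}\,\mathrm{d}u\right|<M_t$, and a constant $\hat\rho(0)$ such that $\frac{\mathcal{L}\{\rho;s\}-\hat\rho(0)}{s}$ has local pseudofunction boundary behavior on $i((-\lambda,\lambda)\setminus E)$, where $\mathcal{L}\{\rho;s\}=\int_0^\infty\rho(x)e^{-sx}\,\mathrm{d}x$ ($\Re e\, s>0$). Then there is an absolute constant $0<\mathfrak{C}\leq2$ such that $$\limsup_{x\to\infty}\left|\int_0^x\rho(u)\,\mathrm{d}u-\hat\rho(0)\right|\leq\frac{\mathfrak{C}M}{\lambda}.$$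
   Context: Fourier transform $\hat\varphi(t)=\int e^{-itx}\varphi(x)\,\mathrm{d}x$. A tempered distribution $f$ is a pseudofunction if $\hat f\in L^\infty$ and $\hat f(x)\to0$ as $|x|\to\infty$; a distribution on an open $U$ is a local pseudofunction on $U$ if near each point of $U$ it coincides with a pseudofunction. An analytic $F$ on $\Re e\, s>0$ has local pseudofunction boundary behavior on $iU$ ($U\subseteq\mathbb{R}$ open) if $F(\sigma+it)$ converges in $\mathcal{D}'(U)$ as $\sigma\to0^+$ to a local pseudofunction on $U$. *)

(* Defs.v *)
From HB Require Import structures.
From mathcomp Require Import all_boot all_order all_algebra.
From mathcomp Require Import all_classical all_reals all_analysis.
From mathcomp Require Import complex.
From mathcomp Require Import Rstruct Rstruct_topology.

Set Implicit Arguments.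
Unset Strict Implicit.
Unset Printing Implicit Defensive.

Import Order.TTheory GRing.Theory Num.Theory.
Import numFieldNormedType.Exports.

Local Open Scope classical_set_scope.
Local Open Scope ring_scope.

Section Defs.
Variable R : realType.
Local Notation mu := (@lebesgue_measure R).

Definition cabs (z : R[i]) : R := Num.sqrt (complex.Re z ^+ 2 + complex.Im z ^+ 2).

Definition cexpi (th : R) : R[i] := Complex (cos th) (sin th).

Definition cexp (z : R[i]) : R[i] :=
  Complex (expR (complex.Re z) * cos (complex.Im z)) (expR (complex.Re z) * sin (complex.Im z)).

Definition RtoC (x : R) : R[i] := Complex x 0.

Definition cint (D : set R) (f : R -> R[i]) : R[i] :=
  Complex (Rintegral mu D (fun x => complex.Re (f x)))
          (Rintegral mu D (fun x => complex.Im (f x))).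

Definition cintegrable (D : set R) (f : R -> R[i]) : Prop :=
  mu.-integrable D (fun x => (complex.Re (f x))%:E) /\
  mu.-integrable D (fun x => (complex.Im (f x))%:E).

Definition loc_integrableC (f : R -> R[i]) : Prop :=
  locally_integrable setT (fun x => complex.Re (f x)) /\
  locally_integrable setT (fun x => complex.Im (f x)).

Definition limsup_pinfty (h : R -> R) : \bar R :=
  limf_esup (fun x => (h x)%:E) (+oo : set_system R).

Definition laplace (rho : R -> R[i]) (s : R[i]) : R[i] :=
  cint [set x | 0 <= x] (fun x => rho x * cexp (- (s * RtoC x))).

Definition smooth (f : R -> R) : Prop :=
  forall (n : nat) (x : R), derivable (derive1n n f) x 1.

Definition test_function (U : set R) (phi : R -> R[i]) : Prop :=
  smooth (fun t => complex.Re (phi t)) /\ smooth (fun t => complex.Im (phi t)) /\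
  exists K : set R, [/\ compact K, K `<=` U & forall t, ~ K t -> phi t = 0].

Definition fourierC (phi : R -> R[i]) (x : R) : R[i] :=
  cint setT (fun t => cexpi (- (x * t)) * phi t).

Definition inv_fourierC (psi : R -> R[i]) (x : R) : R[i] :=
  RtoC (2 * pi)^-1 * cint setT (fun t => cexpi (x * t) * psi t).

(** g is (a representative of) an L^oo function tending to 0 at +-oo:
    the admissible Fourier transforms of pseudofunctions *)
Definition pseudofunction_symbol (g : R -> R[i]) : Prop :=
  [/\ measurable_fun setT (fun x => complex.Re (g x)),
      measurable_fun setT (fun x => complex.Im (g x)),
      (exists B : R, forall x, cabs (g x) <= B),
      (fun x => cabs (g x)) @ +oo --> (0 : R) &
      (fun x => cabs (g x)) @ -oo --> (0 : R)].

(** the pseudofunction f with \hat f = g, i.e. the tempered distribution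
    f = F^{-1} g, evaluated at a test function psi:
    <f, psi> = <g, F^{-1} psi> = \int g(x) (F^{-1} psi)(x) dx *)
Definition pseudofunction (g : R -> R[i]) (psi : R -> R[i]) : R[i] :=
  cint setT (fun x => g x * inv_fourierC psi x).

Definition local_pseudofunction (U : set R) (G : (R -> R[i]) -> R[i]) : Prop :=
  forall t0, U t0 -> exists V : set R, [/\ open V, V t0, V `<=` U &
    exists g, pseudofunction_symbol g /\
      forall phi, test_function V phi -> G phi = pseudofunction g phi].

(** F (analytic on Re s > 0) has local pseudofunction boundary behavior on iU:
    F(sigma + i t) converges in D'(U) as sigma -> 0+ to a local pseudofunction
    on U *)
Definition local_pf_boundary (F : R[i] -> R[i]) (U : set R) : Prop :=
  exists G : (R -> R[i]) -> R[i],
    (forall phi, test_function U phi ->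
       (fun sigma => complex.Re (cint setT (fun t => F (Complex sigma t) * phi t)))
          @ 0^'+ --> complex.Re (G phi) /\
       (fun sigma => complex.Im (cint setT (fun t => F (Complex sigma t) * phi t)))
          @ 0^'+ --> complex.Im (G phi)) /\
    local_pseudofunction U G.

End Defs.

(* Main.v *)
(* Write tau(x) for the integral of rho over [0, x] minus rhohat(0), so that
   (L rho(s) - rhohat(0)) / s is the Laplace transform of tau. Altering rho on a
   bounded set turns tau into the primitive p of a function r bounded by
   M' > M everywhere, without changing it near +oo. The boundary hypothesis
   says that p * phihat(h) -> 0 as h -> +oo for each test function phi
   supported in (-lambda, lambda) away from E (such phi are called good).
   - Near 0 this already makes p bounded.
   - If the points of E without a good neighbourhood existed, a Baire argument
     would give an interval on which they share one bound for the integrals of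
     p(u) exp(-itu); cutting a test function into pieces of width d, each piece
     meeting them contributes O(d), and since E is null and closed the number of
     such pieces is o(1/d). Hence every test function in (-lambda, lambda) is
     good.
   - For phi a mixture of the kernels (rr^2 - t^2)_+, with a < rr < b < lambda,
     whose transforms are evaluated on a half circle as in Newman's contour
     proof, |2 pi phi(0) p(h) - p * phihat(h)| <= 2 pi phi(0) 2M'/a. Letting
     a -> lambda and M' -> M gives the constant 2. *)

(* The bounds assumed at points of E come without uniformity in t, and no boundary behaviour is
   known there. A piece of width d near such a frequency t0 is cheap because integration by parts
   against exp(-i t0 u) multiplies it by t - t0, of size d, while the L1 norm of the transform of a
   rescaled bump does not depend on d. Since 0 lies outside E, p is already bounded when E is
   treated, and division by t carries the assumed bounds from rho over to p. A single kernel (rr^2 -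
   t^2)_+ is not smooth, hence no test function; averaging over rr^2 in [a^2, b^2] with a smooth
   density repairs this. For one radius, p(h + x) + p(h - x) is 2 p(h) plus the primitive of a
   function bounded by 2M'. The half circle yields the main term 2 p(h) pi rr^2 with an error of at
   most 4 pi rr M', and the quotient 2M'/rr is the origin of the constant 2. The boundary hypothesis
   gives decay because a pseudofunction tested against exp(iht) phi(t) becomes an average of its
   transform over a window that moves to infinity with h. *)
Require Import Defs.
From HB Require Import structures.
From mathcomp Require Import all_boot all_order all_algebra.
From mathcomp Require Import all_classical all_reals all_analysis.
From mathcomp Require Import complex.
From mathcomp Require Import measurable_realfun ring lra.
Import Order.TTheory GRing.Theory Num.Theory.
Import numFieldNormedType.Exports.
Local Open Scope classical_set_scope.
Local Open Scope ring_scope.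

Set Implicit Arguments.
Unset Strict Implicit.
Unset Printing Implicit Defensive.

(** * Modulus and arithmetic of complex numbers *)

Section Modulus.
Variable R : realType.
Local Notation C := R[i].
Implicit Types z w : C.

Lemma cabsE z : cabs z = Normc.normc z.
Proof. by case: z. Qed.

Lemma cabs_ge0 z : 0 <= cabs z.
Proof. exact: sqrtr_ge0. Qed.

Lemma cabs0 : cabs (0 : C) = 0.
Proof. by rewrite cabsE Normc.normc0. Qed.

Lemma cabs_eq0 z : cabs z = 0 -> z = 0.
Proof. by rewrite cabsE => /Normc.eq0_normc. Qed.

Lemma cabsM z w : cabs (z * w) = cabs z * cabs w.
Proof. by rewrite !cabsE Normc.normcM. Qed.

Lemma cabsV z : cabs z^-1 = (cabs z)^-1.
Proof. by rewrite !cabsE Normc.normcV. Qed.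

Lemma cabsN z : cabs (- z) = cabs z.
Proof. by case: z => a b; rewrite /cabs /= !sqrrN. Qed.

Lemma ler_cabsD z w : cabs (z + w) <= cabs z + cabs w.
Proof. by rewrite !cabsE le_normcD. Qed.

Lemma ler_cabsB z w : cabs (z - w) <= cabs z + cabs w.
Proof. by rewrite -(cabsN w) ler_cabsD. Qed.

Lemma cabs_distC z w : cabs (z - w) = cabs (w - z).
Proof. by rewrite -cabsN opprB. Qed.

Lemma cabs_RtoC (x : R) : cabs (RtoC x) = `|x|.
Proof. by rewrite /cabs /= expr0n /= addr0 sqrtr_sqr. Qed.

Lemma cabs_cexpi (t : R) : cabs (cexpi t) = 1.
Proof. by rewrite /cabs /= cos2Dsin2 sqrtr1. Qed.

Lemma Re_le_cabs z : `|complex.Re z| <= cabs z.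
Proof. by rewrite -sqrtr_sqr ler_wsqrtr// lerDl sqr_ge0. Qed.

Lemma Im_le_cabs z : `|complex.Im z| <= cabs z.
Proof. by rewrite -sqrtr_sqr ler_wsqrtr// lerDr sqr_ge0. Qed.

Lemma cabs_le_ReIm z : cabs z <= `|complex.Re z| + `|complex.Im z|.
Proof.
case: z => a b /=; rewrite -[leRHS]ger0_norm ?addr_ge0// -sqrtr_sqr ler_wsqrtr//=.
rewrite sqrrD !real_normK ?num_real// addrAC lerDl mulrn_wge0//.
Qed.

Lemma ReD z w : complex.Re (z + w) = complex.Re z + complex.Re w.
Proof. by case: z; case: w. Qed.
Lemma ImD z w : complex.Im (z + w) = complex.Im z + complex.Im w.
Proof. by case: z; case: w. Qed.
Lemma ReN z : complex.Re (- z) = - complex.Re z.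
Proof. by case: z. Qed.
Lemma ImN z : complex.Im (- z) = - complex.Im z.
Proof. by case: z. Qed.
Lemma ReM z w : complex.Re (z * w) =
  complex.Re z * complex.Re w - complex.Im z * complex.Im w.
Proof. by case: z; case: w. Qed.
Lemma ImM z w : complex.Im (z * w) =
  complex.Re z * complex.Im w + complex.Im z * complex.Re w.
Proof. by case: z; case: w. Qed.

Lemma eqC z w : complex.Re z = complex.Re w -> complex.Im z = complex.Im w -> z = w.
Proof. by case: z => a b; case: w => c d /= -> ->. Qed.

Lemma RtoCM (x y : R) : RtoC (x * y) = RtoC x * RtoC y.
Proof. by apply: eqC; rewrite ?ReM ?ImM /=; ring. Qed.
Lemma RtoCD (x y : R) : RtoC (x + y) = RtoC x + RtoC y.
Proof. by apply: eqC; rewrite ?ReD ?ImD /=; ring. Qed.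
Lemma RtoCN (x : R) : RtoC (- x) = - RtoC x.
Proof. by apply: eqC; rewrite ?ReN ?ImN /=; ring. Qed.
Lemma RtoCB (x y : R) : RtoC (x - y) = RtoC x - RtoC y.
Proof. by rewrite RtoCD RtoCN. Qed.
Lemma RtoC0 : RtoC (0 : R) = 0. Proof. by []. Qed.
Lemma RtoC1 : RtoC (1 : R) = 1. Proof. by []. Qed.

Lemma cexpiD (x y : R) : cexpi (x + y) = cexpi x * cexpi y.
Proof. by apply: eqC; rewrite ?ReM ?ImM /= ?cosD ?sinD; ring. Qed.
Lemma cexpi0 : cexpi (0 : R) = 1.
Proof. by apply: eqC; rewrite /= ?cos0 ?sin0. Qed.
End Modulus.

(** Domains of integration are written as 0/1 factors, real here and complex in [ind], so that every
    integral runs over the whole line and a change of domain is pointwise algebra. *)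
Definition rind {R : realType} (b : bool) : R := b%:R.
Definition ind {R : realType} (b : bool) : R[i] := RtoC (rind b).

Lemma rindE (R : realType) (b : bool) : rind b = (if b then 1 else 0) :> R.
Proof. by case: b. Qed.

Lemma cabs1 (R : realType) : cabs (1 : R[i]) = 1.
Proof. by rewrite cabsE Normc.normc1. Qed.

(** * Measurability of complex-valued functions *)

Section ComplexMeasurable.
Context d (T : measurableType d) (R : realType).
Local Notation C := R[i].
Implicit Types f g : T -> C.

Definition cmf f := measurable_fun setT (fun x => complex.Re (f x)) /\
  measurable_fun setT (fun x => complex.Im (f x)).

Lemma cmf_cst (c : C) : cmf (fun=> c).
Proof. by split; exact: measurable_cst. Qed.

Lemma cmfD f g : cmf f -> cmf g -> cmf (fun x => f x + g x).
Proof.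
move=> [a b] [c e]; split.
  by under eq_fun do rewrite ReD; exact: measurable_funD.
by under eq_fun do rewrite ImD; exact: measurable_funD.
Qed.

Lemma cmfN f : cmf f -> cmf (fun x => - f x).
Proof.
move=> [a b]; split.
  by under eq_fun do rewrite ReN; exact: measurableT_comp.
by under eq_fun do rewrite ImN; exact: measurableT_comp.
Qed.

Lemma cmfB f g : cmf f -> cmf g -> cmf (fun x => f x - g x).
Proof. by move=> a b; apply: cmfD => //; exact: cmfN. Qed.

Lemma cmfM f g : cmf f -> cmf g -> cmf (fun x => f x * g x).
Proof.
move=> [a b] [c e]; split.
  by under eq_fun do rewrite ReM; apply: measurable_funB; apply: measurable_funM.
by under eq_fun do rewrite ImM; apply: measurable_funD; apply: measurable_funM.
Qed.

Lemma cmf_RtoC (b : T -> R) : measurable_fun setT b -> cmf (fun x => RtoC (b x)).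
Proof. by move=> mb; split => //=; exact: measurable_cst. Qed.

Lemma cmf_cexpi (b : T -> R) : measurable_fun setT b -> cmf (fun x => cexpi (b x)).
Proof.
move=> mb; split => /=; apply: measurableT_comp => //.
  by apply: continuous_measurable_fun => ?; exact: continuous_cos.
by apply: continuous_measurable_fun => ?; exact: continuous_sin.
Qed.

Lemma measurable_rind (b : T -> bool) : measurable_fun setT b ->
  measurable_fun setT (fun x => rind (b x) : R).
Proof.
move=> mb; rewrite (_ : (fun x => rind (b x)) = (fun x => if b x then 1 else 0)).
  by apply: measurable_fun_ifT.
by apply/funext => x; case: (b x).
Qed.

Lemma cmf_ind (b : T -> bool) : measurable_fun setT b ->
  cmf (fun x => ind (b x) : R[i]).
Proof. by move=> mb; apply: cmf_RtoC; exact: measurable_rind. Qed.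

Lemma measurable_cabs f : cmf f -> measurable_fun setT (fun x => cabs (f x)).
Proof.
move=> [mr mi]; apply: (@measurableT_comp _ _ _ _ _ _ (@Num.sqrt R)).
  by apply: continuous_measurable_fun => ?; exact: sqrt_continuous.
by apply: measurable_funD; exact: measurable_funX.
Qed.

End ComplexMeasurable.

Lemma cmf_comp d1 (T1 : measurableType d1) d2 (T2 : measurableType d2) (R : realType)
  (f : T2 -> R[i]) (g : T1 -> T2) :
  cmf f -> measurable_fun setT g -> cmf (fun x => f (g x)).
Proof. by move=> [mr mi] mg; split; [exact: (measurableT_comp mr)|exact: (measurableT_comp mi)]. Qed.

(** * Integrals over the line: domination, Fubini, dominated convergence, primitives *)

Section Integrals.
Variable R : realType.
Local Notation C := R[i].
Local Notation mu := (@lebesgue_measure R).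

Definition rint (b : R -> R) := mu.-integrable setT (EFin \o b).
Definition J (b : R -> R) : R := \int[mu]_x b x.
(** Integrability is put on the modulus because the majorants below bound moduli; [ciRe] and [ciIm]
    return to the components. *)
Definition ci (f : R -> C) := cmf f /\ rint (fun x => cabs (f x)).
Definition I (f : R -> C) : C := cint setT f.

Implicit Types (a b : R -> R) (f g : R -> C).

Lemma rint_meas b : rint b -> measurable_fun setT b.
Proof. by move=> /integrableP[/measurable_EFinP]. Qed.

Lemma rint_dom a b : measurable_fun setT b -> rint a ->
  (forall x, `|b x| <= a x) -> rint b.
Proof.
move=> mb ia ba; apply: le_integrable ia => //; first exact/measurable_EFinP.
by move=> x _ /=; rewrite lee_fin (le_trans (ba x))// ler_norm.
Qed.

Lemma rint_norm b : rint b -> rint (fun x => `|b x|).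
Proof.
move=> ib; have mb := rint_meas ib; apply: le_integrable ib => //.
  by apply/measurable_EFinP; exact: measurableT_comp.
by move=> x _ /=; rewrite lee_fin normr_id.
Qed.

Lemma rintD a b : rint a -> rint b -> rint (fun x => a x + b x).
Proof. by move=> ia ib; apply: (integrableD _ ia ib). Qed.

Lemma rintZl (k : R) b : rint b -> rint (fun x => k * b x).
Proof. by move=> ib; apply: (integrableZl _ k ib). Qed.

Lemma JD a b : rint a -> rint b -> J (fun x => a x + b x) = J a + J b.
Proof. by move=> ia ib; exact: RintegralD. Qed.

Lemma JZl (k : R) b : rint b -> J (fun x => k * b x) = k * J b.
Proof. by move=> ib; exact: RintegralZl. Qed.

Lemma le_J a b : rint a -> rint b -> (forall x, a x <= b x) -> J a <= J b.
Proof. by move=> ia ib ab; apply: le_Rintegral. Qed.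

Lemma J_ge0 b : (forall x, 0 <= b x) -> 0 <= J b.
Proof. by move=> b0; exact: Rintegral_ge0. Qed.

Lemma ciRe f : ci f -> rint (fun x => complex.Re (f x)).
Proof. by move=> [[mr mi] i]; apply: rint_dom i _ => // x; exact: Re_le_cabs. Qed.

Lemma ciIm f : ci f -> rint (fun x => complex.Im (f x)).
Proof. by move=> [[mr mi] i]; apply: rint_dom i _ => // x; exact: Im_le_cabs. Qed.

Lemma ci_dom f b : cmf f -> rint b -> (forall x, cabs (f x) <= b x) -> ci f.
Proof.
move=> mf ib fb; split=> //; apply: rint_dom ib _; first exact: measurable_cabs.
by move=> x; rewrite ger0_norm ?cabs_ge0.
Qed.

Lemma ci_ReIm f : rint (fun x => complex.Re (f x)) ->
  rint (fun x => complex.Im (f x)) -> ci f.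
Proof.
move=> ir ii; apply: (@ci_dom _ (fun x => `|complex.Re (f x)| + `|complex.Im (f x)|)).
- by split; exact: rint_meas.
- by apply: rintD; exact: rint_norm.
- by move=> x; exact: cabs_le_ReIm.
Qed.

Lemma ciD f g : ci f -> ci g -> ci (fun x => f x + g x).
Proof.
move=> [mf i] [mg i']; apply: (ci_dom (cmfD mf mg) (rintD i i')) => x.
exact: ler_cabsD.
Qed.

Lemma ciZ (c : C) f : ci f -> ci (fun x => c * f x).
Proof.
move=> [mf i]; apply: (ci_dom (cmfM (cmf_cst _ c) mf) (rintZl (cabs c) i)) => x.
by rewrite cabsM.
Qed.

Lemma ciN f : ci f -> ci (fun x => - f x).
Proof.
move=> [mf i]; apply: (ci_dom (cmfN mf) i) => x; by rewrite cabsN.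
Qed.

Lemma ciB f g : ci f -> ci g -> ci (fun x => f x - g x).
Proof. by move=> a b; apply: ciD => //; exact: ciN. Qed.

Lemma ciM_bnd f g (B : R) : cmf g -> (forall x, cabs (g x) <= B) -> ci f ->
  ci (fun x => g x * f x).
Proof.
move=> mg gB [mf i]; apply: (ci_dom (cmfM mg mf) (rintZl B i)) => x.
by rewrite cabsM ler_wpM2r// cabs_ge0.
Qed.

Lemma eqI f g : f =1 g -> I f = I g.
Proof. by move=> /funext ->. Qed.

Lemma I0 : I (fun=> 0) = 0.
Proof.
by apply: eqC => /=; rewrite Rintegral_cst// mul0r.
Qed.

Lemma ID f g : ci f -> ci g -> I (fun x => f x + g x) = I f + I g.
Proof.
move=> cf cg; apply: eqC; rewrite ?ReD ?ImD /= -RintegralD//; do ?[exact: ciRe|exact: ciIm].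
  by apply: eq_Rintegral => x _; rewrite ReD.
by apply: eq_Rintegral => x _; rewrite ImD.
Qed.

Lemma IZl (c : C) f : ci f -> I (fun x => c * f x) = c * I f.
Proof.
move=> cf; have ir := ciRe cf; have ii := ciIm cf.
apply: eqC; rewrite ?ReM ?ImM /= -!RintegralZl//.
  rewrite -RintegralB//; [|exact: rintZl|exact: rintZl].
  by apply: eq_Rintegral => x _; rewrite ReM.
rewrite -RintegralD//; [|exact: rintZl|exact: rintZl].
by apply: eq_Rintegral => x _; rewrite ImM.
Qed.

Lemma IZr (c : C) f : ci f -> I (fun x => f x * c) = I f * c.
Proof. by move=> cf; rewrite mulrC -IZl//; apply: eqI => x; rewrite mulrC. Qed.

Lemma IN f : ci f -> I (fun x => - f x) = - I f.
Proof. by move=> cf; rewrite -mulN1r -IZl//; apply: eqI => x; rewrite mulN1r. Qed.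

Lemma IB f g : ci f -> ci g -> I (fun x => f x - g x) = I f - I g.
Proof. by move=> cf cg; rewrite ID// ?IN//; exact: ciN. Qed.

(* Rotating the integral onto the positive real axis reduces the complex
   triangle inequality to monotonicity of the real integral. *)
Lemma cabs_I_le f b : cmf f -> rint b -> (forall x, cabs (f x) <= b x) ->
  cabs (I f) <= J b.
Proof.
move=> mf ib fb; have cf := ci_dom mf ib fb.
have [->|n0] := eqVneq (I f) 0.
  by rewrite cabs0; apply: J_ge0 => x; rewrite (le_trans _ (fb x))// cabs_ge0.
have r0 : cabs (I f) != 0 by apply: contra_neq n0 => /cabs_eq0.
pose c := conjc (I f) / RtoC (cabs (I f)).
have cc : c * I f = RtoC (cabs (I f)).
  have E : conjc (I f) * I f = RtoC (cabs (I f)) * RtoC (cabs (I f)).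
    rewrite -RtoCM -expr2 sqr_sqrtr ?addr_ge0 ?sqr_ge0//.
    by case: (I f) => x y; apply: eqC; rewrite ?ReM ?ImM /=; ring.
  rewrite /c mulrAC E mulfK//; apply/eqP => /(congr1 (@complex.Re R)) /= /eqP.
  by rewrite (negbTE r0).
have c1 : cabs c = 1.
  have := congr1 (@cabs R) cc; rewrite cabsM cabs_RtoC ger0_norm ?cabs_ge0// => h.
  by apply: (mulIf r0); rewrite h mul1r.
have -> : cabs (I f) = J (fun x => complex.Re (c * f x)).
  by have := congr1 (@complex.Re R) cc; rewrite -IZl//= => <-.
apply: le_J => //; first by apply: ciRe; exact: ciZ.
move=> x; apply: le_trans (fb x); rewrite -[leRHS]mul1r -c1 -cabsM.
by apply: le_trans (Re_le_cabs _); rewrite ler_norm.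
Qed.

Lemma I_RtoC b : I (fun x => RtoC (b x)) = RtoC (J b).
Proof. by apply: eqC => //=; rewrite Rintegral_cst// mul0r. Qed.

(** Tonelli for the nonnegative majorant [B]: finiteness of its iterated integral in one order
    suffices. *)
Lemma prod_integrable (G B : R * R -> R) :
  measurable_fun setT G -> measurable_fun setT B -> (forall z, `|G z| <= B z) ->
  (\int[mu]_x \int[mu]_y (B (x, y))%:E < +oo)%E ->
  (mu \x mu)%E.-integrable setT (EFin \o G).
Proof.
move=> mG mB GB iB.
have B0 z : 0 <= B z by apply: le_trans (GB z).
have mEB : measurable_fun setT (EFin \o B) by exact/measurable_EFinP.
have iB' : (mu \x mu)%E.-integrable setT (EFin \o B).
  apply: ((@integrable12ltyP _ _ _ _ R mu mu (EFin \o B) mEB).2).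
  rewrite (_ : (fun x => _) = (fun x => \int[mu]_y (B (x, y))%:E)%E)//.
  by apply/funext => x; apply: eq_integral => y _ /=; rewrite ger0_norm.
apply: le_integrable iB' => //; first exact/measurable_EFinP.
by move=> z _ /=; rewrite lee_fin (le_trans (GB z))// ler_norm.
Qed.

Lemma I_fubini_cmf (F : R * R -> C) (B : R * R -> R) :
  cmf F -> measurable_fun setT B -> (forall z, cabs (F z) <= B z) ->
  (\int[mu]_x \int[mu]_y (B (x, y))%:E < +oo)%E ->
  cmf (fun x => I (fun y => F (x, y))).
Proof.
move=> [mr mi] mB FB iB.
have key (G : R * R -> R) : measurable_fun setT G -> (forall z, `|G z| <= B z) ->
    measurable_fun setT (fun x => J (fun y => G (x, y))).
  move=> mG GB; have iG := prod_integrable mG mB GB iB.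
  have m := measurable_int _ (integrable_fubini_F iG).
  by apply: (@measurableT_comp _ _ _ _ _ _ (fine : \bar R -> R) _ _ _ m).
split; first exact: (key (fun z => complex.Re (F z)) mr (fun z => le_trans (Re_le_cabs _) (FB z))).
exact: (key (fun z => complex.Im (F z)) mi (fun z => le_trans (Im_le_cabs _) (FB z))).
Qed.

Lemma I_fubini (F : R * R -> C) (B : R * R -> R) :
  cmf F -> measurable_fun setT B -> (forall z, cabs (F z) <= B z) ->
  (\int[mu]_x \int[mu]_y (B (x, y))%:E < +oo)%E ->
  I (fun x => I (fun y => F (x, y))) = I (fun y => I (fun x => F (x, y))).
Proof.
move=> [mr mi] mB FB iB.
have key (G : R * R -> R) : measurable_fun setT G -> (forall z, `|G z| <= B z) ->
    J (fun x => J (fun y => G (x, y))) = J (fun y => J (fun x => G (x, y))).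
  move=> mG GB; have iG := prod_integrable mG mB GB iB.
  (* The inner integrals of Fubini's theorem are extended reals, finite only almost everywhere,
     while [J] takes [fine] of them; the two versions agree outside a null set. *)
  have fin h : mu.-integrable setT h ->
      (\int[mu]_x (fine (h x))%:E = \int[mu]_x h x)%E.
    move=> ih; have mh := measurable_int _ ih.
    apply: ae_eq_integral => //.
      by apply/measurable_EFinP; exact: measurableT_comp.
    have := integrable_ae measurableT ih; apply: filterS => x /(_ Logic.I) hx _.
    by rewrite fineK.
  rewrite /J /Rintegral (fin _ (integrable_fubini_F iG)).
  have iGs : (mu \x mu)%E.-integrable setT (EFin \o (fun z => G (z.2, z.1))).
    apply/integrable12ltyP; last exact: ((@integrable21ltyP _ _ _ _ _ mu mu (EFin \o G) (measurable_int _ iG)).1 iG).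
    apply/measurable_EFinP; apply: (measurableT_comp mG).
    exact: measurable_fun_pair.
  by rewrite (fin _ (integrable_fubini_F iGs)) (Fubini iG).
apply: eqC; rewrite /I /cint /=.
  exact: (key (fun z => complex.Re (F z)) mr (fun z => le_trans (Re_le_cabs _) (FB z))).
exact: (key (fun z => complex.Im (F z)) mi (fun z => le_trans (Im_le_cabs _) (FB z))).
Qed.

Lemma rint_EJ b : rint b -> (\int[mu]_x (b x)%:E = (J b)%:E)%E.
Proof. by move=> ib; rewrite /J /Rintegral fineK//; exact: (integrable_fin_num measurableT ib). Qed.

Lemma prod_dom_lty a b : rint a -> rint b ->
  (\int[mu]_x \int[mu]_y (a (x, y).1 * b (x, y).2)%:E < +oo)%E.
Proof.
move=> ia ib; have iab : rint (fun x => J b * a x) by exact: rintZl.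
have -> : (\int[mu]_x \int[mu]_y (a (x, y).1 * b (x, y).2)%:E =
           \int[mu]_x (J b * a x)%:E)%E.
  apply: eq_integral => x _ /=; under eq_integral do rewrite EFinM.
  by rewrite (integralZl measurableT ib) rint_EJ// -EFinM mulrC.
by rewrite rint_EJ// ltry.
Qed.

Lemma prod_dom_meas a b : rint a -> rint b ->
  measurable_fun setT (fun z : R * R => a z.1 * b z.2).
Proof.
by move=> ia ib; apply: measurable_funM; apply: measurableT_comp => //; exact: rint_meas.
Qed.

(** A product majorant covers every interchange of integrals below except the one over the half
    circle. *)
Lemma I_fubini_prod (F : R * R -> C) a b :
  cmf F -> rint a -> rint b -> (forall x y, cabs (F (x, y)) <= a x * b y) ->
  I (fun x => I (fun y => F (x, y))) = I (fun y => I (fun x => F (x, y))).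
Proof.
move=> mF ia ib Fab; apply: (I_fubini mF (prod_dom_meas ia ib) _ (prod_dom_lty ia ib)).
by case.
Qed.

Lemma I_fubini_prod_cmf (F : R * R -> C) a b :
  cmf F -> rint a -> rint b -> (forall x y, cabs (F (x, y)) <= a x * b y) ->
  cmf (fun x => I (fun y => F (x, y))).
Proof.
move=> mF ia ib Fab; apply: (I_fubini_cmf mF (prod_dom_meas ia ib) _ (prod_dom_lty ia ib)).
by case.
Qed.

(** Convergence is expressed by the modulus of the difference, which reduces the claim to real
    dominated convergence with majorant [2 * b]. *)
Lemma I_dct (f_ : nat -> R -> C) f b :
  (forall n, cmf (f_ n)) -> cmf f -> rint b ->
  (forall n x, cabs (f_ n x) <= b x) -> (forall x, cabs (f x) <= b x) ->
  (forall x, cabs (f_ n x - f x) @[n --> \oo] --> (0 : R)) ->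
  cabs (I (f_ n) - I f) @[n --> \oo] --> (0 : R).
Proof.
move=> mf_ mf ib f_b fb lim.
have cf_ n : ci (f_ n) by exact: ci_dom (f_b n).
have cf : ci f by exact: ci_dom fb.
pose d n x := cabs (f_ n x - f x).
have md n : measurable_fun setT (d n) by apply: measurable_cabs; exact: cmfB.
have db n x : d n x <= 2 * b x.
  by rewrite mulr_natl mulr2n (le_trans (ler_cabsB _ _))// lerD.
have id n : rint (d n).
  by apply: rint_dom (rintZl 2 ib) _ => // x; rewrite ger0_norm ?cabs_ge0.
have : ((\int[mu]_x (d n x)%:E)%E @[n --> \oo] --> (\int[mu]_x (EFin \o cst 0%R) x)%E)%classic.
  have [] := @dominated_convergence _ _ R mu setT measurableT
    (fun n => EFin \o d n) (EFin \o cst 0) (EFin \o (fun x => 2 * b x)).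
  - by move=> n; apply/measurable_EFinP; exact: md.
  - by apply/measurable_EFinP; exact: measurable_cst.
  - by apply: aeW => x _; apply: cvg_EFin; [exact: nearW|exact: lim].
  - exact: rintZl.
  - by apply: aeW => x n _ /=; rewrite lee_fin ger0_norm ?cabs_ge0.
  - by move=> _ _ h.
rewrite integral0 => /fine_cvgP [_ lim0].
apply: (squeeze_cvgr _ (cvg_cst 0) lim0).
apply: nearW => n; rewrite cabs_ge0 /= -IB//.
by apply: cabs_I_le => //; exact: cmfB.
Qed.

Lemma cint_itv (i : interval R) f :
  cint [set` i] f = I (fun x => ind (x \in i) * f x).
Proof.
have E (g : R -> R) : \int[mu]_(x in [set` i]) g x = J (fun x => rind (x \in i) * g x).
  rewrite Rintegral_mkcond; apply: eq_Rintegral => x _.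
  rewrite /patch; case: ifPn; rewrite (inE, notin_setE) /= => h; first by rewrite h mul1r.
  by rewrite (negbTE (introN idP h)) mul0r.
apply: eqC; rewrite /= E; apply: eq_Rintegral => x _; rewrite ?ReM ?ImM /=; ring.
Qed.

Lemma rint_itv (a b : R) (g : R -> R) : continuous g ->
  rint (fun x => rind (a <= x <= b) * g x).
Proof.
move=> cg; have h : mu.-integrable `[a, b] (EFin \o g).
  apply: continuous_compact_integrable; first exact: segment_compact.
  exact: continuous_subspaceT.
have := (@integrable_mkcond _ _ R mu `[a, b]%classic (EFin \o g) (measurable_itv _)).1 h.
rewrite (_ : (EFin \o g) \_ _ = (EFin \o (fun x => rind (a <= x <= b) * g x)))//.
apply/funext => x; rewrite /patch /= mem_setE in_itv /=.
by case: ifPn; rewrite ?mul1r ?mul0r.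
Qed.

Lemma J_ftc (f F : R -> R) (a b : R) : a <= b -> continuous f ->
  (forall x, is_derive x (1 : R) F (f x)) ->
  J (fun x => rind (a <= x <= b) * f x) = F b - F a.
Proof.
move=> ab cf dF.
have -> : J (fun x => rind (a <= x <= b) * f x) = \int[mu]_(x in `[a, b]) f x.
  rewrite Rintegral_mkcond; apply: eq_Rintegral => x _.
  rewrite /patch mem_setE in_itv /=; by case: ifPn; rewrite ?mul1r ?mul0r.
move: ab; rewrite le_eqVlt => /predU1P[<-|ab].
  by rewrite set_itv1 Rintegral_set1 subrr.
have cF : continuous F.
  by move=> x; apply: differentiable_continuous; apply/derivable1_diffP; case: (dF x).
rewrite /Rintegral (@continuous_FTC2 _ f F)//.
- exact: continuous_subspaceT.
- split => [x _||]; first by case: (dF x).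
    by apply: cvg_at_right_filter; exact: cF.
  by apply: cvg_at_left_filter; exact: cF.
- by move=> x _; rewrite derive1E; case: (dF x).
Qed.

Definition cderive (F : R -> C) (f : R -> C) := forall x,
  is_derive x (1 : R) (fun y => complex.Re (F y)) (complex.Re (f x)) /\
  is_derive x (1 : R) (fun y => complex.Im (F y)) (complex.Im (f x)).

Definition ccont (f : R -> C) := continuous (fun y => complex.Re (f y)) /\
  continuous (fun y => complex.Im (f y)).

Lemma ccont_cmf f : ccont f -> cmf f.
Proof. by move=> [cr ci]; split; exact: continuous_measurable_fun. Qed.

Lemma I_ftc (f F : R -> C) (a b : R) : a <= b -> ccont f -> cderive F f ->
  I (fun x => ind (a <= x <= b) * f x) = F b - F a.
Proof.
move=> ab [cr ci] dF; apply: eqC; rewrite ?ReD ?ImD ?ReN ?ImN /=.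
  rewrite -(J_ftc ab cr (fun x => (dF x).1)).
  by apply: eq_Rintegral => x _; rewrite ReM /= mul0r subr0.
rewrite -(J_ftc ab ci (fun x => (dF x).2)).
by apply: eq_Rintegral => x _; rewrite ImM /= mul0r addr0.
Qed.

Lemma ci_itv (a b : R) f : ccont f -> ci (fun x => ind (a <= x <= b) * f x).
Proof.
move=> [cr ci]; apply: ci_ReIm.
  under eq_fun do rewrite ReM /= mul0r subr0; exact: rint_itv.
under eq_fun do rewrite ImM /= mul0r addr0; exact: rint_itv.
Qed.

Lemma indE (b : bool) : ind b = (if b then 1 else 0) :> C.
Proof. by case: b. Qed.

Lemma cabs_ind_le1 (b : bool) : cabs (ind b : C) <= 1.
Proof. by rewrite cabs_RtoC; case: b; rewrite ?normr1 ?normr0. Qed.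

(* Integration by parts against a primitive of [w], as Fubini on [v < u]. *)
Lemma I_primitive (w g : R -> C) a b :
  cmf w -> cmf g -> rint a -> rint b ->
  (forall u v, v < u -> cabs (w v) * cabs (g u) <= a v * b u) ->
  (forall u v, 0 <= a v * b u) ->
  I (fun u => g u * I (fun v => ind (v < u) * w v)) =
  I (fun v => w v * I (fun u => ind (v < u) * g u)).
Proof.
move=> mw mg ia ib wg ab0.
have mlt : measurable_fun [set: R * R] (fun z => z.2 < z.1).
  by apply: measurable_fun_ltr.
have dom u v : cabs (ind (v < u) * (w v * g u)) <= b u * a v.
  rewrite indE; case: ifPn => vu; last by rewrite mul0r cabs0 mulrC.
  by rewrite mul1r cabsM mulrC [leRHS]mulrC mulrC wg.
have mF : cmf (fun z : R * R => ind (z.2 < z.1) * (w z.2 * g z.1)).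
  apply: cmfM; first exact: cmf_ind.
  by apply: cmfM; [apply: (cmf_comp mw)|apply: (cmf_comp mg)].
have := @I_fubini_prod _ b a mF ib ia dom.
rewrite (@eqI _ (fun u => g u * I (fun v => ind (v < u) * w v))); last first.
  (* Moving [g u] under the integral sign requires integrability of [ind (v < u) * w v] in v, which
     the product majorant gives only after division by the modulus of [g u]. *)
  move=> u /=; have [->|gu0] := eqVneq (g u) 0.
    by rewrite mul0r -[RHS]I0; apply: eqI => v; ring.
  rewrite -IZl; first by apply: eqI => v; ring.
  have cu0 : 0 < cabs (g u).
    by rewrite lt_neqAle cabs_ge0 andbT eq_sym; apply: contra_neq gu0 => /cabs_eq0.
  apply: (ci_dom _ (rintZl (b u / cabs (g u)) ia)) => [|v].
    apply: cmfM => //; apply: cmf_ind; apply: measurable_fun_ltr => //.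
  rewrite -(ler_pM2r cu0) -cabsM -mulrA; apply: le_trans (dom u v) _.
  by rewrite le_eqVlt; apply/orP; left; apply/eqP; field; rewrite gt_eqF.
move=> ->; apply: eqI => v /=; have [->|wv0] := eqVneq (w v) 0.
  by rewrite mul0r -[RHS]I0; apply: eqI => u; ring.
rewrite -IZl; first by apply: eqI => u; ring.
have cv0 : 0 < cabs (w v).
  by rewrite lt_neqAle cabs_ge0 andbT eq_sym; apply: contra_neq wv0 => /cabs_eq0.
apply: (ci_dom _ (rintZl (a v / cabs (w v)) ib)) => [|u].
  apply: cmfM => //; apply: cmf_ind; apply: measurable_fun_ltr => //.
rewrite -(ler_pM2r cv0) -cabsM [X in cabs X](_ : _ = ind (v < u) * (w v * g u)); last by ring.
apply: le_trans (dom u v) _.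
by rewrite le_eqVlt; apply/orP; left; apply/eqP; field; rewrite gt_eqF.
Qed.

(** The common integrable majorant: transforms of test functions are bounded by a multiple of its
    square, so that even a linearly growing factor leaves a multiple of [q]. *)
Definition q (x : R) : R := (1 + x ^+ 2)^-1.

Lemma q_gt0 x : 0 < q x.
Proof. by rewrite invr_gt0 ltr_pwDl// sqr_ge0. Qed.

Lemma continuous_q : continuous q.
Proof. exact: continuous_oneDsqrV. Qed.

(** The half-line arctangent integral is doubled by symmetry and then rescaled by an affine
    substitution. *)
Lemma integral_q (s h : R) : 0 < s ->
  (\int[mu]_x (q (s * (x - h)))%:E = (pi / s)%:E)%E.
Proof.
move=> s0.
have E : (\int[mu]_x (q x)%:E = pi%:E)%E.
  rewrite ge0_symfun_integralT.
  + rewrite (_ : \int[mu]_(x in _) _ = (pi / 2)%:E)%E; last first.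
      rewrite -integral0y_oneDsqr set_itvcy; by apply: eq_integral.
    by rewrite -EFinM; congr EFin; field.
  + by move=> x; rewrite ltW// q_gt0.
  + exact: continuous_q.
  + by move=> x /=; rewrite /q sqrrN.
pose F (x : R) := s * (x - h).
have dF (x : R) : is_derive x (1 : R) F s.
  by apply: is_derive_eq; rewrite /= !(mulr1, subr0, addr0) ?scaler1 // /GRing.scale /= mulr1.
have F' : (F^`())%classic = cst s.
  by apply/funext => x; rewrite derive1E; case: (dF x).
have cF : continuous F.
  by move=> x; apply: differentiable_continuous; apply/derivable1_diffP; case: (dF x).
have sub : (\int[mu]_x (q x)%:E = \int[mu]_x (q (F x) * s)%:E)%E.
  have -> : (fun x => (q (F x) * s)%:E) = (fun x => ((((q \o F) * (F^`())%classic) : R -> R) x)%:E).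
    by rewrite F'.
  apply: increasing_ge0_integration_by_substitutionT; rewrite ?F'.
- by move=> x y xy; rewrite /F ltr_pM2l// ltrD2r.
- by move=> x; exact: cvg_cst.
- exact: is_cvg_cst.
- exact: is_cvg_cst.
- by move=> x; case: (dF x).
- apply/cvgrNyPle => A; near=> x; rewrite /F -ler_pdivlMl// lerBlDr; near: x.
  by apply: nbhs_ninfty_le; rewrite num_real.
- apply/cvgryPge => A; near=> x; rewrite /F -ler_pdivrMl// lerBrDr; near: x.
  by apply: nbhs_pinfty_ge; rewrite num_real.
- exact: continuous_q.
- by move=> x; rewrite ltW// q_gt0.
have iqF : mu.-integrable setT (EFin \o (fun x => q (F x) * s)).
  apply/integrableP; split.
    apply/measurable_EFinP; apply: measurable_funM => //.
    apply: continuous_measurable_fun => x; apply: continuous_comp; first exact: cF.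
    exact: continuous_q.
  have -> : (\int[mu]_x `|(q (F x) * s)%:E| = \int[mu]_x (q (F x) * s)%:E)%E.
    by apply: eq_integral => x _ /=; rewrite ger0_norm// mulr_ge0// ltW// q_gt0.
  by rewrite -sub E ltry.
transitivity (\int[mu]_x (s^-1%:E * (q (F x) * s)%:E))%E.
  by apply: eq_integral => x _; rewrite -EFinM; congr EFin; rewrite /F; field; rewrite gt_eqF.
by rewrite (integralZl measurableT iqF) -sub E -EFinM mulrC.
Unshelve. all: by end_near. Qed.

Lemma rint_q (s h : R) : 0 < s -> rint (fun x => q (s * (x - h))).
Proof.
move=> s0; apply/integrableP; split.
  apply/measurable_EFinP; apply: measurableT_comp; first exact: continuous_measurable_fun continuous_q.
  by apply: measurable_funM => //; apply: measurable_funB.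
have -> : (\int[mu]_x `|(q (s * (x - h)))%:E| = \int[mu]_x (q (s * (x - h)))%:E)%E.
  by apply: eq_integral => x _ /=; rewrite ger0_norm// ltW// q_gt0.
by rewrite integral_q// ltry.
Qed.

Lemma J_q (s h : R) : 0 < s -> J (fun x => q (s * (x - h))) = pi / s.
Proof. by move=> s0; rewrite /J /Rintegral integral_q. Qed.

Lemma rint_q1 (h : R) : rint (fun x => q (x - h)).
Proof. by under eq_fun => x do rewrite -[x - h]mul1r; exact: rint_q. Qed.

Lemma J_q1 (h : R) : J (fun x => q (x - h)) = pi.
Proof. by under eq_fun => x do rewrite -[x - h]mul1r; rewrite J_q// divr1. Qed.

End Integrals.

(** * Smooth functions of a real variable and a smooth transition from 0 to 1 *)

Section Smooth.
Variable R : realType.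
Implicit Types f g : R -> R.

(** Differentiability of order n, by recursion on the derivative. Closure under products, inverses
    and composition goes by induction on n in this form, whereas [smooth] speaks of all iterated
    derivatives at once. *)
Fixpoint Cn n f : Prop :=
  if n is m.+1 then (forall x, derivable f x 1) /\ Cn m (derive1 f) else True.

Lemma smooth_derivable f : smooth f -> forall x, derivable f x 1.
Proof. by move=> sf x; exact: (sf 0%N x). Qed.

Lemma smooth_derive1 f : smooth f -> smooth (derive1 f).
Proof. by move=> sf n x; have := sf n.+1 x; rewrite derive1Sn. Qed.

Lemma smoothP f : smooth f <-> forall n, Cn n f.
Proof.
split => [sf n|Cf n].
  elim: n f sf => [//|n IH] f sf; split; first exact: smooth_derivable.
  exact/IH/smooth_derive1.
elim: n f Cf => [|n IH] f Cf x; first exact: (Cf 1%N).1.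
by rewrite derive1Sn; apply: IH => m; exact: (Cf m.+1).2.
Qed.

Lemma smooth_is_derive f : smooth f -> forall x, is_derive x (1 : R) f (derive1 f x).
Proof. by move=> sf x; rewrite derive1E; apply: derivableP; exact: smooth_derivable. Qed.

Lemma smooth_continuous f : smooth f -> continuous f.
Proof.
move=> sf x; apply: differentiable_continuous; apply/derivable1_diffP.
exact: smooth_derivable.
Qed.

Lemma der_eq f (x a b : R) : is_derive x (1 : R) f a -> a = b ->
  is_derive x (1 : R) f b.
Proof. by move=> df <-. Qed.

Lemma d_cst (c x : R) : is_derive x (1 : R) (fun=> c) 0.
Proof. exact: is_derive_cst. Qed.

Lemma d_id (x : R) : is_derive x (1 : R) (fun x => x) 1.
Proof. exact: is_derive_id. Qed.

Lemma dD f g x (a b : R) : is_derive x (1 : R) f a -> is_derive x (1 : R) g b ->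
  is_derive x (1 : R) (fun x => f x + g x) (a + b).
Proof. by move=> df dg; exact: (is_deriveD df dg). Qed.

Lemma dM f g x (a b : R) : is_derive x (1 : R) f a -> is_derive x (1 : R) g b ->
  is_derive x (1 : R) (fun x => f x * g x) (f x * b + g x * a).
Proof. by move=> df dg; exact: (is_deriveM df dg). Qed.

Lemma dZ (c : R) f x (a : R) : is_derive x (1 : R) f a ->
  is_derive x (1 : R) (fun x => c * f x) (c * a).
Proof.
move=> df; apply: der_eq (dM (d_cst c x) df) _.
by rewrite mulr0 addr0.
Qed.

Lemma dN f x (a : R) : is_derive x (1 : R) f a ->
  is_derive x (1 : R) (fun x => - f x) (- a).
Proof. by move=> df; exact: (is_deriveN df). Qed.

Lemma dB f g x (a b : R) : is_derive x (1 : R) f a -> is_derive x (1 : R) g b ->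
  is_derive x (1 : R) (fun x => f x - g x) (a - b).
Proof. by move=> df dg; apply: dD df _; exact: dN. Qed.

Lemma d_comp f g x (a b : R) : is_derive (g x) (1 : R) f a ->
  is_derive x (1 : R) g b -> is_derive x (1 : R) (fun x => f (g x)) (a * b).
Proof. by move=> df dg; exact: (is_derive1_comp df dg). Qed.

Lemma dV f x (a : R) : f x != 0 -> is_derive x (1 : R) f a ->
  is_derive x (1 : R) (fun x => (f x)^-1) (- (f x)^-1 * (f x)^-1 * a).
Proof.
move=> fx0 [df <-]; split; first exact: derivableV.
by rewrite deriveV// /GRing.scale /= -exprVn expr2 !mulNr.
Qed.

Lemma dX f n x (a : R) : is_derive x (1 : R) f a ->
  is_derive x (1 : R) (fun x => f x ^+ n : R) (n%:R * f x ^+ n.-1 * a).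
Proof.
move=> df; elim: n => [|n IH]; first by apply: der_eq (d_cst 1 x) _; rewrite !mul0r.
have -> : (fun x0 => f x0 ^+ n.+1) = (fun x0 => f x0 * f x0 ^+ n).
  by apply/funext => y; rewrite exprS.
apply: der_eq (dM df IH) _; case: n {IH} => [|n] /=; first by rewrite expr0; ring.
by rewrite -[in RHS]addn1 natrD exprS; ring.
Qed.

Lemma derive1_is_derive f g : (forall x, is_derive x (1 : R) f (g x)) -> derive1 f = g.
Proof. by move=> fg; apply/funext => x; rewrite derive1E; case: (fg x). Qed.

Lemma CnS f g n : (forall x, is_derive x (1 : R) f (g x)) -> Cn n g -> Cn n.+1 f.
Proof.
by move=> fg gn; split; [move=> x; case: (fg x)|rewrite (derive1_is_derive fg)].
Qed.

Lemma CnS_is_derive f n : Cn n.+1 f -> forall x, is_derive x (1 : R) f (derive1 f x).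
Proof. by move=> [df _] x; rewrite derive1E; apply: derivableP. Qed.

Lemma CnW f n : Cn n.+1 f -> Cn n f.
Proof. by elim: n f => [//|n IH] f [df Cf]; split => //; exact: IH. Qed.

Lemma Cn_cst (c : R) n : Cn n (fun=> c).
Proof.
elim: n c => [//|n IH] c; apply: (@CnS _ (fun=> 0)) => // x; exact: is_derive_cst.
Qed.

Lemma Cn_id n : Cn n id.
Proof.
case: n => [//|n]; apply: (@CnS _ (fun=> 1)); exact: Cn_cst.
Qed.

Lemma CnD f g n : Cn n f -> Cn n g -> Cn n (fun x => f x + g x).
Proof.
elim: n f g => [//|n IH] f g Cf Cg.
apply: (@CnS _ (fun x => derive1 f x + derive1 g x)); last by apply: IH; [case: Cf|case: Cg].
by move=> x; apply: dD; apply: CnS_is_derive; [exact: Cf|exact: Cg].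
Qed.

Lemma CnM f g n : Cn n f -> Cn n g -> Cn n (fun x => f x * g x).
Proof.
elim: n f g => [//|n IH] f g Cf Cg.
apply: (@CnS _ (fun x => f x * derive1 g x + g x * derive1 f x)); last first.
  by apply: CnD; apply: IH; do ?[exact: CnW]; [case: Cg|case: Cf].
by move=> x; have df := CnS_is_derive Cf; have dg := CnS_is_derive Cg; exact: dM.
Qed.

Lemma CnV f n : (forall x, f x != 0) -> Cn n f -> Cn n (fun x => (f x)^-1).
Proof.
move=> f0; elim: n => [//|n IH] Cf.
apply: (@CnS _ (fun x => - 1 * (f x)^-1 * (f x)^-1 * derive1 f x)); last first.
  apply: CnM; last by case: Cf.
  do 2 (apply: CnM; last by apply: IH; exact: CnW); exact: Cn_cst.
move=> x; have df := CnS_is_derive Cf.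
by apply: der_eq (dV (f0 x) (df x)) _; rewrite mulN1r.
Qed.

Lemma Cn_comp f g n : Cn n f -> Cn n g -> Cn n (fun x => f (g x)).
Proof.
elim: n f => [//|n IH] f Cf Cg.
apply: (@CnS _ (fun x => derive1 f (g x) * derive1 g x)); last first.
  by apply: CnM; [apply: IH; [case: Cf|exact: CnW]|case: Cg].
by move=> x; have df := CnS_is_derive Cf; have dg := CnS_is_derive Cg; exact: d_comp.
Qed.

Lemma smooth_cst (c : R) : smooth (fun=> c : R).
Proof. by apply/smoothP => n; exact: Cn_cst. Qed.
Lemma smooth_id : smooth (id : R -> R).
Proof. by apply/smoothP => n; exact: Cn_id. Qed.
Lemma smoothD f g : smooth f -> smooth g -> smooth (fun x => f x + g x).
Proof. by move=> /smoothP Cf /smoothP Cg; apply/smoothP => n; exact: CnD. Qed.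
Lemma smoothM f g : smooth f -> smooth g -> smooth (fun x => f x * g x).
Proof. by move=> /smoothP Cf /smoothP Cg; apply/smoothP => n; exact: CnM. Qed.
Lemma smoothV f : (forall x, f x != 0) -> smooth f -> smooth (fun x => (f x)^-1).
Proof. by move=> f0 /smoothP Cf; apply/smoothP => n; exact: CnV. Qed.
Lemma smooth_comp f g : smooth f -> smooth g -> smooth (fun x => f (g x)).
Proof. by move=> /smoothP Cf /smoothP Cg; apply/smoothP => n; exact: Cn_comp. Qed.
Lemma smoothZ (c : R) f : smooth f -> smooth (fun x => c * f x).
Proof. by move=> sf; apply: smoothM _ sf; exact: smooth_cst. Qed.
Lemma smoothN f : smooth f -> smooth (fun x => - f x).
Proof. by move=> sf; under eq_fun do rewrite -mulN1r; exact: smoothZ. Qed.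
Lemma smoothB f g : smooth f -> smooth g -> smooth (fun x => f x - g x).
Proof. by move=> sf sg; apply: smoothD sf _; exact: smoothN. Qed.
Lemma smooth_primitive f g : (forall x, is_derive x (1 : R) f (g x)) ->
  smooth g -> smooth f.
Proof.
move=> fg /smoothP Cg; apply/smoothP => -[//|n]; exact: CnS (Cg n).
Qed.

Lemma smooth_cos : smooth (cos : R -> R) /\ smooth (sin : R -> R).
Proof.
suff H n : Cn n (cos : R -> R) /\ Cn n (sin : R -> R).
  by split; apply/smoothP => n; case: (H n).
elim: n => [//|n [Cc Cs]]; split.
  apply: (@CnS _ (fun x => - 1 * sin x)); last by apply: CnM => //; exact: Cn_cst.
  by move=> x; rewrite mulN1r; exact: is_derive_cos.
by apply: (@CnS _ cos) => // x; exact: is_derive_sin.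
Qed.

(* For every k, x^-k exp(-1/x) extends smoothly by 0 to x <= 0; the family is
   closed under differentiation up to linear combinations. *)
Definition fexp k (x : R) : R := if 0 < x then x ^- k * expR (- x^-1) else 0.

Lemma fexp_ge0 k x : 0 <= fexp k x.
Proof.
rewrite /fexp; case: ifPn => // x0.
by rewrite mulr_ge0 ?expR_ge0// invr_ge0 exprn_ge0// ltW.
Qed.

Lemma fexp_gt0 k x : 0 < x -> 0 < fexp k x.
Proof. by move=> x0; rewrite /fexp x0 mulr_gt0 ?expR_gt0// invr_gt0 exprn_gt0. Qed.

Lemma fexp_le0 k x : x <= 0 -> fexp k x = 0.
Proof. by rewrite /fexp ltNge => ->. Qed.

(** Vanishing to second order at 0 is what makes the difference quotient there tend to 0. The bound
    is [y <= expR y] for y = 1 / (m x), raised to the power m = k + 2. *)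
Lemma fexp_sqr_bound k : exists c : R, 0 < c /\ forall x, fexp k x <= c * x ^+ 2.
Proof.
pose m := k.+2; exists (m%:R ^+ m); split; first by rewrite exprn_gt0// ltr0n.
move=> x; rewrite /fexp; case: ifPn => x0; last by rewrite mulr_ge0 ?sqr_ge0// exprn_ge0.
have xn0 : x != 0 by rewrite gt_eqF.
have m0 : (m%:R : R) != 0 by rewrite pnatr_eq0.
have H : x^-1 ^+ m <= m%:R ^+ m * expR (x^-1).
  have -> : expR (x^-1) = expR (x^-1 / m%:R) ^+ m.
    by rewrite -expRM_natl; congr expR; rewrite mulrCA divff ?mulr1.
  rewrite -exprMn; apply: lerXn2r; rewrite ?nnegrE ?invr_ge0 ?(ltW x0)//.
  rewrite -ler_pdivrMl ?ltr0n// mulrC; apply: le_trans (expR_ge1Dx _).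
  by rewrite lerDr.
rewrite expRN -ler_pdivlMr ?invr_gt0 ?expR_gt0// invrK.
have -> : x ^- k = x^-1 ^+ m * x ^+ 2.
  by rewrite /m !exprS -exprVn; field.
by rewrite [leRHS]mulrAC ler_wpM2r// sqr_ge0.
Qed.

Lemma is_derive_fexp k x :
  is_derive x (1 : R) (fexp k) (fexp k.+2 x - k%:R * fexp k.+1 x).
Proof.
have [x0|x0|->] := ltgtP x 0.
- rewrite !fexp_le0 ?ltW// mulr0 subr0.
  apply: near_eq_is_derive (d_cst 0 x).
  near=> y; rewrite /= fexp_le0// ltW//; near: y; exact: lt_nbhsl.
- pose g := fun y : R => y ^- k * expR (- y^-1).
  apply: (@near_eq_is_derive _ _ _ g).
    near=> y; rewrite /fexp ifT//; near: y; exact: lt_nbhsr.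
  have xn0 : x != 0 by rewrite gt_eqF.
  have dinv : is_derive x (1 : R) (fun y => y^-1) (- x^-1 * x^-1 * 1).
    exact: (dV xn0 (d_id x)).
  have dk : is_derive x (1 : R) (fun y => y ^- k) (- (k%:R * x ^- k.+1)).
    have -> : (fun y : R => y ^- k) = (fun y => y^-1 ^+ k).
      by apply/funext => y; rewrite exprVn.
    apply: der_eq (dX k dinv) _.
    case: (k) => [|m]; first by rewrite !mul0r oppr0.
    by rewrite /= -!exprVn !exprS; ring.
  apply: der_eq (dM dk (d_comp (is_derive_expR _) (dN dinv))) _.
  by rewrite /fexp x0 -!exprVn !exprS; ring.
- rewrite !fexp_le0// mulr0 subr0.
  have [c [c0 fc]] := fexp_sqr_bound k.
  have L : (fun h : R => h^-1 *: ((fexp k \o shift 0) (h *: 1) - fexp k 0)) @ 0^' --> (0 : R).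
    apply/cvgrPdist_le => e e0; near=> h.
    rewrite /= (fexp_le0 _ (lexx 0)) addr0 subr0 sub0r normrN /GRing.scale /= mulr1 normrM.
    have hn0 : h != 0 by near: h; exact: nbhs_dnbhs_neq.
    rewrite (ger0_norm (fexp_ge0 _ _)) normfV ler_pdivrMl ?normr_gt0//.
    apply: le_trans (fc h) _; rewrite -real_normK ?num_real// expr2 mulrA mulrC ler_wpM2l//.
    rewrite -ler_pdivlMl//; near: h.
    apply: dnbhs0_le; by rewrite mulr_gt0 ?invr_gt0.
  apply: DeriveDef; first by apply/cvg_ex; exists 0.
  exact: cvg_lim.
Unshelve. all: by end_near. Qed.

Lemma smooth_fexp k : smooth (fexp k).
Proof.
apply/smoothP => n; elim: n k => [//|n IH] k.
apply: CnS; first by move=> x; exact: is_derive_fexp.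
by apply: CnD => //; under eq_fun do rewrite -mulNr; apply: CnM => //; exact: Cn_cst.
Qed.

(** The classical smooth transition between 0 and 1. Its derivative will serve as averaging density,
    and differences of its translates as a partition of unity. *)
Definition step (x : R) : R := fexp 0 x / (fexp 0 x + fexp 0 (1 - x)).

Lemma step_den x : 0 < fexp 0 x + fexp 0 (1 - x).
Proof.
have [x0|x0] := ltP 0 x; first by rewrite ltr_pwDl ?fexp_gt0 ?fexp_ge0.
by rewrite ltr_wpDl ?fexp_gt0 ?fexp_ge0//; lra.
Qed.

Lemma step_le0 x : x <= 0 -> step x = 0.
Proof. by move=> x0; rewrite /step fexp_le0// mul0r. Qed.

Lemma step_ge1 x : 1 <= x -> step x = 1.
Proof.
move=> x1; rewrite /step (@fexp_le0 0 (1 - x)) ?subr_le0// addr0 divff// gt_eqF//.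
by apply: fexp_gt0; lra.
Qed.

Lemma smooth_step : smooth step.
Proof.
have s1 : smooth (fun x => fexp 0 (1 - x)).
  apply: (@smooth_comp (fexp 0) (fun x => 1 - x)); first exact: smooth_fexp.
  by apply: smoothB; [exact: smooth_cst|exact: smooth_id].
apply: smoothM; first exact: smooth_fexp.
apply: smoothV; first by move=> x; rewrite gt_eqF// step_den.
by apply: smoothD _ s1; exact: smooth_fexp.
Qed.

(** Makes the averaging weight [wfun] nonnegative, so that estimates pass through the average
    without loss. *)
Lemma step_derive_ge0 x : 0 <= derive1 step x.
Proof.
have d1 := is_derive_fexp 0 x.
have d2 : is_derive x (1 : R) (fun x : R => fexp 0 (1 - x)) (- fexp 2 (1 - x)).
  have d3 := is_derive_fexp 0 (1 - x).
  apply: der_eq (@d_comp (fexp 0) (fun x => 1 - x) _ _ _ d3 (dB (d_cst 1 x) (d_id x))) _; ring.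
have dn : fexp 0 x + fexp 0 (1 - x) != 0 by rewrite gt_eqF// step_den.
have : is_derive x (1 : R) step ((fexp 2 x * fexp 0 (1 - x) + fexp 0 x * fexp 2 (1 - x)) /
   (fexp 0 x + fexp 0 (1 - x)) ^+ 2).
  by apply: der_eq (dM d1 (@dV (fun x : R => fexp 0 x + fexp 0 (1 - x)) _ _ dn (dD d1 d2))) _; rewrite mul0r subr0; field.
move=> h; rewrite derive1E; case: h => _ ->.
by rewrite divr_ge0 ?sqr_ge0// addr_ge0// mulr_ge0 ?fexp_ge0.
Qed.

End Smooth.

(** * Fourier transforms of test functions: decay, continuity, modulation *)

Section FourierTest.
Variable R : realType.
Local Notation C := R[i].
Implicit Types (phi psi : R -> R) (a b : R).

(** Real profiles are enough: each complex test function submitted to the boundary hypothesis is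
    [cexpi (h * t)] times one of these. *)
Definition tst a b phi := smooth phi /\ forall t, ~~ (a <= t <= b) -> phi t = 0.

Definition Fh phi (x : R) : C := I (fun t => cexpi (- (x * t)) * RtoC (phi t)).

Lemma tstW a b a' b' phi : a' <= a -> b <= b' -> tst a b phi -> tst a' b' phi.
Proof.
move=> aa bb [sp p0]; split=> // t ht; apply: p0; apply: contra ht => /andP[h1 h2].
by rewrite (le_trans aa h1) (le_trans h2 bb).
Qed.

Lemma tstD a b phi psi : tst a b phi -> tst a b psi -> tst a b (fun t => phi t + psi t).
Proof.
move=> [s1 z1] [s2 z2]; split; first exact: smoothD.
by move=> t ht; rewrite z1// z2// addr0.
Qed.

Lemma tstM a b phi psi : tst a b phi -> smooth psi -> tst a b (fun t => phi t * psi t).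
Proof.
move=> [s1 z1] s2; split; first exact: smoothM.
by move=> t ht; rewrite z1// mul0r.
Qed.

Lemma tstZ a b c phi : tst a b phi -> tst a b (fun t => c * phi t).
Proof.
move=> [s1 z1]; split; first exact: smoothZ.
by move=> t ht; rewrite z1// mulr0.
Qed.

Lemma tst_derive a b phi : tst a b phi -> tst a b (derive1 phi).
Proof.
move=> [sp p0]; split; first exact: smooth_derive1.
move=> t ht; rewrite derive1E.
have : is_derive t (1 : R) phi 0; last by case.
apply: near_eq_is_derive (d_cst 0 t).
have : t < a \/ b < t by move: ht; rewrite negb_and -!ltNge => /orP.
case=> h; near=> s; rewrite p0//.
  by rewrite negb_and -ltNge; apply/orP; left; near: s; exact: lt_nbhsl.
by rewrite negb_and -!ltNge; apply/orP; right; near: s; exact: lt_nbhsr.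
Unshelve. all: by end_near. Qed.

Lemma tst_rint a b phi : tst a b phi -> rint phi.
Proof.
move=> [sp p0]; rewrite (_ : phi = fun x => rind (a <= x <= b) * phi x).
  exact/rint_itv/smooth_continuous.
apply/funext => x; rewrite /rind; case: (boolP (a <= x <= b)) => h; rewrite ?mul1r//.
by rewrite mul0r p0.
Qed.

Lemma smooth_meas phi : smooth phi -> measurable_fun setT phi.
Proof. by move=> sp; apply: continuous_measurable_fun; exact: smooth_continuous. Qed.

Lemma tst_dom a b phi (g : R -> C) : tst a b phi -> cmf g -> (forall t, cabs (g t) <= 1) ->
  ci (fun t => g t * RtoC (phi t)) /\ cabs (I (fun t => g t * RtoC (phi t))) <= J (fun t => `|phi t|).
Proof.
move=> tp mg g1; have ip := tst_rint tp.
have m : cmf (fun t => g t * RtoC (phi t)).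
  by apply: cmfM => //; apply: cmf_RtoC; exact: rint_meas.
have d t : cabs (g t * RtoC (phi t)) <= `|phi t|.
  by rewrite cabsM cabs_RtoC ler_piMl.
by split; [exact: ci_dom m (rint_norm ip) d|exact: cabs_I_le m (rint_norm ip) d].
Qed.

Lemma cmf_osc (x : R) : cmf (fun t : R => cexpi (- (x * t)) : C).
Proof.
apply: cmf_cexpi; apply: measurableT_comp => //; exact: measurable_funM.
Qed.

Lemma Fh_ci a b phi x : tst a b phi -> ci (fun t => cexpi (- (x * t)) * RtoC (phi t)).
Proof.
by move=> tp; case: (tst_dom tp (cmf_osc x)) => // t; rewrite cabs_cexpi.
Qed.

Lemma Fh_le a b phi x : tst a b phi -> cabs (Fh phi x) <= J (fun t => `|phi t|).
Proof.
by move=> tp; case: (tst_dom tp (cmf_osc x)) => // t; rewrite cabs_cexpi.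
Qed.

Lemma FhD a b phi psi x : tst a b phi -> tst a b psi ->
  Fh (fun t => phi t + psi t) x = Fh phi x + Fh psi x.
Proof.
move=> t1 t2; rewrite -ID; [|exact: Fh_ci t1|exact: Fh_ci t2].
by apply: eqI => t; rewrite RtoCD; ring.
Qed.

Lemma FhZ a b c phi x : tst a b phi -> Fh (fun t => c * phi t) x = RtoC c * Fh phi x.
Proof.
move=> t1; rewrite -IZl; last exact: Fh_ci t1.
by apply: eqI => t; rewrite RtoCM; ring.
Qed.

Lemma cderiveM F f G g : cderive F f -> cderive G g ->
  cderive (fun x => F x * G x : C) (fun x => f x * G x + F x * g x).
Proof.
move=> dF dG x; have [a1 a2] := dF x; have [b1 b2] := dG x; split.
  under [X in is_derive _ _ X]eq_fun do rewrite ReM.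
  apply: der_eq (dB (dM a1 b1) (dM a2 b2)) _; rewrite ReD !ReM; ring.
under [X in is_derive _ _ X]eq_fun do rewrite ImM.
by apply: der_eq (dD (dM a1 b2) (dM a2 b1)) _; rewrite ImD !ImM; ring.
Qed.

Lemma cderive_RtoC (f g : R -> R) : (forall x, is_derive x (1 : R) f (g x)) ->
  cderive (fun x => RtoC (f x)) (fun x => RtoC (g x)).
Proof. by move=> fg x; split => //=; exact: d_cst. Qed.

Lemma cderive_cexpi (f g : R -> R) : (forall x, is_derive x (1 : R) f (g x)) ->
  cderive (fun x => cexpi (f x)) (fun x => Complex 0 (g x) * cexpi (f x)).
Proof.
move=> fg x; have df := fg x; split; rewrite /= ?ReM ?ImM /=.
  by apply: der_eq (d_comp (is_derive_cos _) df) _; ring.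
by apply: der_eq (d_comp (is_derive_sin _) df) _; ring.
Qed.

Lemma ccontM (f g : R -> C) : ccont f -> ccont g -> ccont (fun x => f x * g x).
Proof.
move=> [fr fi] [gr gi]; split => x.
  under eq_fun do rewrite ReM.
  by apply: cvgB; apply: cvgM; [exact: fr|exact: gr|exact: fi|exact: gi].
under eq_fun do rewrite ImM.
by apply: cvgD; apply: cvgM; [exact: fr|exact: gi|exact: fi|exact: gr].
Qed.

Lemma ccontD (f g : R -> C) : ccont f -> ccont g -> ccont (fun x => f x + g x).
Proof.
move=> [fr fi] [gr gi]; split => x.
  by under eq_fun do rewrite ReD; apply: cvgD; [exact: fr|exact: gr].
by under eq_fun do rewrite ImD; apply: cvgD; [exact: fi|exact: gi].
Qed.

Lemma ccont_cst (c : C) : ccont (fun=> c).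
Proof. by split => x; exact: cvg_cst. Qed.

Lemma ccont_RtoC (f : R -> R) : continuous f -> ccont (fun x => RtoC (f x)).
Proof. by move=> cf; split => //= x; exact: cvg_cst. Qed.

Lemma ccont_cexpi (f : R -> R) : continuous f -> ccont (fun x => cexpi (f x)).
Proof.
move=> cf; split => x; apply: continuous_comp; [exact: cf|exact: continuous_cos|exact: cf|exact: continuous_sin].
Qed.

Lemma d_lin (c d x : R) : is_derive x (1 : R) (fun t : R => c * t + d) c.
Proof. by apply: der_eq (dD (dZ c (d_id x)) (d_cst d x)) _; ring. Qed.

Lemma continuous_lin (c d : R) : continuous (fun t : R => c * t + d).
Proof.
move=> x; apply: differentiable_continuous; apply/derivable1_diffP.
by case: (d_lin c d x).
Qed.

Lemma Fh_derive a b phi x : a <= b -> tst a b phi ->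
  Fh (derive1 phi) x = Complex 0 x * Fh phi x.
Proof.
move=> ab tp; have td := tst_derive tp.
have E : I (fun t => cexpi (- (x * t)) * RtoC (derive1 phi t) -
   Complex 0 x * (cexpi (- (x * t)) * RtoC (phi t))) = 0.
  pose F t := cexpi (- x * t + 0) * RtoC (phi t).
  pose f t := (Complex 0 (- x) * cexpi (- x * t + 0)) * RtoC (phi t) +
    cexpi (- x * t + 0) * RtoC (derive1 phi t) : C.
  have dF : cderive F f.
    apply: cderiveM; last exact/cderive_RtoC/smooth_is_derive/tp.1.
    by apply: cderive_cexpi => t; exact: d_lin.
  have cf : ccont f.
    apply: ccontD; apply: ccontM; do ?[apply: ccontM].
    - exact: ccont_cst.
    - exact/ccont_cexpi/continuous_lin.
    - exact/ccont_RtoC/smooth_continuous/tp.1.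
    - exact/ccont_cexpi/continuous_lin.
    - exact/ccont_RtoC/smooth_continuous/td.1.
  (* The interval is widened by 1 on both sides because [tst] gives the value 0 only strictly
     outside [a, b]. *)
  have := I_ftc (_ : a - 1 <= b + 1) cf dF.
  rewrite /F !tp.2; [|by apply/negP; lra..].
  rewrite !mulr0 subrr => <-; last lra.
  apply: eqI => t; rewrite /f addr0 mulNr indE; case: ifPn => ht.
    by rewrite mul1r; have -> : Complex 0 (- x) = - Complex 0 x; [apply: eqC; rewrite /= ?oppr0|ring].
  by rewrite tp.2 ?td.2 ?RtoC0 ?mulr0 ?subrr ?mul0r//; apply: contra ht; lra.
move: E; rewrite IB; [|exact: Fh_ci td|by apply: ciZ; exact: Fh_ci tp].
rewrite IZl; last exact: Fh_ci tp.
by move/subr0_eq.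
Qed.

(** The operator 1 - d^2 D^2 has symbol 1 + (d x)^2, the inverse of [q (d * x)]. The scale d is free
    so that it can later be matched with the width of the support. *)
Lemma Fh_damp a b phi (d x : R) : a <= b -> tst a b phi ->
  Fh (fun t => phi t - d ^+ 2 * derive1 (derive1 phi) t) x = RtoC (1 + (d * x) ^+ 2) * Fh phi x.
Proof.
move=> ab tp; have t1 := tst_derive tp; have t2 := tst_derive t1.
under eq_fun do rewrite -mulNr.
rewrite (@FhD a b) ?(@FhZ a b)//; last exact: tstZ.
rewrite (Fh_derive _ ab t1) (Fh_derive _ ab tp) mulrA mulrA -{1}(mul1r (Fh phi x)) -mulrDl; congr (_ * _).
by apply: eqC; rewrite ?ReD ?ReM ?ImD ?ImM /=; ring.
Qed.

Lemma Fh_decay1 a b phi (d x : R) : a <= b -> tst a b phi ->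
  cabs (Fh phi x) <= J (fun t => `|phi t - d ^+ 2 * derive1 (derive1 phi) t|) * q (d * x).
Proof.
move=> ab tp; have t1 := tst_derive tp; have t2 := tst_derive t1.
rewrite /q ler_pdivlMr ?ltr_pwDl ?sqr_ge0// mulrC.
have -> : (1 + (d * x) ^+ 2) * cabs (Fh phi x) = cabs (RtoC (1 + (d * x) ^+ 2) * Fh phi x).
  by rewrite cabsM cabs_RtoC ger0_norm// addr_ge0// sqr_ge0.
rewrite -(Fh_damp _ _ ab tp); apply: (@Fh_le a b).
by under eq_fun do rewrite -mulNr; apply: tstD => //; exact: tstZ.
Qed.

(** Two applications of the operator of [Fh_damp] at d = 1, each gaining a factor [q x]; the [+ 1]
    in the witness only ensures a positive constant. *)
Lemma Fh_decay a b phi : a <= b -> tst a b phi ->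
  exists c, 0 < c /\ forall x, cabs (Fh phi x) <= c * q x ^+ 2.
Proof.
move=> ab tp; pose L (f : R -> R) := fun t => f t - 1 ^+ 2 * derive1 (derive1 f) t.
have tL f : tst a b f -> tst a b (L f).
  move=> tf; rewrite /L; under eq_fun do rewrite -mulNr; apply: tstD => //.
  by apply: tstZ; do 2 apply: tst_derive.
exists (J (fun t => `|L (L phi) t|) + 1); split.
  by rewrite ltr_wpDl// J_ge0.
move=> x; have := Fh_decay1 1 x ab (tL _ tp); rewrite mul1r (Fh_damp _ _ ab tp) mul1r.
rewrite cabsM cabs_RtoC ger0_norm ?addr_ge0 ?sqr_ge0// -ler_pdivlMl; last by rewrite ltr_pwDl ?sqr_ge0.
move=> /le_trans; apply; rewrite -/(q x) /L; set B := J _.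
have -> : q x * (B * q x) = B * q x ^+ 2 by ring.
by rewrite ler_wpM2r ?sqr_ge0// lerDl.
Qed.

Lemma cexpi_lip (x y : R) : cabs (cexpi x - cexpi y) <= `|x - y|.
Proof.
wlog yx : x y / y <= x.
  by move=> H; have /orP[h|h] := le_total y x; [exact: H|rewrite cabs_distC distrC; exact: H].
have cE : ccont (fun t => Complex 0 1 * cexpi t : C).
  by apply: ccontM; [exact: ccont_cst|apply: ccont_cexpi => ?; exact: cvg_id].
rewrite -(I_ftc yx cE); last by apply: (@cderive_cexpi id (fun=> 1)) => t; exact: d_id.
have <- : J (fun t => rind (y <= t <= x) * 1) = `|x - y|.
  rewrite (J_ftc yx (f := fun=> 1) (F := id)) ?ger0_norm ?subr_ge0//.
  by move=> ?; exact: cvg_cst.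
apply: cabs_I_le.
- by case: (ci_itv y x cE).
- by apply: rint_itv => ?; exact: cvg_cst.
- move=> t; rewrite !cabsM cabs_cexpi mulr1 cabs_RtoC /rind.
  have -> : cabs (Complex 0 1 : C) = 1 by rewrite /cabs /= expr0n expr1n add0r sqrtr1.
  by case: (_ <= _ <= _); rewrite !mulr1 ?normr1 ?normr0.
Qed.

Lemma continuous_lip (f : R -> R) (L : R) : (forall x y, `|f x - f y| <= L * `|x - y|) ->
  continuous f.
Proof.
move=> fL x; apply/cvgrPdist_le => e e0.
have L1 : 0 < `|L| + 1 by rewrite ltr_wpDl.
near=> y; apply: le_trans (fL _ _) _.
apply: (@le_trans _ _ ((`|L| + 1) * `|x - y|)).
  by rewrite ler_wpM2r// (le_trans (ler_norm _))// lerDl.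
rewrite -ler_pdivlMl//; near: y.
apply/nbhs_normP; exists ((`|L| + 1)^-1 * e); first by rewrite /= mulr_gt0 ?invr_gt0.
by move=> z /= /ltW.
Unshelve. all: by end_near. Qed.

Lemma ccont_lip (f : R -> C) (L : R) : (forall x y, cabs (f x - f y) <= L * `|x - y|) ->
  ccont f.
Proof.
move=> fL; split; apply: (@continuous_lip _ L) => x y; apply: le_trans (fL x y).
  by rewrite -ReN -ReD Re_le_cabs.
by rewrite -ImN -ImD Im_le_cabs.
Qed.

(** The transform is Lipschitz with constant the L1 norm of t phi(t), because [cexpi] is
    1-Lipschitz. *)
Lemma Fh_ccont a b phi : tst a b phi -> ccont (Fh phi).
Proof.
move=> tp; have tp1 : tst a b (fun t => phi t * t) by apply: tstM tp _; exact: smooth_id.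
apply: (@ccont_lip _ (J (fun t => `|phi t * t|))) => x y.
rewrite -IB; [|exact: Fh_ci tp..].
have ci1 : ci (fun t => (cexpi (- (x * t)) - cexpi (- (y * t))) * RtoC (phi t)).
  by under eq_fun do rewrite mulrBl; apply: ciB; exact: Fh_ci tp.
rewrite mulrC -JZl; last exact/rint_norm/tst_rint/tp1.
rewrite (@eqI _ _ (fun t => (cexpi (- (x * t)) - cexpi (- (y * t))) * RtoC (phi t))); last first.
  by move=> t; rewrite mulrBl.
apply: cabs_I_le; first by case: ci1.
  exact/rintZl/rint_norm/tst_rint/tp1.
move=> t; rewrite cabsM cabs_RtoC.
apply: (@le_trans _ _ (`|- (x * t) - - (y * t)| * `|phi t|)).
  by rewrite ler_wpM2r// cexpi_lip.
by rewrite -!normrM le_eqVlt; apply/orP; left; apply/eqP; rewrite -normrN; congr (`|_|); ring.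
Qed.

(** Modulation becomes translation. This is how testing the boundary distribution against
    [cexpi (h * t) * phi t] produces a convolution at the point h. *)
Lemma Fh_mod phi (h x : R) :
  I (fun t => cexpi (- (x * t)) * (cexpi (h * t) * RtoC (phi t))) = Fh phi (x - h).
Proof.
by apply: eqI => t; rewrite mulrA -cexpiD; congr (cexpi _ * _); ring.
Qed.

End FourierTest.

(** * Invariance of the integral, and integrals over half-lines *)

Section ChangeOfVariable.
Variable R : realType.
Local Notation C := R[i].
Local Notation mu := (@lebesgue_measure R).

Lemma rint_pushforward (f : R -> R) (phi : R -> R) :
  measurable_fun setT phi ->
  (forall A, measurable A -> mu (phi @^-1` A) = mu A) ->
  rint f -> rint (fun x => f (phi x)) /\ J (fun x => f (phi x)) = J f.
Proof.
move=> mphi inv rf.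
have mf : measurable_fun setT (EFin \o f) := measurable_int _ rf.
have maf : measurable_fun setT (fun x => `|(f x)%:E|%E) by exact: measurableT_comp.
have eqm (g : R -> \bar R) : (\int[pushforward mu (phi : _ -> measurableTypeR R)]_x g x = \int[mu]_x g x)%E.
  by apply: eq_measure_integral => A mA _; exact: inv.
have i1 : rint (fun x => f (phi x)).
  apply/integrableP; split; first exact: (measurableT_comp mf).
  have := @ge0_integral_pushforward _ _ _ _ R (phi : measurableTypeR R -> measurableTypeR R) mphi (@lebesgue_measure R) setT _ measurableT maf (fun y _ => abse_ge0 _).
  rewrite preimage_setT => <-; rewrite eqm.
  by move/integrableP : rf => [].
split=> //.
have := @integral_pushforward _ _ _ _ R (phi : measurableTypeR R -> measurableTypeR R) mphi (@lebesgue_measure R) setT (EFin \o f) mf.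
rewrite preimage_setT => /(_ i1 measurableT); rewrite eqm => E.
by rewrite /J /Rintegral; congr fine; rewrite E.
Qed.

Lemma lebesgue_shift (h : R) A : measurable A ->
  mu ((fun x => h + x) @^-1` A) = mu A.
Proof.
move=> mA; have mh : measurable_fun setT (fun x : R => h + x) by exact: measurable_funD.
apply/esym.
have -> : mu ((fun x => h + x) @^-1` A) = pushforward mu ((fun x => h + x) : R -> measurableTypeR R) A by [].
apply: lebesgue_measure_unique => //= _ [[a b]] _ <-.
rewrite /pushforward.
have -> : (fun x : R => h + x) @^-1` `]a, b]%classic = `](a - h), (b - h)]%classic.
  by apply/seteqP; split => x /=; rewrite !in_itv /=; lra.
rewrite /= !lebesgue_measure_itv /= !lte_fin ltrD2r; case: ifPn => // _.
by rewrite -!EFinD; congr EFin; ring.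
Qed.

Lemma I_invariant (f : R -> C) (phi : R -> R) :
  measurable_fun setT phi ->
  (forall A, measurable A -> mu (phi @^-1` A) = mu A) ->
  ci f -> ci (fun x => f (phi x)) /\ I (fun x => f (phi x)) = I f.
Proof.
move=> mphi inv cf.
have [r1 r2] := rint_pushforward mphi inv (ciRe cf).
have [i1 i2] := rint_pushforward mphi inv (ciIm cf).
by split; [exact: ci_ReIm|apply: eqC].
Qed.

Lemma I_shift (f : R -> C) (h : R) : ci f ->
  ci (fun x => f (h + x)) /\ I (fun x => f (h + x)) = I f.
Proof.
by apply: I_invariant; [exact: measurable_funD|exact: lebesgue_shift].
Qed.

Lemma I_opp (f : R -> C) : ci f -> ci (fun x => f (- x)) /\ I (fun x => f (- x)) = I f.
Proof. apply: (@I_invariant f (fun x => - x)); last exact: lebesgue_measureN.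
by apply: continuous_measurable_fun => x; apply: continuousN; exact: cvg_id. Qed.

(** A single point is null; this exchanges strict and weak inequalities at the end of an
    interval. *)
Lemma I_ae1 (f g : R -> C) (a : R) : ci f -> ci g -> (forall x, x != a -> f x = g x) ->
  I f = I g.
Proof.
move=> cf cg fg.
have key (u v : R -> R) : rint u -> rint v -> (forall x, x != a -> u x = v x) -> J u = J v.
  move=> iu iv uv; rewrite /J /Rintegral; congr fine; apply: ae_eq_integral => //.
  - exact: (measurable_int _ iu).
  - exact: (measurable_int _ iv).
  - exists [set a]; split => //; first exact: lebesgue_measure_set1.
    move=> x /= nx; apply: contrapT => xa; apply: nx => _; rewrite uv//.
    exact/eqP.
apply: eqC; apply: key; do ?[exact: ciRe|exact: ciIm]; by move=> x xa; rewrite fg.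
Qed.

(** Folding the line at h. Against a kernel that is even about h, this is where the symmetric sum
    [p (h + x) + p (h - x)] arises. *)
Lemma I_half (f : R -> C) (h : R) : ci f ->
  I f = I (fun x => ind (0 < x) * (f (h + x) + f (h - x))).
Proof.
move=> cf; have [cs Is] := I_shift h cf; have [co _] := I_opp cs.
have mp : cmf (fun x : R => ind (0 < x) : C) by apply: cmf_ind; exact: measurable_fun_ltr.
have mn : cmf (fun x : R => ind (x < 0) : C) by apply: cmf_ind; exact: measurable_fun_ltr.
have cp : ci (fun x => ind (0 < x) * f (h + x)) by apply: ciM_bnd cs => // x; exact: cabs_ind_le1.
have cn : ci (fun x => ind (x < 0) * f (h + x)) by apply: ciM_bnd cs => // x; exact: cabs_ind_le1.
have [cn' In'] := I_opp cn.
rewrite -Is.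
transitivity (I (fun x => ind (0 < x) * f (h + x) + ind (x < 0) * f (h + x))).
  apply: (@I_ae1 _ _ 0) => //; first exact: ciD.
  by move=> x x0; rewrite !indE; case: ltgtP x0 => // _ _; rewrite ?mul1r ?mul0r ?addr0 ?add0r.
rewrite ID// -In' -ID//; apply: eqI => x.
by rewrite oppr_lt0 mulrDr.
Qed.

(** The finite formula on the intervals from v to v + n, followed by dominated convergence; decay of
    F along the sequence v + n is then enough. *)
Lemma I_ftc_oo (f F : R -> C) (v : R) (b : R -> R) : ccont f -> cderive F f ->
  rint b -> (forall u, v < u -> cabs (f u) <= b u) -> (forall u, 0 <= b u) ->
  (fun n : nat => cabs (F (v + n%:R))) @ \oo --> (0 : R) ->
  ci (fun u => ind (v < u) * f u) /\ I (fun u => ind (v < u) * f u) = - F v.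
Proof.
move=> cf dF rb fb b0 F0; have mf := ccont_cmf cf.
have bd (c : bool) u : (c -> v < u) -> cabs (ind c * f u) <= b u.
  by move=> h; rewrite indE; case: c h => h; rewrite ?mul1r ?mul0r ?cabs0// fb// h.
have m1 : cmf (fun u => ind (v < u) * f u).
  by apply: cmfM => //; apply: cmf_ind; exact: measurable_fun_ltr.
have m2 n : cmf (fun u => ind (v < u <= v + n%:R) * f u).
  apply: cmfM => //; apply: cmf_ind.
  by apply: measurable_and; [exact: measurable_fun_ltr|exact: measurable_fun_ler].
have c1 : ci (fun u => ind (v < u) * f u) by apply: ci_dom m1 rb _ => u; exact: bd.
have c2 n : ci (fun u => ind (v < u <= v + n%:R) * f u).
  by apply: ci_dom (m2 n) rb _ => u; apply: bd => /andP[].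
split=> //.
have vn (n : nat) : v <= v + n%:R by rewrite lerDl.
have E n : I (fun u => ind (v < u <= v + n%:R) * f u) = F (v + n%:R) - F v.
  rewrite -(I_ftc (vn n) cf dF); apply: (@I_ae1 _ _ v) => //; first exact: ci_itv.
  by move=> u uv; rewrite lt_neqAle eq_sym uv.
have H : (fun n => cabs (I (fun u => ind (v < u <= v + n%:R) * f u) - I (fun u => ind (v < u) * f u))) @ \oo --> (0 : R).
  apply: (I_dct m2 m1 rb) => [n x|x|x]; first by apply: bd => /andP[].
    exact: bd.
  apply: (@cvg_near_cst _ _ (0 : R)); near=> n.
  suff -> : (v < x <= v + n%:R) = (v < x) by rewrite subrr cabs0.
  case: (v < x) => //=; rewrite addrC -lerBlDr; near: n.
  exact: nbhs_infty_ger.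
apply/eqP; rewrite -subr_eq0; apply/eqP/cabs_eq0/eqP; rewrite eq_le cabs_ge0 andbT.
have S : (fun n => cabs (I (fun u => ind (v < u <= v + n%:R) * f u) - I (fun u => ind (v < u) * f u)) + cabs (F (v + n%:R))) @ \oo --> (0 + 0 : R).
  exact: cvgD.
rewrite addr0 in S; rewrite -[leRHS](cvg_lim _ S)//.
apply: limr_ge; [by apply/cvg_ex; exists 0|near=> n].
rewrite E -[X in cabs X]opprB.
have -> : - F v - I (fun u => ind (v < u) * f u) = (F (v + n%:R) - F v - I (fun u => ind (v < u) * f u)) - F (v + n%:R) by ring.
by rewrite cabsN ler_cabsB.
Unshelve. all: by end_near. Qed.

Lemma exp_integral (c : R) : 0 < c ->
  rint (fun x => rind (0 < x) * expR (- (c * x))) /\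
  J (fun x => rind (0 < x) * expR (- (c * x))) = c^-1.
Proof.
move=> c0; have cn0 : c != 0 by rewrite gt_eqF.
pose F x := - (c^-1 * expR (- (c * x))).
have dF x : is_derive x (1 : R) F (expR (- (c * x))).
  apply: der_eq (dN (dZ c^-1 (d_comp (is_derive_expR _) (dN (dZ c (d_id x)))))) _.
  by field.
have cF : continuous F.
  by move=> x; apply: differentiable_continuous; apply/derivable1_diffP; case: (dF x).
have ce : continuous (fun x : R => expR (- (c * x))).
  move=> x; apply: continuous_comp; last exact: continuous_expR.
  by apply: continuousN; apply: continuousM; [exact: cvg_cst|exact: cvg_id].
have E : (\int[mu]_(x in `[0%R, +oo[) (expR (- (c * x)))%:E = (c^-1)%:E)%E.
  rewrite (@ge0_continuous_FTC2y _ _ F 0 0).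
  - by rewrite /F mulr0 oppr0 expR0 mulr1 -EFinB sub0r opprK.
  - by move=> x _; exact: expR_ge0.
  - exact: continuous_subspaceT.
  - rewrite -oppr0; apply: cvgN; rewrite -[X in _ --> X](mulr0 c^-1).
    apply: cvgM; first exact: cvg_cst.
    apply: (@cvg_comp _ _ _ (fun x : R => c * x) (fun y => expR (- y)) _ +oo); last exact: cvgr_expR.
    exact: gt0_cvgMry.
  - by move=> x _; case: (dF x).
  - exact/cvg_at_right_filter/cF.
  - by move=> x _; rewrite derive1E; case: (dF x).
have mr : measurable_fun setT (fun x : R => rind (0 < x) * expR (- (c * x)) : R).
  apply: measurable_funM; last exact: continuous_measurable_fun.
  by apply: measurable_rind; exact: measurable_fun_ltr.
have E' : (\int[mu]_x (rind (0 < x) * expR (- (c * x)))%:E = (c^-1)%:E)%E.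
  rewrite -E -integral_itv_obnd_cbnd; last first.
    by apply/measurable_EFinP; apply: measurable_funTS; exact: continuous_measurable_fun.
  rewrite [RHS]integral_mkcond; apply: eq_integral => x _.
  by rewrite /patch mem_setE in_itv /= andbT /rind; case: ifPn; rewrite ?mul1r ?mul0r.
split; last by rewrite /J /Rintegral E'.
apply/integrableP; split; first exact/measurable_EFinP.
have -> : (\int[mu]_x `|(rind (0 < x) * expR (- (c * x)))%:E| = \int[mu]_x (rind (0 < x) * expR (- (c * x)))%:E)%E.
  by apply: eq_integral => x _ /=; rewrite ger0_norm// mulr_ge0 ?expR_ge0.
by rewrite E' ltry.
Qed.

End ChangeOfVariable.

(** * Integrals against a damped oscillation *)

Section HalfLine.
Variable R : realType.
Local Notation C := R[i].

Section Exponential.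
Variables (s th : R).
Hypotheses (s0 : 0 < s) (th0 : 0 <= th) (th1 : th < pi / 2).
Let c := s * cos th.
Let d := s * sin th.

Let costh : 0 < cos th.
Proof.
by apply: cos_gt0_pihalf; rewrite th1 andbT; apply: lt_le_trans th0; have := pi_gt0 R; lra.
Qed.

Let c0 : 0 < c. Proof. exact: mulr_gt0. Qed.

(** The real part of e^{-2 i th} exp(-z u) at the point z = s e^{-i th} of the half circle of radius
    s. *)
Definition damped u : R := expR (- (s * cos th * u)) * cos (s * sin th * u - 2 * th).

Lemma continuous_scale (k : R) : continuous (fun x : R => k * x).
Proof. by move=> x; apply: continuousM; [exact: cvg_cst|exact: cvg_id]. Qed.

Lemma continuous_damped : continuous damped.
Proof.
move=> x; rewrite /continuous_at /damped; apply: cvgM.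
  apply: (@continuous_comp _ _ _ (fun x => - (s * cos th * x)) expR); last exact: continuous_expR.
  by apply: continuousN; exact: continuous_scale.
apply: (@continuous_comp _ _ _ (fun x => s * sin th * x - 2 * th) cos); last exact: continuous_cos.
exact: continuous_lin.
Qed.

Lemma damped_le u : `|damped u| <= expR (- (c * u)).
Proof.
rewrite /damped normrM ger0_norm ?expR_ge0// ler_piMr ?expR_ge0//.
by rewrite ler_norml cos_geN1 cos_le1.
Qed.

(** Integrating exp(-z u) with z = s e^{-i th} divides by -z, which lowers the phase from 2 th to th
    and produces the factor 1/s. *)
Let F u : R := - (expR (- (c * u)) * cos (d * u + - th) / s).

Let dF u : is_derive u (1 : R) F (damped u).
Proof.
have e1 : is_derive u (1 : R) (fun u => expR (- (c * u))) (expR (- (c * u)) * - (c * 1)).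
  exact: (d_comp (is_derive_expR _) (dN (dZ c (d_id u)))).
have e2 : is_derive u (1 : R) (fun u => cos (d * u + - th)) (- sin (d * u + - th) * d).
  exact: (d_comp (is_derive_cos _) (d_lin d (- th) u)).
have := dZ (- s^-1) (dM e1 e2).
have -> : (fun x => - s^-1 * (expR (- (c * x)) * cos (d * x + - th))) = F.
  by apply/funext => x; rewrite /F; field; rewrite gt_eqF.
move=> h; apply: der_eq h _; rewrite /damped /c /d.
have -> : s * sin th * u - 2 * th = (s * sin th * u + - th) - th by ring.
rewrite [in RHS]cosB; set A := s * sin th * u + - th; field; by rewrite gt_eqF.
Qed.

Let measurable_F : measurable_fun setT (fun x : R => expR (- (c * x)) * cos (d * x - th) / s).
Proof.
have -> : (fun x : R => expR (- (c * x)) * cos (d * x - th) / s) = (fun x => - F x).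
  by apply/funext => x; rewrite /F opprK.
apply: continuous_measurable_fun => x; apply: continuousN.
by apply: differentiable_continuous; apply/derivable1_diffP; case: (dF x).
Qed.

Let F_le x : `|expR (- (c * x)) * cos (d * x - th) / s| <= expR (- (c * x)) / s.
Proof.
rewrite normrM normfV (ger0_norm (ltW s0)) ler_pM2r ?invr_gt0// normrM.
rewrite (ger0_norm (expR_ge0 _)) ler_piMr ?expR_ge0//.
by rewrite ler_norml cos_geN1 cos_le1.
Qed.

Lemma damped_tail v : 0 <= v ->
  ci (fun u => ind (v < u) * RtoC (damped u)) /\
  I (fun u => ind (v < u) * RtoC (damped u)) = RtoC (expR (- (c * v)) * cos (d * v - th) / s).
Proof.
move=> v0; have [re _] := exp_integral c0.
have := @I_ftc_oo _ (fun u => RtoC (damped u)) (fun u => RtoC (F u)) v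
  (fun x => rind (0 < x) * expR (- (c * x))).
rewrite -RtoCN /F opprK; apply.
- exact/ccont_RtoC/continuous_damped.
- exact: (cderive_RtoC dF).
- exact: re.
- by move=> u vu; rewrite cabs_RtoC /rind (le_lt_trans v0 vu) mul1r damped_le.
- by move=> u; rewrite mulr_ge0 ?expR_ge0.
- apply: (squeeze_cvgr _ (cvg_cst 0) (h := fun n : nat => s^-1 * expR (- (c * (v + n%:R))))).
    near=> n; rewrite cabs_ge0 cabs_RtoC normrN !normrM normfV (ger0_norm (ltW s0)) mulrC.
    rewrite ler_wpM2l ?invr_ge0 ?(ltW s0)// ger0_norm ?expR_ge0// ler_piMr ?expR_ge0//.
    by rewrite ler_norml cos_geN1 cos_le1.
  rewrite -[X in _ --> X](mulr0 s^-1); apply: cvgM; first exact: cvg_cst.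
  apply: (@cvg_comp _ _ _ (fun n : nat => c * (v + n%:R)) (fun y => expR (- y)) _ +oo); last exact: cvgr_expR.
  apply/cvgryPge => A; near=> n; rewrite -ler_pdivrMl// -lerBlDl; near: n.
  exact: nbhs_infty_ger.
Unshelve. all: by end_near. Qed.

(** The constant P0 contributes its value times the full integral cos th / s of [damped]. After
    exchanging the integrations, the rest is r against the tail of [damped], at most exp(-c v) / s,
    and integrating this over v > 0 leaves M / (s c). *)
Lemma damped_bound (P r : R -> C) (P0 : C) (M K : R) : cmf P ->
  (forall u, cabs (P u) <= K) -> cmf r ->
  (forall v, cabs (r v) <= M) ->
  (forall u, 0 < u -> P u = P0 + I (fun v => ind (v < u) * (ind (0 < v) * r v))) ->
  cabs (I (fun u => ind (0 < u) * (P u * RtoC (damped u))) - P0 * RtoC (cos th / s)) <= M / (s * c).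
Proof.
move=> mP PK mr rM PE.
have M0 : 0 <= M by apply: le_trans (rM 0); exact: cabs_ge0.
have [c1 E1] := damped_tail (lexx 0).
have mp : cmf (fun x : R => ind (0 < x) : C) by apply: cmf_ind; exact: measurable_fun_ltr.
have mw : cmf (fun v : R => ind (0 < v) * r v) by exact: cmfM.
have mg : cmf (fun u : R => ind (0 < u) * RtoC (damped u)) by case: c1.
(* Half of the decay rate is given to each variable: for 0 < v < u, exp(-c u) <= exp(-c v / 2)
   exp(-c u / 2), the product majorant that [I_primitive] asks for. *)
have ch0 : 0 < c / 2 by rewrite divr_gt0.
have [re _] := exp_integral ch0; have [re' Je'] := exp_integral c0.
have ind0 (x : R) : (0 : R) <= rind (0 < x) by [].
have PF := I_primitive mw mg (rintZl M re) re.
have eqP1 : I (fun u => ind (0 < u) * (P u * RtoC (damped u))) =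
    I (fun u => P0 * (ind (0 < u) * RtoC (damped u)) +
      ind (0 < u) * RtoC (damped u) * I (fun v => ind (v < u) * (ind (0 < v) * r v))).
  apply: eqI => u; rewrite !indE; case: ifPn => u0; last by rewrite !mul0r mulr0 addr0.
  by rewrite (PE _ u0); move: (I _) => z; ring.
have Jv v : (ind (0 < v) * r v) * I (fun u => ind (v < u) * (ind (0 < u) * RtoC (damped u))) =
    ind (0 < v) * r v * RtoC (expR (- (c * v)) * cos (d * v - th) / s).
  rewrite !indE; case: ifPn => v0; last by rewrite !mul0r.
  congr (_ * _); rewrite -(damped_tail (ltW v0)).2; apply: eqI => u.
  rewrite !indE; case: ifPn => vu; last by rewrite !mul0r.
  by rewrite (lt_trans v0 vu) !mul1r.
have cg2 : ci (fun u => ind (0 < u) * RtoC (damped u) * I (fun v => ind (v < u) * (ind (0 < v) * r v))).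
  rewrite (_ : (fun u => _) = (fun u => (P u - P0) * (ind (0 < u) * RtoC (damped u)))).
    apply: (ciM_bnd (B := K + cabs P0) _ _ c1); first by apply: cmfB mP _; exact: cmf_cst.
    by move=> u; apply: le_trans (ler_cabsB _ _) _; rewrite lerD2r PK.
  apply/funext => u; rewrite !indE; case: ifPn => u0; last by rewrite !(mul0r, mulr0).
  by rewrite (PE _ u0); move: (I _) => z; ring.
rewrite eqP1 (ID (ciZ P0 c1) cg2) (IZl P0 c1) E1 PF; last 2 first.
- move=> u v vu; rewrite !cabsM !indE.
  case: (boolP (0 < v)) => v0; last first.
    by rewrite cabs0 !rindE /= !(mul0r, mulr0).
  have u0 := lt_trans v0 vu; rewrite u0 !rindE /= !mul1r cabs1 !mul1r.
  rewrite -mulrA; apply: ler_pM; [exact: cabs_ge0|exact: cabs_ge0|exact: rM|].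
  rewrite cabs_RtoC; apply: le_trans (damped_le u) _.
  rewrite -expRD ler_expR; nra.
- by move=> u v; rewrite !mulr_ge0// expR_ge0.
rewrite (eqI Jv) !mulr0 sub0r cosN oppr0 expR0 mul1r.
have -> : P0 * RtoC (cos th / s) + I (fun x => ind (0 < x) * r x * RtoC (expR (- (c * x)) * cos (d * x - th) / s)) - P0 * RtoC (cos th / s) = I (fun x => ind (0 < x) * r x * RtoC (expR (- (c * x)) * cos (d * x - th) / s)) by move: (I _) => z; ring.
have -> : M / (s * c) = J (fun x => M / s * (rind (0 < x) * expR (- (c * x)))).
  by rewrite (JZl _ re') Je' invfM mulrA.
apply: cabs_I_le.
- by apply: cmfM mw _; exact: cmf_RtoC.
- exact: (rintZl _ re').
- move=> x; rewrite !cabsM cabs_RtoC !indE rindE; case: (boolP (0 < x)) => x0; last by rewrite /= cabs0 !(mul0r, mulr0).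
  rewrite /= cabs1 !mul1r.
  apply: le_trans (ler_pM (cabs_ge0 _) (normr_ge0 _) (rM x) (F_le x)) _.
  by rewrite mulrA mulrAC.
Qed.

End Exponential.
End HalfLine.

(** * The kernel with transform supported in [-s, s] and its half circle representation *)

Section NewmanKernel.
Variable R : realType.
Local Notation C := R[i].

(** The transform of (s^2 - t^2)_+ for x != 0. At x = 0 division by zero makes the value 0 instead
    of 4 s^3 / 3, which integrals over x > 0 do not see. *)
Definition kk (s x : R) : R := 4 * (sin (s * x) - s * x * cos (s * x)) / x ^+ 3.

Lemma kk_even s x : kk s (- x) = kk s x.
Proof. by rewrite /kk mulrN sinN cosN exprNn -signr_odd /=; rewrite expr1 mulN1r invrN; ring. Qed.

Lemma kk_fourier (s x : R) : 0 < s -> x != 0 ->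
  J (fun t => rind (- s <= t <= s) * ((s ^+ 2 - t ^+ 2) * cos (x * t))) = kk s x.
Proof.
move=> s0 x0; have ss : - s <= s by lra.
pose G (t : R) := (s ^+ 2 - t ^+ 2) * (sin (x * t) / x) + (- 2 * t * (cos (x * t) / x ^+ 2) + 2 * (sin (x * t) / x ^+ 3)).
have dx (t : R) : is_derive t (1 : R) (fun t => x * t) x.
  by apply: der_eq (dZ x (d_id t)) _; rewrite mulr1.
have ds (k t : R) : is_derive t (1 : R) (fun t => k^-1 * sin (x * t)) (k^-1 * (cos (x * t) * x)).
  by apply: dZ; exact: (d_comp (is_derive_sin _) (dx t)).
have dc (k t : R) : is_derive t (1 : R) (fun t => k^-1 * cos (x * t)) (k^-1 * (- sin (x * t) * x)).
  by apply: dZ; exact: (d_comp (is_derive_cos _) (dx t)).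
have dG t : is_derive t (1 : R) G ((s ^+ 2 - t ^+ 2) * cos (x * t)).
  have := dD (dM (dB (d_cst (s ^+ 2) t) (dX 2 (d_id t))) (ds x t))
     (dD (dM (dZ (- 2) (d_id t)) (dc (x ^+ 2) t)) (dZ 2 (ds (x ^+ 3) t))).
  have -> : (fun x0 : R => (s ^+ 2 - x0 ^+ 2) * (x^-1 * sin (x * x0)) +
      (- 2 * x0 * ((x ^+ 2)^-1 * cos (x * x0)) + 2 * ((x ^+ 3)^-1 * sin (x * x0)))) = G.
    by apply/funext => y; rewrite /G; ring.
  by move=> h; apply: der_eq h _ => /=; field.
rewrite (J_ftc ss _ dG); last first.
  move=> t; apply: cvgM.
    by apply: cvgB; [exact: cvg_cst|apply: cvgM; exact: cvg_id].
  by apply: (@continuous_comp _ _ _ (fun t => x * t) cos); [exact: continuous_scale|exact: continuous_cos].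
rewrite /G /kk !mulrN sinN cosN (mulrC x s); field; exact: x0.
Qed.

(* Deforming [-s, s] to a half circle of radius s, as in Newman's proof of the
   prime number theorem: Newman's weight (1 + z^2/s^2)/z has size 2|cos th|/s. *)
Lemma kk_newman (s x : R) : 0 < s -> 0 < x ->
  J (fun th => rind (0 <= th <= pi / 2) * (4 * s ^+ 3 * cos th * damped s th x)) = kk s x.
Proof.
move=> s0 x0; have xn : x != 0 by rewrite gt_eqF.
have sn : s != 0 by rewrite gt_eqF.
have p0 : 0 <= pi / 2 :> R by rewrite divr_ge0// pi_ge0.
pose X := s * x; have Xn : X != 0 by rewrite mulf_neq0.
pose E (th : R) := expR (- X * cos th).
pose K (th : R) := cos (X * sin th). pose S (th : R) := sin (X * sin th).
(* [A] and [B] are the real and imaginary parts of 1/X + (z^2 + 2 z + 2)/X^3 with z = X e^{-i th}.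
   In the variable z the integrand is a quadratic polynomial times e^{-z}, and [G] is its
   primitive. *)
pose A (th : R) := 2 * X^-1 * cos th ^+ 2 + (2 * X^-1 ^+ 2 * cos th + 2 * X^-1 ^+ 3).
pose B (th : R) := - 2 * X^-1 * (sin th * cos th) + - 2 * X^-1 ^+ 2 * sin th.
have dc th := is_derive_cos th : is_derive th (1 : R) (cos : R -> R) (- sin th).
have dsn th := is_derive_sin th : is_derive th (1 : R) (sin : R -> R) (cos th).
have dE th : is_derive th (1 : R) E (E th * (- X * - sin th)).
  exact: (d_comp (is_derive_expR _) (dZ (- X) (dc th))).
have dK th : is_derive th (1 : R) K (- S th * (X * cos th)).
  exact: (d_comp (is_derive_cos _) (dZ X (dsn th))).
have dS th : is_derive th (1 : R) S (K th * (X * cos th)).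
  exact: (d_comp (is_derive_sin _) (dZ X (dsn th))).
have dA th := dD (dZ (2 * X^-1) (dX 2 (dc th))) (dD (dZ (2 * X^-1 ^+ 2) (dc th)) (d_cst (2 * X^-1 ^+ 3) th)).
have dB' th := dD (dZ (- 2 * X^-1) (dM (dsn th) (dc th))) (dZ (- 2 * X^-1 ^+ 2) (dsn th)).
pose G th := 2 * s ^+ 3 * (E th * (A th * S th + B th * K th)).
have dG th : is_derive th (1 : R) G (4 * s ^+ 3 * cos th * damped s th x).
  have := dZ (2 * s ^+ 3) (dM (dE th) (dD (dM (dA th) (dS th)) (dM (dB' th) (dK th)))).
  move=> h; apply: (der_eq (f := G)) h _ => /=.
  rewrite /damped.
  have -> : s * sin th * x - 2 * th = X * sin th - (th + th) by rewrite /X; ring.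
  have -> : expR (- (s * cos th * x)) = E th by rewrite /E /X; congr expR; ring.
  rewrite cosB cosD sinD -/(K th) -/(S th).
  by move: (E th) (K th) (S th) (cos th) (sin th) => e k u c z; field.
rewrite (J_ftc p0 _ dG); last first.
  move=> th; apply: cvgM; last first.
    rewrite /damped; apply: cvgM.
      apply: (@continuous_comp _ _ _ (fun th => - (s * cos th * x)) expR); last exact: continuous_expR.
      by apply: cvgN; apply: cvgM; [apply: cvgM; [exact: cvg_cst|exact: continuous_cos]|exact: cvg_cst].
    apply: (@continuous_comp _ _ _ (fun th => s * sin th * x - 2 * th) cos); last exact: continuous_cos.
    apply: cvgB; last exact: continuous_scale.
    by apply: cvgM; [apply: cvgM; [exact: cvg_cst|exact: continuous_sin]|exact: cvg_cst].
  by apply: cvgM; [exact: cvg_cst|exact: continuous_cos].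
rewrite /G /E /A /B /S /K cos0 sin0 cos_pihalf sin_pihalf !(mulr0, mulr1) sin0 expR0.
rewrite /kk -/X /X; field; by rewrite xn sn.
Qed.

Lemma sin_le_norm (y : R) : `|sin y| <= `|y|.
Proof.
have := cexpi_lip y 0; rewrite subr0; apply: le_trans.
by apply: le_trans (Im_le_cabs _); rewrite ImD ImN /= sin0 subr0.
Qed.

(** The factor 1 + x^2 is split. The integral formula gives |kk| <= 4 s^3, and |sin y| <= |y| in the
    closed formula gives x^2 |kk| <= 8 s. *)
Lemma kk_le (s x : R) : 0 < s -> `|kk s x| <= (4 * s ^+ 3 + 8 * s) * q x.
Proof.
move=> s0; have [->|x0] := eqVneq x 0.
  rewrite /kk expr0n /= invr0 mulr0 normr0 mulr_ge0 ?(ltW (q_gt0 _))//.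
  by rewrite addr_ge0// mulr_ge0// ?exprn_ge0// ltW.
rewrite /q ler_pdivlMr ?ltr_pwDl ?sqr_ge0// mulrDr mulr1 lerD//.
  rewrite -kk_fourier//; have ss : - s <= s by lra.
  have ci1 : continuous (fun t : R => (s ^+ 2 - t ^+ 2) * cos (x * t)).
    move=> t; apply: cvgM.
      by apply: cvgB; [exact: cvg_cst|apply: cvgM; exact: cvg_id].
    by apply: (@continuous_comp _ _ _ (fun t => x * t) cos); [exact: continuous_scale|exact: continuous_cos].
  have ci2 : continuous (fun t : R => 2 * s ^+ 2) by move=> t; exact: cvg_cst.
  have r1 := rint_itv (- s) s ci1; have r2 := rint_itv (- s) s ci2.
  have -> : 4 * s ^+ 3 = J (fun t => rind (- s <= t <= s) * (2 * s ^+ 2)).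
    have dt (t : R) : is_derive t (1 : R) (fun t => 2 * s ^+ 2 * t) (2 * s ^+ 2).
      by apply: der_eq (dZ _ (d_id t)) _; rewrite mulr1.
    by rewrite (J_ftc ss ci2 dt); ring.
  rewrite ler_norml; apply/andP; split.
    rewrite -mulN1r -JZl//; apply: le_J => //; first exact: rintZl.
    move=> t; rewrite rindE; case: ifPn => ht; rewrite ?(mul0r, mulr0)// !mul1r mulN1r.
    have := cos_geN1 (x * t); have := cos_le1 (x * t); nra.
  apply: le_J => // t; rewrite rindE; case: ifPn => ht; rewrite ?mul0r// !mul1r.
  have := cos_geN1 (x * t); have := cos_le1 (x * t); nra.
have -> : 8 * s = (4 * (`|s * x| + `|s * x|) / `|x| ^+ 3) * x ^+ 2.
  by rewrite normrM (ger0_norm (ltW s0)) -[x ^+ 2]real_normK ?num_real//; field; rewrite normr_eq0.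
rewrite ler_wpM2r ?sqr_ge0// /kk !normrM normfV normrX ler_wpM2r ?invr_ge0 ?exprn_ge0//.
rewrite ger0_norm// ler_wpM2l// (le_trans (ler_normB _ _))// -normrM lerD ?sin_le_norm//.
by rewrite [leLHS]normrM ler_piMr// ler_norml cos_geN1 cos_le1.
Qed.

Lemma measurable_inv : measurable_fun setT (GRing.inv : R -> R).
Proof.
have oS : open [set x : R | x != 0].
  rewrite (_ : [set x : R | x != 0] = ~` [set 0]); last first.
    by apply/seteqP; split => x /= /eqP.
  by apply: closed_openC; exact: closed_eq.
have mS : measurable [set x : R | x != 0] by exact: open_measurable.
have -> : [set: R] = [set x : R | x != 0] `|` [set 0].
  apply/seteqP; split => x //= _; have [->|x0] := eqVneq x 0; [by right|by left].
apply/measurable_funU => //; split.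
  apply: open_continuous_measurable_fun => // x; rewrite inE /= => x0.
  by apply: cvgV => //; exact: cvg_id.
exact: measurable_fun_set1.
Qed.

Lemma kk_meas d (T : measurableType d) (f g : T -> R) :
  measurable_fun setT f -> measurable_fun setT g ->
  measurable_fun setT (fun z => kk (f z) (g z)).
Proof.
move=> mf mg; rewrite /kk; apply: measurable_funM.
  apply: measurable_funM => //; apply: measurable_funB.
    apply: (@measurableT_comp _ _ _ _ _ _ (sin : R -> R)); last exact: measurable_funM.
    by apply: continuous_measurable_fun => ?; exact: continuous_sin.
  apply: measurable_funM; first exact: measurable_funM.
  apply: (@measurableT_comp _ _ _ _ _ _ (cos : R -> R)); last exact: measurable_funM.
  by apply: continuous_measurable_fun => ?; exact: continuous_cos.
apply: (@measurableT_comp _ _ _ _ _ _ (GRing.inv : R -> R)); last exact: measurable_funX.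
exact: measurable_inv.
Qed.

Lemma damped_meas d (T : measurableType d) (s : R) (f g : T -> R) :
  measurable_fun setT f -> measurable_fun setT g ->
  measurable_fun setT (fun z => damped s (f z) (g z)).
Proof.
move=> mf mg; rewrite /damped.
have mc : measurable_fun setT (cos : R -> R).
  by apply: continuous_measurable_fun => ?; exact: continuous_cos.
have ms : measurable_fun setT (sin : R -> R).
  by apply: continuous_measurable_fun => ?; exact: continuous_sin.
have mcf := measurableT_comp mc mf; have msf := measurableT_comp ms mf.
apply: measurable_funM.
  apply: (@measurableT_comp _ _ _ _ _ _ (expR : R -> R)) => //.
  apply: measurableT_comp => //; apply: measurable_funM => //; exact: measurable_funM.
apply: (measurableT_comp mc); apply: measurable_funB; last exact: measurable_funM.
by apply: measurable_funM => //; exact: measurable_funM.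
Qed.

Section KernelBound.
Variables (s K : R) (P : R -> C).
Hypotheses (s0 : 0 < s) (mP : cmf P) (PK : forall x, cabs (P x) <= K).

Let K0 : 0 <= K. Proof. by apply: le_trans (PK 0); exact: cabs_ge0. Qed.

Let wt (th : R) : R := rind (0 <= th <= pi / 2) * (4 * s ^+ 3 * cos th).

Let cospi (th : R) : 0 <= th <= pi / 2 -> 0 <= cos th.
Proof.
by move=> /andP[h1 h2]; apply: cos_ge0_pihalf; rewrite h2 andbT; have := pi_gt0 R; lra.
Qed.

Let wt_ge0 th : 0 <= wt th.
Proof.
rewrite /wt rindE; case: ifPn => h; rewrite ?mul0r// mul1r.
apply: mulr_ge0; last exact: cospi.
by rewrite mulr_ge0// exprn_ge0// ltW.
Qed.

Let F (z : R * R) : C := RtoC (wt z.1) * (ind (0 < z.2) * (P z.2 * RtoC (damped s z.1 z.2))).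
(** Not a product: the decay rate s cos th in x degenerates as th tends to pi/2. The factor cos th
    in the weight cancels the resulting 1 / (s cos th), so that integration in x leaves the constant
    4 s^2 K. At th = pi/2 itself the weight is 0. *)
Let B (z : R * R) : R := wt z.1 * K * (rind (0 < z.2) * expR (- (s * cos z.1 * z.2))).

Let mwt : measurable_fun setT (fun z : R * R => wt z.1).
Proof.
have mc : measurable_fun setT (cos : R -> R).
  by apply: continuous_measurable_fun => ?; exact: continuous_cos.
apply: measurable_funM.
  by apply: measurable_rind; apply: measurable_and; apply: measurable_fun_ler.
by apply: measurable_funM => //; exact: (measurableT_comp mc).
Qed.

Let mpos : measurable_fun [set: R * R] (fun z => 0 < z.2).
Proof. by apply: measurable_fun_ltr. Qed.

Let mF : cmf F.
Proof.
apply: cmfM; first exact: cmf_RtoC.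
apply: cmfM; first exact: cmf_ind.
apply: cmfM; first exact: (cmf_comp mP).
by apply: cmf_RtoC; exact: damped_meas.
Qed.

Let mB : measurable_fun setT B.
Proof.
have mc : measurable_fun setT (cos : R -> R).
  by apply: continuous_measurable_fun => ?; exact: continuous_cos.
apply: measurable_funM; first exact: measurable_funM.
apply: measurable_funM; first exact: measurable_rind.
apply: (@measurableT_comp _ _ _ _ _ _ (expR : R -> R)) => //.
apply: measurableT_comp => //; apply: measurable_funM => //; apply: measurable_funM => //.
exact: (measurableT_comp mc).
Qed.

Let damped_norm th x : `|damped s th x| <= expR (- (s * cos th * x)).
Proof.
rewrite /damped normrM ger0_norm ?expR_ge0// ler_piMr ?expR_ge0//.
by rewrite ler_norml cos_geN1 cos_le1.
Qed.

Let FB z : cabs (F z) <= B z.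
Proof.
rewrite /F /B -[leRHS]mulrA cabsM (cabs_RtoC (wt z.1)) (ger0_norm (wt_ge0 _)); apply: ler_wpM2l; first exact: wt_ge0.
rewrite indE rindE; case: ifPn => _; first rewrite !mul1r cabsM cabs_RtoC; last by rewrite mul0r cabs0 mul0r mulr0.
by apply: ler_pM; [exact: cabs_ge0|exact: normr_ge0|exact: PK|exact: damped_norm].
Qed.

Let thpi (th : R) : 0 <= th <= pi / 2 -> (0 <= th < pi / 2) || (th == pi / 2).
Proof. by move=> /andP[->]; rewrite le_eqVlt => /orP[->|->]; rewrite ?orbT. Qed.

Let wt_exp th : 0 <= th < pi / 2 -> wt th * (s * cos th)^-1 = 4 * s ^+ 2.
Proof.
move=> /andP[h1 h2]; rewrite /wt rindE h1 (ltW h2) mul1r; field.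
rewrite !gt_eqF// cos_gt0_pihalf// h2 andbT; have := pi_gt0 R; lra.
Qed.

Let JB th : rint (fun x => B (th, x)) /\
  J (fun x => B (th, x)) = rind (0 <= th < pi / 2) * (4 * s ^+ 2 * K).
Proof.
have [h|h] := boolP (0 <= th < pi / 2).
  have c0 : 0 < s * cos th.
    case/andP: h => h1 h2; rewrite mulr_gt0// cos_gt0_pihalf// h2 andbT; have := pi_gt0 R; lra.
  have [r1 j1] := exp_integral c0; split; first exact: (rintZl (wt th * K) r1).
  by rewrite /B /= (JZl _ r1) j1 mulrAC wt_exp// rindE mul1r.
have z : (fun x => B (th, x)) = fun=> 0.
  apply/funext => x; rewrite /B /=.
  have -> : wt th = 0; last by rewrite !mul0r.
  rewrite /wt rindE; case: ifPn => h'; last by rewrite mul0r.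
  have := thpi h'; rewrite (negbTE h) => /eqP ->; by rewrite cos_pihalf !mulr0.
rewrite z rindE mul0r; split; last by rewrite /J Rintegral_cst// mul0r.
exact: integrable0.
Qed.

Let iB : (\int[lebesgue_measure]_x \int[lebesgue_measure]_y (B (x, y))%:E < +oo)%E.
Proof.
have r : rint (fun th : R => rind (0 <= th < pi / 2) * (4 * s ^+ 2 * K)).
  have r1 := rint_itv 0 (pi / 2) (fun x => @cvg_cst _ (4 * s ^+ 2 * K) _ _ (nbhs_filter x)).
  apply: rint_dom _ r1 _.
    apply: measurable_funM => //; apply: measurable_rind; apply: measurable_and.
      exact: measurable_fun_ler.
    exact: measurable_fun_ltr.
  move=> x; rewrite !rindE; case: ifPn => [/andP[h1 h2]|_].
    by rewrite h1 (ltW h2) /= !mul1r ger0_norm// mulr_ge0// mulr_ge0// sqr_ge0.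
  by rewrite mul0r normr0; case: ifP => _; rewrite ?mul0r// mul1r mulr_ge0// mulr_ge0// sqr_ge0.
rewrite [ltLHS](_ : _ = \int[lebesgue_measure]_x (rind (0 <= x < pi / 2) * (4 * s ^+ 2 * K))%:E)%E.
  by rewrite (rint_EJ r) ltry.
by apply: eq_integral => x _; rewrite (rint_EJ (JB x).1) (JB x).2.
Qed.

Let F_wt th : I (fun x => F (th, x)) =
  RtoC (wt th) * I (fun x => ind (0 < x) * (P x * RtoC (damped s th x))).
Proof.
have [h|h] := boolP (0 <= th < pi / 2); last first.
  have w0 : wt th = 0.
    rewrite /wt rindE; case: ifPn => h'; last by rewrite mul0r.
    by have := thpi h'; rewrite (negbTE h) => /eqP ->; rewrite cos_pihalf !mulr0.
  by rewrite w0 mul0r -[RHS]I0; apply: eqI => x; rewrite /F /= w0 mul0r.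
have c0 : 0 < s * cos th.
  case/andP: h => h1 h2; rewrite mulr_gt0// cos_gt0_pihalf// h2 andbT; have := pi_gt0 R; lra.
have [r1 _] := exp_integral c0; rewrite /F /= IZl//.
apply: (ci_dom _ (rintZl K r1)) => [|x].
  apply: cmfM; first by apply: cmf_ind; exact: measurable_fun_ltr.
  by apply: cmfM => //; apply: cmf_RtoC; exact: damped_meas.
rewrite indE rindE; case: ifPn => _; first rewrite !mul1r cabsM cabs_RtoC; last by rewrite mul0r cabs0 mul0r mulr0.
by apply: ler_pM; [exact: cabs_ge0|exact: normr_ge0|exact: PK|exact: damped_norm].
Qed.

Lemma I_kk : I (fun x => ind (0 < x) * (P x * RtoC (kk s x))) =
  I (fun th => RtoC (wt th) * I (fun x => ind (0 < x) * (P x * RtoC (damped s th x)))).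
Proof.
transitivity (I (fun x => I (fun th => F (th, x)))).
  apply: eqI => x; rewrite indE; case: ifPn => x0; last first.
    rewrite mul0r -[LHS]I0; apply: eqI => th; rewrite /F /= indE (negbTE x0); by rewrite mul0r mulr0.
  rewrite mul1r -(kk_newman s0 x0) -I_RtoC -IZl.
    by apply: eqI => th; rewrite /F /= indE x0 /wt mulrA !RtoCM; ring.
  have cw : continuous (fun th : R => 4 * s ^+ 3 * cos th * damped s th x).
    move=> th; apply: cvgM; last first.
      rewrite /damped; apply: cvgM.
        apply: (@continuous_comp _ _ _ (fun th => - (s * cos th * x)) expR); last exact: continuous_expR.
        by apply: cvgN; apply: cvgM; [apply: cvgM; [exact: cvg_cst|exact: continuous_cos]|exact: cvg_cst].
      apply: (@continuous_comp _ _ _ (fun th => s * sin th * x - 2 * th) cos); last exact: continuous_cos.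
      apply: cvgB; last exact: continuous_scale.
      by apply: cvgM; [apply: cvgM; [exact: cvg_cst|exact: continuous_sin]|exact: cvg_cst].
    by apply: cvgM; [exact: cvg_cst|exact: continuous_cos].
  by apply: ci_ReIm; [exact: rint_itv|exact: integrable0].
rewrite -(I_fubini mF mB FB iB); apply: eqI => th.
exact: F_wt.
Qed.

(** [damped_bound] integrated over the quarter turn [0, pi/2]. The weight 4 s^3 cos th turns the
    error M / (s^2 cos th) into the constant 4 s M, of integral 2 pi s M, and the main term into 4
    s^2 cos^2 th, of integral pi s^2. *)
Lemma kernel_bound (r : R -> C) (P0 : C) (M : R) : cmf r ->
  (forall v, cabs (r v) <= M) ->
  (forall u, 0 < u -> P u = P0 + I (fun v => ind (v < u) * (ind (0 < v) * r v))) ->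
  cabs (I (fun x => ind (0 < x) * (P x * RtoC (kk s x))) - P0 * RtoC (pi * s ^+ 2)) <= 2 * pi * s * M.
Proof.
move=> mr rM PE; have M0 : 0 <= M by apply: le_trans (rM 0); exact: cabs_ge0.
have p0 : 0 <= pi / 2 :> R by rewrite divr_ge0// pi_ge0.
pose A th := I (fun x => ind (0 < x) * (P x * RtoC (damped s th x))).
have cst_cont (k : R) : continuous (fun _ : R => k) by move=> x; exact: cvg_cst.
have cA : ci (fun th => RtoC (wt th) * A th).
  have := I_fubini_cmf mF mB FB iB; under eq_fun => th do rewrite F_wt -/(A th).
  move=> mA; apply: (ci_dom mA (rint_itv 0 (pi / 2) (cst_cont (4 * s ^+ 2 * K)))) => th.
  rewrite /A -F_wt; apply: le_trans (cabs_I_le _ (JB th).1 _) _ => [|x|].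
  - exact: (cmf_comp mF (measurable_pair1 th)).
  - exact: FB.
  rewrite (JB th).2 !rindE; case: ifPn => [/andP[h1 h2]|_]; first by rewrite h1 (ltW h2).
  by rewrite mul0r; case: ifP => _; rewrite ?mul0r// mul1r mulr_ge0// mulr_ge0// sqr_ge0.
have cc2 : continuous (fun th : R => 4 * s ^+ 2 * cos th ^+ 2).
  move=> th; apply: cvgM; first exact: cvg_cst.
  by apply: cvgM; exact: continuous_cos.
have dcs (th : R) : is_derive th (1 : R) (fun th => 2 * s ^+ 2 * (th + sin th * cos th)) (4 * s ^+ 2 * cos th ^+ 2).
  apply: der_eq (dZ _ (dD (d_id th) (dM (is_derive_sin th) (is_derive_cos th)))) _.
  have := cos2Dsin2 th; move: (cos th) (sin th) => c z h.
  have -> : 1 = c ^+ 2 + z ^+ 2 by rewrite h.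
  by ring.
have E1 : RtoC (pi * s ^+ 2) = I (fun th => RtoC (wt th) * RtoC (cos th / s)).
  transitivity (I (fun th => RtoC (rind (0 <= th <= pi / 2) * (4 * s ^+ 2 * cos th ^+ 2)))).
    rewrite I_RtoC (J_ftc p0 cc2 dcs) cos_pihalf cos0 sin0; congr RtoC; by field.
  apply: eqI => th; rewrite -RtoCM /wt; congr RtoC; field; by rewrite gt_eqF.
have cE : ci (fun th => RtoC (wt th) * RtoC (cos th / s)).
  have := ci_itv 0 (pi / 2) (ccont_RtoC cc2).
  congr ci; apply/funext => th; rewrite -RtoCM /ind -RtoCM /wt; congr RtoC; field; by rewrite gt_eqF.
rewrite I_kk -/A E1 -(IZl _ cE) -(IB cA); last exact: ciZ.
have -> : 2 * pi * s * M = J (fun th => rind (0 <= th <= pi / 2) * (4 * s * M)).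
  have dt (t : R) : is_derive t (1 : R) (fun t => 4 * s * M * t) (4 * s * M).
    by apply: der_eq (dZ _ (d_id t)) _; rewrite mulr1.
  by rewrite (J_ftc p0 (cst_cont _) dt); field.
apply: cabs_I_le.
- by case: (ciB cA (ciZ P0 cE)).
- exact: rint_itv.
move=> th; have -> : RtoC (wt th) * A th - P0 * (RtoC (wt th) * RtoC (cos th / s)) =
   RtoC (wt th) * (A th - P0 * RtoC (cos th / s)) by ring.
rewrite cabsM cabs_RtoC (ger0_norm (wt_ge0 _)).
have [h|h] := boolP (0 <= th < pi / 2).
  have w := wt_exp h; case/andP: h => h1 h2.
  have := damped_bound s0 h1 h2 mP PK mr rM PE; rewrite -/(A th) => D.
  apply: le_trans (ler_wpM2l (wt_ge0 th) D) _.
  rewrite h1 (ltW h2) rindE mul1r.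
  have -> : wt th * (M / (s * (s * cos th))) = wt th / (s * cos th) * (M / s).
    by rewrite [s * (s * _)]mulrC invfM; ring.
  by rewrite w le_eqVlt; apply/orP; left; apply/eqP; field; rewrite gt_eqF.
have -> : wt th = 0.
  rewrite /wt rindE; case: ifPn => h'; last by rewrite mul0r.
  by have := thpi h'; rewrite (negbTE h) => /eqP ->; rewrite cos_pihalf !mulr0.
by rewrite mul0r rindE; case: ifP => _; rewrite ?mul0r// mul1r mulr_ge0// mulr_ge0// ltW.
Qed.

End KernelBound.
End NewmanKernel.

(** * A smooth mixture of the kernels, and the estimate of p(h) by a convolution *)

Section BandLimited.
Variable R : realType.
Local Notation C := R[i].
Local Notation mu := (@lebesgue_measure R).
Variables a b : R.
Hypotheses (a0 : 0 < a) (ab : a < b).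

Let A := a ^+ 2.
Let B := b ^+ 2.
Let b0 : 0 < b. Proof. exact: lt_trans a0 ab. Qed.
Let A0 : 0 < A. Proof. exact: exprn_gt0. Qed.
Let AB : A < B. Proof. by rewrite /A /B ltr_pXn2r// ?nnegrE ltW. Qed.
Let BA0 : B - A != 0. Proof. by rewrite gt_eqF// subr_gt0. Qed.

Let u (r : R) := (B - A)^-1 * r + - (B - A)^-1 * A.
Let uE r : u r = (r - A) / (B - A). Proof. by rewrite /u; ring. Qed.

(** A smooth probability density on [a^2, b^2] for the squared radius r = s^2, with upper tail [W].
    In this variable the kernel is the truncated linear function (r - t^2)_+. *)
Definition wfun (r : R) : R := derive1 (@step R) (u r) * (B - A)^-1.
Let W (r : R) : R := 1 - step (u r).

Let smooth_u : smooth u.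
Proof.
apply: smoothD; last exact: smooth_cst.
by apply: smoothZ; exact: smooth_id.
Qed.

Let smooth_w : smooth wfun.
Proof.
apply: smoothM; last exact: smooth_cst.
by apply: smooth_comp smooth_u; apply: smooth_derive1; exact: smooth_step.
Qed.

Let smooth_W : smooth W.
Proof. by apply: smoothB; [exact: smooth_cst|apply: smooth_comp smooth_u; exact: smooth_step]. Qed.

Let dW r : is_derive r (1 : R) W (- wfun r).
Proof.
have d1 := smooth_is_derive (@smooth_step R) (u r).
apply: der_eq (dB (d_cst 1 r) (d_comp d1 (d_lin (B - A)^-1 (- (B - A)^-1 * A) r))) _.
by rewrite /wfun; ring.
Qed.

Lemma wfun_ge0 r : 0 <= wfun r.
Proof. by rewrite mulr_ge0 ?step_derive_ge0// invr_ge0 subr_ge0 ltW. Qed.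

Let u_ge1 r : B <= r -> 1 <= u r.
Proof. by move=> h; rewrite uE ler_pdivlMr ?subr_gt0// mul1r lerD2r. Qed.

Let u_le0 r : r <= A -> u r <= 0.
Proof. by move=> h; rewrite uE pmulr_lle0 ?invr_gt0 ?subr_gt0// subr_le0. Qed.

Let W0 r : B <= r -> W r = 0.
Proof. by move=> h; rewrite /W step_ge1 ?subrr// u_ge1. Qed.

Let W1 r : r <= A -> W r = 1.
Proof. by move=> h; rewrite /W step_le0 ?subr0// u_le0. Qed.

Lemma wfun0 r : ~~ (A <= r <= B) -> wfun r = 0.
Proof.
rewrite negb_and -!ltNge => h; apply: oppr_inj; rewrite oppr0.
have [_ <-] := dW r; have : is_derive r (1 : R) W 0; last by case.
case/orP: h => h.
  apply: near_eq_is_derive (d_cst 1 r).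
  by near=> s; rewrite W1// ltW//; near: s; exact: lt_nbhsl.
apply: near_eq_is_derive (d_cst 0 r).
by near=> s; rewrite W0// ltW//; near: s; exact: lt_nbhsr.
Unshelve. all: by end_near. Qed.

Lemma wfun_ind (f : R -> R) : (fun r => wfun r * f r) = (fun r => rind (A <= r <= B) * (wfun r * f r)).
Proof.
apply/funext => r; rewrite rindE; case: ifPn => h; rewrite ?mul1r//.
by rewrite wfun0// !mul0r.
Qed.

Lemma rint_wfun (f : R -> R) : continuous f -> rint (fun r => wfun r * f r).
Proof.
move=> cf; rewrite wfun_ind; apply: rint_itv => x.
by apply: cvgM; [exact: smooth_continuous|exact: cf].
Qed.

(** The mean squared radius, which is also the value at 0 of the mixture [phib]. *)
Definition wmass : R := J (fun r => wfun r * r).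

Lemma wmass_gt0 : 0 < wmass.
Proof.
have c1 : continuous (fun r : R => A) by move=> x; exact: cvg_cst.
have c2 : continuous (fun r : R => r) by move=> x; exact: cvg_id.
apply: (@lt_le_trans _ _ A) => //.
have <- : J (fun r => wfun r * A) = A.
  rewrite wfun_ind.
  have dd r : is_derive r (1 : R) (fun r => - A * W r) (wfun r * A).
    by apply: der_eq (dZ (- A) (dW r)) _; ring.
  rewrite (J_ftc (ltW AB) _ dd); first by rewrite W0// W1//; ring.
  by move=> x; apply: cvgM; [exact: smooth_continuous|exact: cvg_cst].
apply: le_J; [exact: rint_wfun|exact: rint_wfun|move=> r].
have [h|h] := boolP (A <= r <= B); last by rewrite wfun0// !mul0r.
by case/andP: h => h _; rewrite ler_wpM2l// wfun_ge0.
Qed.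

(** [W] equals 1 far to the left, where its integral from -oo would diverge. The second step cuts it
    off below and leaves it unchanged for r >= 0, where the values of t^2 lie. *)
Let W2 (r : R) : R := W r * step (r + 2).

Let smooth_W2 : smooth W2.
Proof.
apply: smoothM smooth_W _; apply: (@smooth_comp R (@step R) (fun r : R => r + 2)); first exact: smooth_step.
by apply: smoothD; [exact: smooth_id|exact: smooth_cst].
Qed.

Let cW2 : continuous W2 := smooth_continuous smooth_W2.

Let W2_supp r : ~~ (- 2 <= r <= B) -> W2 r = 0.
Proof.
rewrite negb_and -!ltNge /W2 => /orP[h|h]; last by rewrite W0 ?mul0r// ltW.
by rewrite step_le0 ?mulr0//; lra.
Qed.

Let W2_W r : 0 <= r -> W2 r = W r.
Proof. by move=> h; rewrite /W2 step_ge1 ?mulr1//; lra. Qed.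

Let V (y : R) : R := \int[mu]_(r in [set` `]-oo, y]]) W2 r.

Let dV' y : is_derive y (1 : R) V (W2 y).
Proof.
have i2 : rint W2.
  rewrite (_ : W2 = fun r => rind (- 2 <= r <= B) * W2 r).
    exact: (rint_itv _ _ cW2).
  apply/funext => r; rewrite rindE; case: ifPn => h; rewrite ?mul1r// mul0r.
  exact: W2_supp.
have [] := @continuous_FTC1 R W2 (BInfty R true) y (y + 1).
- by rewrite ltrDl.
- by apply: integrableS i2 => //.
- exact: ltNyr.
- exact: cW2.
by move=> d1 d2; split; [exact: d1|rewrite -derive1E; exact: d2].
Qed.

(** The integral of [W] from t^2 to b^2. Written through the primitive [V], it is smooth as a
    composition; [phibE] recovers the mixture. *)
Definition phib (t : R) : R := V B - V (t ^+ 2).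

Let V_const y : B <= y -> V y = V B.
Proof.
move=> h; apply/eqP; rewrite -subr_eq0; apply/eqP.
rewrite -(J_ftc h cW2 dV').
rewrite (_ : (fun r => _) = fun=> 0); first by rewrite /J Rintegral_cst// mul0r.
apply/funext => r; rewrite rindE; case: ifPn => [/andP[h1 h2]|]; rewrite ?mul0r// mul1r.
by rewrite /W2 W0 ?mul0r.
Qed.

Lemma phib_tst : tst (- b) b phib.
Proof.
split.
  apply: smoothB; first exact: smooth_cst.
  apply: (@smooth_comp R V (fun t => t ^+ 2)); first exact: smooth_primitive dV' smooth_W2.
  by under eq_fun do rewrite expr2; apply: smoothM; exact: smooth_id.
move=> t ht; rewrite /phib V_const ?subrr// /B.
rewrite -[leRHS]real_normK ?num_real// ler_pXn2r ?nnegrE ?(ltW b0)//.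
by move: ht; rewrite -ler_norml -ltNge => /ltW.
Qed.

Lemma phibE t : phib t = J (fun r => wfun r * ((r - t ^+ 2) * rind (t ^+ 2 <= r))).
Proof.
rewrite /phib; set y := t ^+ 2; have y0 : 0 <= y by exact: sqr_ge0.
have [h|h] := ltP B y.
  rewrite (V_const (ltW h)) subrr (_ : (fun r => _) = fun=> 0); first by rewrite /J Rintegral_cst// mul0r.
  apply/funext => r; have [h'|h'] := boolP (A <= r <= B); last by rewrite wfun0// mul0r.
  by rewrite rindE leNgt (le_lt_trans _ h) ?mulr0//; case/andP: h'.
(* Integration by parts in r: where [W2] agrees with [W], the derivative of this function is -(r -
   y) [wfun r]. *)
pose F r := (r - y) * W r - V r.
have dF r : is_derive r (1 : R) F ((r - y) * - wfun r + W r - W2 r).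
  by apply: der_eq (dB (dM (dB (d_id r) (d_cst y r)) (dW r)) (dV' r)) _; ring.
have cF : continuous (fun r => (r - y) * - wfun r + W r - W2 r).
  move=> r; apply: cvgB; last exact: cW2.
  apply: cvgD; last exact: (smooth_continuous smooth_W).
  apply: cvgM; first by apply: cvgB; [exact: cvg_id|exact: cvg_cst].
  by apply: cvgN; exact: (smooth_continuous smooth_w).
have E := J_ftc h cF dF.
have -> : V B - V y = - (F B - F y) by rewrite /F W0// subrr; ring.
rewrite -E -mulN1r -JZl; last exact: rint_itv.
congr J; apply/funext => r; rewrite !rindE.
have [yr|yr] := leP y r => /=; last by rewrite !mul0r !mulr0.
have [rB|rB] := leP r B.
  by rewrite mul1r mulr1 (W2_W (le_trans y0 yr)); ring.
by rewrite wfun0 ?negb_and -?ltNge ?rB ?orbT// !mul0r mulr0.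
Qed.

Lemma Fh_phib x : x != 0 -> Fh phib x = I (fun r => RtoC (wfun r * kk (Num.sqrt r) x)).
Proof.
move=> x0; rewrite /Fh.
pose F (z : R * R) : C := cexpi (- (x * z.1)) * RtoC (wfun z.2 * ((z.2 - z.1 ^+ 2) * rind (z.1 ^+ 2 <= z.2))).
have mF : cmf F.
  apply: cmfM; first exact: (cmf_comp (cmf_osc x)).
  apply: cmf_RtoC; apply: measurable_funM.
    by apply: measurableT_comp; first exact: smooth_meas.
  have m2 : measurable_fun [set: R * R] (fun z : R * R => z.1 ^+ 2) by exact: measurable_funX.
  apply: measurable_funM; first exact: measurable_funB.
  by apply: measurable_rind; exact: measurable_fun_ler.
have c1 : continuous (fun _ : R => 1 : R) by move=> ?; exact: cvg_cst.
have cB : continuous (fun _ : R => B) by move=> ?; exact: cvg_cst.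
have dom t r : cabs (F (t, r)) <= rind (- b <= t <= b) * 1 * (wfun r * B).
  rewrite /F cabsM cabs_cexpi mul1r cabs_RtoC normrM (ger0_norm (wfun_ge0 _)) /= mulrCA.
  have [h|h] := boolP (A <= r <= B); last by rewrite wfun0// !mul0r.
  case/andP: h => h1 h2; rewrite ler_wpM2l ?wfun_ge0// !rindE mulr1.
  have [h|h] := leP (t ^+ 2) r; last by rewrite mulr0 normr0 mulr_ge0 ?sqr_ge0//; case: ifP.
  have -> : - b <= t <= b.
    rewrite -ler_norml -(@ler_pXn2r _ 2%N) ?nnegrE ?(ltW b0)// real_normK ?num_real//.
    exact: le_trans h h2.
  rewrite mulr1 mul1r ger0_norm ?subr_ge0//; apply: le_trans h2.
  by rewrite lerBlDr lerDl sqr_ge0.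
have := I_fubini_prod mF (rint_itv (- b) b c1) (rint_wfun cB) dom.
have -> : I (fun t => cexpi (- (x * t)) * RtoC (phib t)) = I (fun t => I (fun r => F (t, r))).
  apply: eqI => t; rewrite phibE -I_RtoC -IZl//.
  apply: ci_ReIm; last exact: integrable0.
  apply: rint_dom (rint_wfun cB) _ => [|r] /=.
    apply: measurable_funM; first exact: smooth_meas.
    apply: measurable_funM; first exact: measurable_funB.
    by apply: measurable_rind; exact: measurable_fun_ler.
  have := dom t r; rewrite /F cabsM cabs_cexpi mul1r cabs_RtoC => /le_trans; apply.
  by rewrite rindE; case: ifP => _; rewrite ?mul1r// !mul0r mulr_ge0 ?wfun_ge0 ?sqr_ge0.
move=> ->; apply: eqI => r.
have [h|h] := boolP (A <= r <= B); last first.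
  by rewrite wfun0// mul0r -[RHS]I0; apply: eqI => t; rewrite /F /= wfun0// !mul0r mulr0.
have r0 : 0 < r by case/andP: h => h _; exact: lt_le_trans h.
have s0 : 0 < Num.sqrt r by rewrite sqrtr_gt0.
rewrite -(kk_fourier s0 x0) RtoCM.
set s := Num.sqrt r; have s2 : s ^+ 2 = r by rewrite sqr_sqrtr ?ltW.
have indE' t : (t ^+ 2 <= r) = (- s <= t <= s).
  by rewrite -ler_norml -s2 -[t ^+ 2]real_normK ?num_real// ler_pXn2r ?nnegrE ?(ltW s0).
have cc : continuous (fun t : R => (s ^+ 2 - t ^+ 2) * cos (x * t)).
  move=> t; apply: cvgM.
    by apply: cvgB; [exact: cvg_cst|apply: cvgM; exact: cvg_id].
  by apply: (@continuous_comp _ _ _ (fun t => x * t) cos); [exact: continuous_scale|exact: continuous_cos].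
have cs : continuous (fun t : R => (s ^+ 2 - t ^+ 2) * sin (x * t)).
  move=> t; apply: cvgM.
    by apply: cvgB; [exact: cvg_cst|apply: cvgM; exact: cvg_id].
  by apply: (@continuous_comp _ _ _ (fun t => x * t) sin); [exact: continuous_scale|exact: continuous_sin].
have rs := rint_itv (- s) s cs.
(* The sine part has an odd integrand; reflection shows that its integral is its own negative. *)
have J0 : J (fun t => rind (- s <= t <= s) * ((s ^+ 2 - t ^+ 2) * sin (x * t))) = 0.
  have mo : measurable_fun setT (fun x : R => - x).
    by apply: continuous_measurable_fun => y; apply: continuousN; exact: cvg_id.
  have [_] := rint_pushforward mo (@lebesgue_measureN R) rs.
  have -> : (fun t => rind (- s <= - t <= s) * ((s ^+ 2 - (- t) ^+ 2) * sin (x * - t))) =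
     (fun t => -1 * (rind (- s <= t <= s) * ((s ^+ 2 - t ^+ 2) * sin (x * t)))).
    apply/funext => t; rewrite mulrN sinN sqrrN lerNl opprK lerNl [X in rind X]andbC; ring.
  by rewrite (JZl _ rs); set j := J _; lra.
apply: eqC; rewrite /= ?mul0r ?mulr0 ?subr0 ?add0r ?addr0.
  rewrite -(JZl _ (rint_itv _ _ cc)); congr J; apply/funext => t.
  by rewrite /F /= indE' s2 cosN; ring.
transitivity (- wfun r * J (fun t => rind (- s <= t <= s) * ((s ^+ 2 - t ^+ 2) * sin (x * t)))); last by rewrite J0 mulr0.
rewrite -(JZl _ rs); congr J; apply/funext => t.
by rewrite /F /= indE' s2 sinN; ring.
Qed.

Let sqrt_sqr r : A <= r -> Num.sqrt r ^+ 2 = r.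
Proof. by move=> h; rewrite sqr_sqrtr// (le_trans (ltW A0)). Qed.

Let sqrt_le_div r : A <= r -> Num.sqrt r <= r / a.
Proof.
move=> h; rewrite ler_pdivlMr// -[leRHS](sqrt_sqr h) expr2 ler_wpM2l//.
by rewrite -[leLHS](ger0_norm (ltW a0)) -sqrtr_sqr ler_wsqrtr.
Qed.

Let double_kernel (z : C) (x y : R) : RtoC (2 * pi) * z * RtoC (x * y) =
  RtoC x * ((z + z) * RtoC (pi * y)).
Proof. by rewrite !RtoCM (_ : RtoC 2 = 1 + 1) ?RtoCD//; ring. Qed.

(** The transform is placed at [u - h], a window travelling with h; the sign is the one that
    [Fh_mod] delivers. *)
Definition conv (p : R -> C) (phi : R -> R) (h : R) : C := I (fun u => p u * Fh phi (u - h)).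

Lemma Fh_rint phi (c d h : R) : c <= d -> tst c d phi -> exists k, 0 < k /\
  forall x, cabs (Fh phi x) <= k * q x.
Proof.
move=> cd tp; have [k [k0 kF]] := Fh_decay cd tp; exists k; split=> // x.
apply: le_trans (kF x) _; rewrite ler_wpM2l ?(ltW k0)// expr2 ler_piMl ?(ltW (q_gt0 _))//.
by rewrite /q invf_le1 ?ltr_pwDl ?sqr_ge0// lerDl sqr_ge0.
Qed.

Lemma conv_ci (p : R -> C) (K : R) phi (c d h : R) : c <= d -> tst c d phi ->
  cmf p -> (forall u, cabs (p u) <= K) -> ci (fun u => p u * Fh phi (u - h)).
Proof.
move=> cd tp mp pK; have [k [k0 kF]] := Fh_rint h cd tp.
have m : cmf (fun u => p u * Fh phi (u - h)).
  apply: cmfM => //; apply: (cmf_comp (ccont_cmf (Fh_ccont tp))).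
  exact: measurable_funB.
apply: (ci_dom m (rintZl (K * k) (rint_q1 h))) => u'.
rewrite cabsM -mulrA; apply: ler_pM => //; exact: cabs_ge0.
Qed.

(** Folding at h and expanding the transform as a mixture leaves [kernel_bound] for each radius s =
    sqrt r, with P0 = 2 p(h). On the support s >= a, so the error of size s is at most s^2 / a, and
    averaging it yields a multiple of [wmass]. *)
Lemma phib_estimate (p r : R -> C) (h K M : R) :
  cmf p -> (forall u, cabs (p u) <= K) -> cmf r -> (forall v, cabs (r v) <= M) ->
  (forall x, 0 < x -> p (h + x) + p (h - x) =
     p h + p h + I (fun v => ind (v < x) * (ind (0 < v) * r v))) ->
  cabs (conv p phib h - RtoC (2 * pi * wmass) * p h) <= 2 * pi * wmass * (M / a).
Proof.
move=> mp pK mr rM pE; have K0 : 0 <= K by apply: le_trans (pK 0); exact: cabs_ge0.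
have M0 : 0 <= M by apply: le_trans (rM 0); exact: cabs_ge0.
pose P x := p (h + x) + p (h - x).
have mP : cmf P.
  apply: cmfD; apply: (cmf_comp mp); first exact: measurable_funD.
  exact: measurable_funB.
have PK x : cabs (P x) <= 2 * K.
  by rewrite mulr_natl mulr2n; apply: le_trans (ler_cabsD _ _) _; exact: lerD.
pose X s := I (fun x => ind (0 < x) * (P x * RtoC (kk s x))).
have bb : - b <= b by have := b0; lra.
have cc := conv_ci h bb phib_tst mp pK.
have c1 : continuous (fun r : R => 4 * b ^+ 3 + 8 * b) by move=> ?; exact: cvg_cst.
pose F (z : R * R) : C := RtoC (wfun z.1) * (ind (0 < z.2) * (P z.2 * RtoC (kk (Num.sqrt z.1) z.2))).
have mF : cmf F.
  apply: cmfM; first by apply: cmf_RtoC; apply: measurableT_comp; first exact: smooth_meas.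
  apply: cmfM; first by apply: cmf_ind; exact: measurable_fun_ltr.
  apply: cmfM; first exact: (cmf_comp mP).
  apply: cmf_RtoC; apply: kk_meas => //.
  apply: (@measurableT_comp _ _ _ _ _ _ (@Num.sqrt R)) => //.
  by apply: continuous_measurable_fun => ?; exact: sqrt_continuous.
have rq : rint (fun x : R => 2 * K * q x).
  apply: rintZl; have := @rint_q1 R 0; by under eq_fun do rewrite subr0.
have sq r' : A <= r' <= B -> 0 < Num.sqrt r' /\ Num.sqrt r' <= b.
  move=> /andP[h1 h2]; split; first by rewrite sqrtr_gt0 (lt_le_trans A0).
  by rewrite -[leRHS](ger0_norm (ltW b0)) -sqrtr_sqr ler_wsqrtr.
have kkb r' x : A <= r' <= B -> `|kk (Num.sqrt r') x| <= (4 * b ^+ 3 + 8 * b) * q x.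
  move=> hr; have [s0 sb] := sq _ hr; apply: le_trans (kk_le x s0) _.
  rewrite ler_wpM2r ?(ltW (q_gt0 _))// lerD ?ler_wpM2l// ler_pXn2r ?nnegrE ?(ltW s0) ?(ltW b0)//.
have dom r' x : cabs (F (r', x)) <= wfun r' * (4 * b ^+ 3 + 8 * b) * (2 * K * q x).
  rewrite /F cabsM cabs_RtoC (ger0_norm (wfun_ge0 _)) /= -[leRHS]mulrA.
  have [hr|hr] := boolP (A <= r' <= B); last by rewrite wfun0// !mul0r.
  rewrite ler_wpM2l ?wfun_ge0// cabsM.
  have -> : (4 * b ^+ 3 + 8 * b) * (2 * K * q x) = 1 * ((2 * K) * ((4 * b ^+ 3 + 8 * b) * q x)) by ring.
  apply: ler_pM; [exact: cabs_ge0|exact: cabs_ge0|exact: cabs_ind_le1|].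
  rewrite cabsM cabs_RtoC; apply: ler_pM; [exact: cabs_ge0|by []|exact: PK|exact: kkb].
have rw := rint_wfun c1.
have FX r' : I (fun x => F (r', x)) = RtoC (wfun r') * X (Num.sqrt r').
  have [hr|hr] := boolP (A <= r' <= B); last first.
    by rewrite wfun0// mul0r -[RHS]I0; apply: eqI => x; rewrite /F /= wfun0// mul0r.
  rewrite /F /= IZl//; apply: (ci_dom _ (rintZl (4 * b ^+ 3 + 8 * b) rq)) => [|x].
    apply: cmfM; first by apply: cmf_ind; exact: measurable_fun_ltr.
    by apply: cmfM => //; apply: cmf_RtoC; exact: kk_meas.
  have -> : (4 * b ^+ 3 + 8 * b) * (2 * K * q x) = 1 * ((2 * K) * ((4 * b ^+ 3 + 8 * b) * q x)) by ring.
  rewrite cabsM; apply: ler_pM; [exact: cabs_ge0|exact: cabs_ge0|exact: cabs_ind_le1|].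
  by rewrite cabsM cabs_RtoC; apply: ler_pM; [exact: cabs_ge0|by []|exact: PK|exact: kkb].
have E1 : conv p phib h = I (fun r' => RtoC (wfun r') * X (Num.sqrt r')).
  rewrite /conv (I_half h cc).
  transitivity (I (fun x => I (fun r' => F (r', x)))).
    apply: eqI => x; rewrite indE; case: ifPn => x0; last first.
      rewrite mul0r -[LHS]I0; apply: eqI => r'; by rewrite /F /= (indE R (0 < x)) (negbTE x0) mul0r mulr0.
    have xn : x != 0 by rewrite gt_eqF.
    have -> : h + x - h = x by ring. have -> : h - x - h = - x by ring.
    rewrite !Fh_phib ?oppr_eq0//; under [in X in _ + _ * X]eq_fun => r' do rewrite kk_even.
    rewrite mul1r -mulrDl -/(P x) -IZl; last first.
      apply: ci_ReIm; last exact: integrable0.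
      apply: rint_dom (rintZl (q x) rw) _ => [|r'] /=.
        apply: measurable_funM; first exact: smooth_meas.
        apply: kk_meas => //; by apply: continuous_measurable_fun => ?; exact: sqrt_continuous.
      rewrite normrM (ger0_norm (wfun_ge0 _)).
      have [hr|hr] := boolP (A <= r' <= B); last by rewrite wfun0// !mul0r mulr0.
      by rewrite mulrCA ler_wpM2l ?wfun_ge0// mulrC kkb.
    by apply: eqI => r'; rewrite /F /= (indE R (0 < x)) x0 mul1r RtoCM; ring.
  by rewrite -(I_fubini_prod mF rw rq dom); apply: eqI => r'; rewrite FX.
have cX : ci (fun r' => RtoC (wfun r') * X (Num.sqrt r')).
  have := I_fubini_prod_cmf mF rw rq dom; under eq_fun do rewrite FX.
  move=> mX; apply: (ci_dom mX (rintZl (J (fun x => 2 * K * q x)) rw)) => r'.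
  rewrite -FX mulrC -(JZl _ rq); apply: cabs_I_le; [exact: (cmf_comp mF (measurable_pair1 r'))|exact: (rintZl _ rq)|].
  exact: dom.
have cid : continuous (fun r : R => r) by move=> ?; exact: cvg_id.
have rm := rint_wfun cid.
have cm : ci (fun r' => RtoC (wfun r' * r')) by apply: ci_ReIm; [exact: rm|exact: integrable0].
pose c0 : C := RtoC (2 * pi) * p h.
have E2 : RtoC (2 * pi * wmass) * p h = I (fun r' => c0 * RtoC (wfun r' * r')).
  by rewrite (IZl _ cm) I_RtoC -/wmass RtoCM /c0; ring.
rewrite E1 E2 -(IB cX (ciZ c0 cm)).
have -> : 2 * pi * wmass * (M / a) = J (fun r' => 2 * pi * M / a * (wfun r' * r')).
  by rewrite (JZl _ rm) -/wmass; ring.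
apply: cabs_I_le; [exact: (ciB cX (ciZ c0 cm)).1|exact: (rintZl _ rm)|move=> r'].
have [hr|hr] := boolP (A <= r' <= B); last first.
  by rewrite (wfun0 hr) !(mul0r, RtoC0, mulr0) subrr cabs0.
have [s0 sb] := sq _ hr; case/andP: (hr) => hA hB.
have -> : RtoC (wfun r') * X (Num.sqrt r') - c0 * RtoC (wfun r' * r') =
    RtoC (wfun r') * (X (Num.sqrt r') - (p h + p h) * RtoC (pi * Num.sqrt r' ^+ 2)).
  by rewrite (sqrt_sqr hA) /c0 double_kernel mulrBr.
rewrite cabsM cabs_RtoC (ger0_norm (wfun_ge0 _)).
apply: le_trans (ler_wpM2l (wfun_ge0 _) (kernel_bound s0 mP PK mr rM pE)) _.
have -> : 2 * pi * M / a * (wfun r' * r') = wfun r' * (2 * pi * (r' / a) * M) by ring.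
apply: (ler_wpM2l (wfun_ge0 _)); apply: (ler_wpM2r M0).
by apply: ler_wpM2l; [rewrite mulr_ge0 ?pi_ge0|exact: sqrt_le_div].
Qed.

End BandLimited.

(** * Boundedness and limit superior of a Lipschitz primitive *)

Section LipschitzPrimitive.
Variable R : realType.
Local Notation C := R[i].

Definition good (p : R -> C) (phi : R -> R) :=
  (fun h => cabs (conv p phi h)) @ +oo --> (0 : R).

Lemma goodP (p : R -> C) phi : good p phi <->
  forall e, 0 < e -> exists H, forall h, H <= h -> cabs (conv p phi h) <= e.
Proof.
split=> [/cvgrPdist_le g e e0|g].
  have [H [_ HH]] := g e e0; exists (H + 1) => h Hh.
  have := HH h; rewrite sub0r normrN ger0_norm ?cabs_ge0//; apply.
  by rewrite (lt_le_trans _ Hh)// ltrDl.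
apply/cvgrPdist_le => e e0; have [H HH] := g e e0.
near=> h; rewrite sub0r normrN ger0_norm ?cabs_ge0//; apply: HH; near: h.
by apply: nbhs_pinfty_ge; rewrite num_real.
Unshelve. all: by end_near. Qed.

Lemma q_sqr (x : R) : `|x| * q x ^+ 2 <= q x.
Proof.
rewrite expr2 mulrA ler_piMl ?(ltW (q_gt0 _))// /q ler_pdivrMr ?ltr_pwDl ?sqr_ge0// mul1r.
have := sqr_ge0 (`|x| - 1); rewrite -[x ^+ 2]real_normK ?num_real//; have := normr_ge0 x; nra.
Qed.

Lemma q_sqr_le (x : R) : q x ^+ 2 <= q x.
Proof.
rewrite expr2 ler_piMl ?(ltW (q_gt0 _))// /q invf_le1 ?ltr_pwDl ?sqr_ge0//.
by rewrite lerDl sqr_ge0.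
Qed.

Lemma cmf_Fh (phi : R -> R) (c d h : R) : tst c d phi -> cmf (fun u : R => Fh phi (u - h)).
Proof. by move=> tp; apply: (cmf_comp (ccont_cmf (Fh_ccont tp))); exact: measurable_funB. Qed.

(** Gives meaning to the convolution while only linear growth of p is known: one factor [q] of the
    decay absorbs |u - h|, by [q_sqr]. *)
Lemma conv_lip_ci (p : R -> C) phi (c d h M A : R) : c <= d -> tst c d phi -> cmf p ->
  (forall u, cabs (p u) <= A + M * `|u - h|) -> 0 <= A -> 0 <= M ->
  exists k, 0 <= k /\ ci (fun u => p u * Fh phi (u - h)) /\
   forall u, cabs (p u * Fh phi (u - h)) <= k * q (u - h).
Proof.
move=> cd tp mp pA A0 M0; have [k [k0 kF]] := Fh_decay cd tp.
have bd u : cabs (p u * Fh phi (u - h)) <= (A + M) * k * q (u - h).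
  rewrite cabsM; apply: le_trans (ler_pM (cabs_ge0 _) (cabs_ge0 _) (pA u) (kF _)) _.
  have := q_sqr (u - h); have := q_sqr_le (u - h); move: (q _) `|_| => x y h1 h2.
  have -> : (A + M * y) * (k * x ^+ 2) = k * (A * x ^+ 2 + M * (y * x ^+ 2)) by ring.
  have -> : (A + M) * k * x = k * (A * x + M * x) by ring.
  by rewrite ler_wpM2l ?(ltW k0)// lerD// ler_wpM2l.
exists ((A + M) * k); split; first by rewrite mulr_ge0 ?addr_ge0 ?(ltW k0).
split => //; apply: (ci_dom _ (rintZl _ (rint_q1 h)) bd).
by apply: cmfM => //; exact: cmf_Fh tp.
Qed.

Variables (p r : R -> C) (M u0 : R).
Hypotheses (mr : cmf r) (rM : forall v, cabs (r v) <= M)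
  (r0 : forall v, v < u0 -> r v = 0)
  (pE : forall u, p u = I (fun v => ind (v < u) * r v)).

Let M0 : 0 <= M. Proof. by apply: le_trans (rM 0); exact: cabs_ge0. Qed.

Let ccst (k : R) : continuous (fun _ : R => k). Proof. by move=> x; exact: cvg_cst. Qed.

Let r_cut (x y : R) (c : R -> bool) : measurable_fun setT c -> (forall v, c v -> x <= v <= y) ->
  ci (fun v => ind (c v) * r v).
Proof.
move=> mc cxy; apply: (ci_dom _ (rint_itv x y (@ccst M))) => [|v].
  by apply: cmfM mr; exact: cmf_ind.
rewrite cabsM indE; case: ifPn => h; last by rewrite cabs0 mul0r mulr_ge0.
by rewrite cabs1 mul1r rindE cxy// mul1r.
Qed.

Let r_ci u : ci (fun v => ind (v < u) * r v).
Proof.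
have -> : (fun v => ind (v < u) * r v) = (fun v => ind (u0 <= v < u) * r v).
  apply/funext => v; have [h|h] := leP u0 v; first by [].
  by rewrite r0// !mulr0.
apply: (@r_cut u0 u); last by move=> v /andP[-> /ltW].
by apply: measurable_and; [exact: measurable_fun_ler|exact: measurable_fun_ltr].
Qed.

Lemma prim_diff v u : v <= u -> p u - p v = I (fun x => ind (v <= x < u) * r x).
Proof.
move=> vu; rewrite !pE -(IB (r_ci u) (r_ci v)); apply: eqI => x.
rewrite !indE; have [vx|xv] := leP v x => /=; first by case: ifP => _; rewrite ?mul0r ?subr0.
by rewrite (lt_le_trans xv vu) mul1r mul0r subrr.
Qed.

Lemma prim_lip u v : cabs (p u - p v) <= M * `|u - v|.
Proof.
wlog vu : u v / v <= u.
  by move=> H; have /orP[h|h] := le_total v u; [exact: H|rewrite cabs_distC distrC; exact: H].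
rewrite (prim_diff vu) ger0_norm ?subr_ge0//.
have dt t : is_derive t (1 : R) (fun t => M * t) M.
  by apply: der_eq (dZ M (d_id t)) _; rewrite mulr1.
have <- : J (fun t => rind (v <= t <= u) * M) = M * (u - v).
  by rewrite (J_ftc vu (@ccst M) dt) mulrBr.
apply: cabs_I_le; last 1 first.
- move=> x; rewrite cabsM indE rindE; case: ifPn => [/andP[h1 h2]|_].
    by rewrite cabs1 h1 (ltW h2) !mul1r.
  by rewrite cabs0 mul0r; case: ifP => _; rewrite ?mul1r ?mul0r.
- apply: cmfM mr; apply: cmf_ind; apply: measurable_and.
    exact: measurable_fun_ler.
  exact: measurable_fun_ltr.
- exact: (rint_itv _ _ (@ccst M)).
Qed.

Lemma prim_ccont : ccont p.
Proof. exact: ccont_lip prim_lip. Qed.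

Lemma prim_cmf : cmf p.
Proof. exact: ccont_cmf prim_ccont. Qed.

Lemma prim0 u : u <= u0 -> p u = 0.
Proof.
move=> h; rewrite pE -[RHS]I0; apply: eqI => v; rewrite indE; case: ifPn => vu; last by rewrite mul0r.
by rewrite r0 ?mulr0// (lt_le_trans vu).
Qed.

(** Puts the symmetric sum into the form required by [phib_estimate]. The new density r(h + v) - r(h
    - v) is bounded by 2M uniformly in h. *)
Lemma prim_sym h x : 0 < x -> p (h + x) + p (h - x) =
  p h + p h + I (fun v => ind (v < x) * (ind (0 < v) * (r (h + v) - r (h - v)))).
Proof.
move=> x0.
have e1 : p (h + x) - p h = I (fun v => ind (0 < v < x) * r (h + v)).
  have cr : ci (fun v => ind (h <= v < h + x) * r v).
    apply: (@r_cut h (h + x)) => [|v /andP[-> /ltW]//].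
    by apply: measurable_and; [exact: measurable_fun_ler|exact: measurable_fun_ltr].
  have [cs <-] : ci (fun v => ind (h <= h + v < h + x) * r (h + v)) /\
     I (fun v => ind (h <= h + v < h + x) * r (h + v)) = p (h + x) - p h.
    by rewrite prim_diff ?lerDl ?(ltW x0)//; exact: I_shift cr.
  apply: (@I_ae1 _ _ _ 0) => //.
    have mrs : cmf (fun v : R => r (h + v)) by apply: (cmf_comp mr); exact: measurable_funD.
    apply: (ci_dom _ (rint_itv 0 x (@ccst M))) => [|v].
      apply: cmfM mrs; apply: cmf_ind; apply: measurable_and; exact: measurable_fun_ltr.
    rewrite cabsM indE rindE; case: ifPn => [/andP[h1 h2]|_].
      by rewrite cabs1 (ltW h1) (ltW h2) !mul1r.
    by rewrite cabs0 mul0r; case: ifP => _; rewrite ?mul1r ?mul0r.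
  by move=> v v0; rewrite lerDl ltrD2l [0 < v]lt_neqAle [0 == v]eq_sym v0.
have e2 : p h - p (h - x) = I (fun v => ind (0 < v < x) * r (h - v)).
  have cr : ci (fun v => ind (h - x <= v < h) * r v).
    apply: (@r_cut (h - x) h) => [|v /andP[-> /ltW]//].
    by apply: measurable_and; [exact: measurable_fun_ler|exact: measurable_fun_ltr].
  have [cs Es] := I_shift h cr; have [cs' Es'] := I_opp cs.
  have -> : p h - p (h - x) = I (fun v => ind (h - x <= h + - v < h) * r (h + - v)).
    by rewrite Es' Es prim_diff// gerBl ltW.
  apply: (@I_ae1 _ _ _ x) => //.
    have mrs : cmf (fun v : R => r (h - v)) by apply: (cmf_comp mr); exact: measurable_funB.
    apply: (ci_dom _ (rint_itv 0 x (@ccst M))) => [|v].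
      apply: cmfM mrs; apply: cmf_ind; apply: measurable_and; exact: measurable_fun_ltr.
    rewrite cabsM indE rindE; case: ifPn => [/andP[h1 h2]|_].
      by rewrite cabs1 (ltW h1) (ltW h2) !mul1r.
    by rewrite cabs0 mul0r; case: ifP => _; rewrite ?mul1r ?mul0r.
  by move=> v vx; rewrite lerD2l lerN2 gtrDl oppr_lt0 andbC le_eqVlt (negbTE vx).
have c1 : ci (fun v => ind (0 < v < x) * r (h + v)).
  have mrs : cmf (fun v : R => r (h + v)) by apply: (cmf_comp mr); exact: measurable_funD.
  apply: (ci_dom _ (rint_itv 0 x (@ccst M))) => [|v].
    apply: cmfM mrs; apply: cmf_ind; apply: measurable_and; exact: measurable_fun_ltr.
  rewrite cabsM indE rindE; case: ifPn => [/andP[h1 h2]|_].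
    by rewrite cabs1 (ltW h1) (ltW h2) !mul1r.
  by rewrite cabs0 mul0r; case: ifP => _; rewrite ?mul1r ?mul0r.
have c2 : ci (fun v => ind (0 < v < x) * r (h - v)).
  have mrs : cmf (fun v : R => r (h - v)) by apply: (cmf_comp mr); exact: measurable_funB.
  apply: (ci_dom _ (rint_itv 0 x (@ccst M))) => [|v].
    apply: cmfM mrs; apply: cmf_ind; apply: measurable_and; exact: measurable_fun_ltr.
  rewrite cabsM indE rindE; case: ifPn => [/andP[h1 h2]|_].
    by rewrite cabs1 (ltW h1) (ltW h2) !mul1r.
  by rewrite cabs0 mul0r; case: ifP => _; rewrite ?mul1r ?mul0r.
have -> : I (fun v => ind (v < x) * (ind (0 < v) * (r (h + v) - r (h - v)))) =
   (p (h + x) - p h) - (p h - p (h - x)).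
  rewrite e1 e2 -(IB c1 c2); apply: eqI => v; rewrite !indE.
  by case: (0 < v); case: (v < x); rewrite /= ?(mul0r, mul1r, mulr0, subrr).
ring.
Qed.

Variables a b : R.
Hypotheses (a0 : 0 < a) (ab : a < b) (gp : good p (phib a b)).

Let bb : - b <= b. Proof. by have := lt_trans a0 ab; lra. Qed.
Let tp := phib_tst a0 ab.
Let m0 : 0 < 2 * pi * wmass a b.
Proof. by rewrite mulr_gt0 ?wmass_gt0// mulr_gt0 ?pi_gt0. Qed.

(** For the constant function 1, with r = 0, the error in [phib_estimate] vanishes. This computes
    the integral of the transform without Fourier inversion. *)
Lemma conv1 h : conv (fun=> 1) (phib a b) h = RtoC (2 * pi * wmass a b).
Proof.
have := @phib_estimate R a b a0 ab (fun=> 1) (fun=> 0) h 1 0 (cmf_cst _ 1) _ (cmf_cst _ 0) _ _.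
rewrite mul0r !mulr0 mulr1 => H; apply/eqP; rewrite -subr_eq0; apply/eqP/cabs_eq0/eqP.
rewrite eq_le cabs_ge0 andbT; apply: H.
- by move=> _; rewrite cabs1.
- by move=> _; rewrite cabs0.
- by move=> x _; rewrite (@eqI _ _ (fun=> 0)) ?I0 ?addr0// => v; rewrite !mulr0.
Qed.

(** Replacing p(u) by p(h) in the convolution costs at most M times the integral of |u - h|
    |phihat(u - h)|, hence at most M k pi. For large h the convolution itself is at most 1, so p(h)
    is bounded there. Further left the Lipschitz bound starting from u0, where p vanishes, takes
    over. *)
Lemma prim_bounded : exists K, forall u, cabs (p u) <= K.
Proof.
have [k [k0 kF]] := Fh_decay bb tp.
have [H HH] := (goodP _ _).1 gp 1 ltr01.
pose D := (1 + M * k * pi) / (2 * pi * wmass a b).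
have D0 : 0 <= D by rewrite divr_ge0 ?(ltW m0)// addr_ge0// mulr_ge0 ?pi_ge0// mulr_ge0 ?(ltW k0).
have big h : H <= h -> cabs (p h) <= D.
  move=> Hh; rewrite ler_pdivlMr//.
  have lin u : cabs (p u) <= cabs (p h) + M * `|u - h|.
    rewrite -[p u](subrK (p h)) addrC; apply: le_trans (ler_cabsD _ _) _.
    by rewrite lerD2l prim_lip.
  have [k1 [_ [c1 _]]] := conv_lip_ci bb tp prim_cmf lin (cabs_ge0 _) M0.
  have one u : cabs (1 : C) <= 1 + 0 * `|u - h| by rewrite cabs1 mul0r addr0.
  have [k2 [_ [c2 _]]] := conv_lip_ci bb tp (cmf_cst R (1 : C)) one ler01 (lexx 0).
  have E : conv p (phib a b) h - p h * RtoC (2 * pi * wmass a b) =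
      I (fun u => (p u - p h) * Fh (phib a b) (u - h)).
    rewrite -(conv1 h) /conv -(IZl _ c2) -(IB c1); last exact: ciZ.
    by apply: eqI => u; ring.
  have B : cabs (conv p (phib a b) h - p h * RtoC (2 * pi * wmass a b)) <= M * k * pi.
    rewrite E -(J_q1 h) -(JZl _ (rint_q1 h)); apply: cabs_I_le.
    - apply: cmfM; last exact: cmf_Fh tp.
      by apply: cmfB; [exact: prim_cmf|exact: cmf_cst].
    - exact/rintZl/rint_q1.
    move=> u; rewrite cabsM; apply: le_trans (ler_pM (cabs_ge0 _) (cabs_ge0 _) (prim_lip _ _) (kF _)) _.
    have -> : M * `|u - h| * (k * q (u - h) ^+ 2) = M * k * (`|u - h| * q (u - h) ^+ 2) by ring.
    by rewrite ler_wpM2l ?q_sqr// mulr_ge0 ?(ltW k0).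
  have -> : cabs (p h) * (2 * pi * wmass a b) = cabs (p h * RtoC (2 * pi * wmass a b)).
    by rewrite cabsM cabs_RtoC ger0_norm// ltW.
  have -> : p h * RtoC (2 * pi * wmass a b) = conv p (phib a b) h -
     (conv p (phib a b) h - p h * RtoC (2 * pi * wmass a b)) by ring.
  by apply: le_trans (ler_cabsB _ _) _; exact: lerD (HH _ Hh) B.
exists (D + M * `|H - u0|) => u; have [h|h] := leP H u.
  by apply: le_trans (big _ h) _; rewrite lerDl mulr_ge0.
have [h'|h'] := leP u u0; first by rewrite prim0// cabs0 addr_ge0// mulr_ge0.
rewrite -[p u]subr0 -(prim0 (lexx u0)); apply: le_trans (prim_lip _ _) _.
apply: ler_wpDl => //; rewrite ler_wpM2l// !ger0_norm ?subr_ge0 ?(ltW h')//; last exact: ltW (lt_trans h' h).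
by rewrite lerD2r ltW.
Qed.

Lemma prim_limsup (e : R) : 0 < e -> exists H, forall h, H <= h -> cabs (p h) <= 2 * M / a + e.
Proof.
move=> e0; have [K pK] := prim_bounded.
(* The tolerance carries the mass as a factor, so that it becomes [e] once the main term is divided
   by that mass. *)
have [H HH] := (goodP _ _).1 gp (2 * pi * wmass a b * e) (mulr_gt0 m0 e0).
exists H => h /HH g.
have mrs : cmf (fun v : R => r (h + v) - r (h - v)).
  apply: cmfB; apply: (cmf_comp mr); first exact: measurable_funD.
  exact: measurable_funB.
have rb v : cabs (r (h + v) - r (h - v)) <= 2 * M.
  by rewrite mulr_natl mulr2n; apply: le_trans (ler_cabsB _ _) _; exact: lerD.
have B := phib_estimate a0 ab prim_cmf pK mrs rb (@prim_sym h).
rewrite -(ler_pM2l m0).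
have -> : 2 * pi * wmass a b * cabs (p h) = cabs (RtoC (2 * pi * wmass a b) * p h).
  by rewrite cabsM cabs_RtoC ger0_norm// ltW.
have -> : RtoC (2 * pi * wmass a b) * p h = conv p (phib a b) h -
     (conv p (phib a b) h - RtoC (2 * pi * wmass a b) * p h) by ring.
apply: le_trans (ler_cabsB _ _) _; rewrite [leRHS]mulrDr [leRHS]addrC; exact: lerD.
Qed.

End LipschitzPrimitive.

(** * Derivative of the transform, and convolution with one piece *)

Section Estimates.
Variable R : realType.
Local Notation C := R[i].

Lemma Re_RtoCM (x : R) (z : C) : complex.Re (RtoC x * z) = x * complex.Re z.
Proof. by rewrite ReM /= mul0r subr0. Qed.

Lemma Im_RtoCM (x : R) (z : C) : complex.Im (RtoC x * z) = x * complex.Im z.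
Proof. by rewrite ImM /= mul0r addr0. Qed.

Lemma is_derive_quad (f : R -> R) (x L c : R) :
  (forall e, `|f (e + x) - f x - e * L| <= c * e ^+ 2) -> is_derive x (1 : R) f L.
Proof.
move=> H.
have lim : (fun h : R => h^-1 *: ((f \o shift x) (h *: 1) - f x)) @ 0^' --> L.
  apply/cvgrPdist_le => e e0; near=> h.
  have hn0 : h != 0 by near: h; exact: nbhs_dnbhs_neq.
  rewrite /= /GRing.scale /= mulr1 -normrN.
  have -> : - (L - h^-1 * (f (h + x) - f x)) = h^-1 * (f (h + x) - f x - h * L) by field.
  rewrite normrM normfV ler_pdivrMl ?normr_gt0//; apply: le_trans (H h) _.
  rewrite -real_normK ?num_real// expr2 mulrA mulrC ler_wpM2l//.
  apply: (@le_trans _ _ ((`|c| + 1) * `|h|)).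
    by rewrite ler_wpM2r// (le_trans (ler_norm _))// lerDl.
  rewrite -ler_pdivlMl; last by rewrite ltr_wpDl.
  near: h; apply: dnbhs0_le; rewrite mulr_gt0// invr_gt0 ltr_wpDl//.
apply: DeriveDef; first by apply/cvg_ex; exists L.
exact: cvg_lim.
Unshelve. all: by end_near. Qed.

(** The left side is the integral from 0 to y of i (e^{it} - 1), whose modulus is at most |t|. This
    second order estimate is what permits differentiation under the Fourier integral. *)
Lemma cexpi_quad (y : R) : cabs (cexpi y - 1 - Complex 0 y) <= y ^+ 2.
Proof.
have key (a b c : R) : a <= b -> `|a| <= c -> `|b| <= c ->
    cabs (cexpi b - cexpi a - Complex 0 (b - a)) <= c * (b - a).
  move=> ab ac bc; have c0 : 0 <= c by apply: le_trans ac.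
  have cE : ccont (fun t => Complex 0 1 * (cexpi t - 1) : C).
    apply: ccontM; first exact: ccont_cst.
    by apply: ccontD; [apply: ccont_cexpi => ?; exact: cvg_id|exact: ccont_cst].
  have dE : cderive (fun t : R => cexpi t - Complex 0 t) (fun t => Complex 0 1 * (cexpi t - 1)).
    move=> t; split; rewrite ?ReM ?ImM ?ReD ?ImD ?ReN ?ImN /=.
      have -> : (fun y : R => complex.Re (cexpi y - Complex 0 y)) = (fun y => cos y - 0).
        by apply/funext => z; rewrite ReD ReN.
      by apply: der_eq (dB (is_derive_cos t) (d_cst 0 t)) _; ring.
    have -> : (fun y : R => complex.Im (cexpi y - Complex 0 y)) = (fun y => sin y - y).
      by apply/funext => z; rewrite ImD ImN.
    by apply: der_eq (dB (is_derive_sin t) (d_id t)) _; ring.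
  have -> : cexpi b - cexpi a - Complex 0 (b - a) = (cexpi b - Complex 0 b) - (cexpi a - Complex 0 a).
    by apply: eqC; rewrite !(ReD, ImD, ReN, ImN) /=; ring.
  rewrite -(I_ftc ab cE dE).
  have ccst : continuous (fun _ : R => c) by move=> ?; exact: cvg_cst.
  have dt t : is_derive t (1 : R) (fun t => c * t) c.
    by apply: der_eq (dZ c (d_id t)) _; rewrite mulr1.
  have <- : J (fun t => rind (a <= t <= b) * c) = c * (b - a).
    by rewrite (J_ftc ab ccst dt) mulrBr.
  apply: cabs_I_le; [exact: (ci_itv a b cE).1|exact: (rint_itv _ _ ccst)|move=> t].
  rewrite cabsM indE rindE; case: ifPn => [/andP[h1 h2]|_]; last by rewrite cabs0 !mul0r.
  rewrite cabs1 !mul1r cabsM (_ : cabs (Complex 0 1) = 1); last by rewrite /cabs /= expr0n expr1n add0r sqrtr1.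
  rewrite mul1r -cexpi0; apply: le_trans (cexpi_lip _ _) _; rewrite subr0 ler_norml.
  by move: ac bc; rewrite !ler_norml => /andP[? ?] /andP[? ?]; apply/andP; split; lra.
have [y0|y0] := leP 0 y.
  have := key 0 y y y0; rewrite normr0 ger0_norm// cexpi0 subr0 => /(_ y0 (lexx _)).
  by rewrite expr2.
have := key y 0 (- y) (ltW y0); rewrite normr0 ltr0_norm// cexpi0 sub0r => /(_ (lexx _)).
rewrite oppr_ge0 => /(_ (ltW y0)).
have -> : - y * - y = y ^+ 2 by ring.
rewrite -cabsN; congr (cabs _ <= _); apply: eqC; rewrite !(ReD, ImD, ReN, ImN) /=; ring.
Qed.

Lemma Fh_cderive (a b : R) phi : tst a b phi ->
  cderive (Fh phi) (fun x => Complex 0 (-1) * Fh (fun t => phi t * t) x).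
Proof.
move=> tp; have t1 : tst a b (fun t => phi t * t) by apply: tstM tp _; exact: smooth_id.
have t2 : tst a b (fun t => phi t * t * t) by apply: tstM t1 _; exact: smooth_id.
have H x e : cabs (Fh phi (e + x) - Fh phi x - RtoC e * (Complex 0 (-1) * Fh (fun t => phi t * t) x))
    <= J (fun t => `|phi t * t * t|) * e ^+ 2.
  have c1 := Fh_ci (e + x) tp; have c2 := Fh_ci x tp; have c3 := Fh_ci x t1.
  rewrite mulrA -(IZl (RtoC e * Complex 0 (-1)) c3) -(IB c1 c2) -(IB (ciB c1 c2)); last exact: ciZ.
  have r2 := rint_norm (tst_rint t2).
  rewrite [leRHS]mulrC -(JZl _ r2); apply: cabs_I_le.
  - exact: (ciB (ciB c1 c2) (ciZ _ c3)).1.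
  - exact: rintZl.
  move=> t; set X := (X in cabs X).
  have -> : X = cexpi (- (x * t)) * RtoC (phi t) * (cexpi (- (e * t)) - 1 - Complex 0 (- (e * t))).
    rewrite /X (_ : - ((e + x) * t) = - (x * t) + - (e * t)) ?cexpiD; last by ring.
    rewrite RtoCM (_ : Complex 0 (- (e * t)) = RtoC e * Complex 0 (-1) * RtoC t); first by ring.
    by apply: eqC; rewrite !(ReM, ImM) /=; ring.
  rewrite !cabsM cabs_cexpi mul1r cabs_RtoC.
  apply: le_trans (ler_wpM2l (normr_ge0 _) (cexpi_quad _)) _.
  rewrite !normrM -[(- (e * t)) ^+ 2]real_normK ?num_real// normrN normrM -[e ^+ 2]real_normK ?num_real//.
  by rewrite le_eqVlt; apply/orP; left; apply/eqP; ring.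
move=> x; split; apply: (@is_derive_quad _ _ _ (J (fun t => `|phi t * t * t|))) => e.
  apply: le_trans (H x e); apply: le_trans (Re_le_cabs _); rewrite !(ReD, ReN).
  by rewrite Re_RtoCM.
apply: le_trans (H x e); apply: le_trans (Im_le_cabs _); rewrite !(ImD, ImN).
by rewrite Im_RtoCM.
Qed.

Lemma q_shift (x h : R) : q (x - h) <= 2 * (1 + h ^+ 2) * q x.
Proof.
rewrite /q ler_pdivlMr ?ltr_pwDl ?sqr_ge0// mulrC ler_pdivrMr ?ltr_pwDl ?sqr_ge0//.
have := sqr_ge0 (x - h - h); have := sqr_ge0 (h * (x - h)); nra.
Qed.

Section Piece.
Variables (p : R -> C) (K u0 : R).
Hypotheses (mp : cmf p) (pK : forall u, cabs (p u) <= K) (p0 : forall u, u < u0 -> p u = 0).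

(** The oscillating integrals of p; a bound uniform in x is the form in which the hypothesis at
    points of E will be used. *)
Definition osc (t x : R) : C := I (fun u => ind (u < x) * (p u * cexpi (- (t * u)))).

Let K0 : 0 <= K. Proof. by apply: le_trans (pK 0); exact: cabs_ge0. Qed.

(* Integrating p(u) e^{-i t0 u} by parts against the slowly varying factor
   e^{i t0 u} phi^(u-h), whose derivative is the transform of (t - t0) phi. *)
Lemma conv_piece (a b t0 N : R) phi h : a <= b -> tst a b phi ->
  (forall x, cabs (osc t0 x) <= N) ->
  cabs (conv p phi h) <= N * J (fun u => cabs (Fh (fun t => phi t * (t - t0)) (u - h))).
Proof.
move=> ab tp oN.
have N0 : 0 <= N by apply: le_trans (oN 0); exact: cabs_ge0.
have t1 : tst a b (fun t => phi t * t) by apply: tstM tp _; exact: smooth_id.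
have t2 : tst a b (fun t => phi t * (t - t0)).
  by apply: tstM tp _; apply: smoothB; [exact: smooth_id|exact: smooth_cst].
have [k [k0 kF]] := Fh_decay ab t2.
have [k' [k0' kF']] := Fh_decay ab tp.
pose w u := p u * cexpi (- (t0 * u)).
pose m u := cexpi (t0 * u) * Fh phi (u - h).
pose g u := Complex 0 (-1) * (cexpi (t0 * u) * Fh (fun t => phi t * (t - t0)) (u - h)) : C.
have mw : cmf w by apply: cmfM mp _; exact: cmf_osc.
have dm : cderive m g.
  have e1 : cderive (fun u => cexpi (t0 * u)) (fun u => Complex 0 t0 * cexpi (t0 * u)).
    by apply: cderive_cexpi => t; apply: der_eq (dZ t0 (d_id t)) _; rewrite mulr1.
  have e2 : cderive (fun u => Fh phi (u - h)) (fun u => Complex 0 (-1) * Fh (fun t => phi t * t) (u - h)).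
    move=> u; have [d1 d2] := Fh_cderive tp (u - h).
    have ds := dB (d_id u) (d_cst h u).
    split; [have := @d_comp _ _ (fun u => u - h) _ _ _ d1 ds|have := @d_comp _ _ (fun u => u - h) _ _ _ d2 ds];
    by move=> d; apply: der_eq d _; rewrite subr0 mulr1.
  have := cderiveM e1 e2; congr cderive; apply/funext => u; rewrite /g.
  have -> : Fh (fun t => phi t * (t - t0)) (u - h) = Fh (fun t => phi t * t) (u - h) - RtoC t0 * Fh phi (u - h).
    have -> : (fun t => phi t * (t - t0)) = (fun t => phi t * t + (- t0) * phi t) by apply/funext => t; ring.
    rewrite (FhD _ t1); last exact: tstZ.
    by rewrite (FhZ _ _ tp) RtoCN mulNr.
  have -> : Complex 0 t0 = - (Complex 0 (-1) * RtoC t0) by apply: eqC; rewrite !(ReM, ImM, ReN, ImN) /=; ring.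
  ring.
have cg : ccont g.
  apply: ccontM; first exact: ccont_cst.
  apply: ccontM; first by apply: ccont_cexpi; exact: continuous_scale.
  have [cr ci] := Fh_ccont t2.
  have cs : continuous (fun u : R => u - h) by move=> u; apply: cvgB; [exact: cvg_id|exact: cvg_cst].
  split => u.
    by apply: (@continuous_comp _ _ _ (fun u : R => u - h) (fun y => complex.Re (Fh (fun t => phi t * (t - t0)) y))); [exact: cs|exact: cr].
  by apply: (@continuous_comp _ _ _ (fun u : R => u - h) (fun y => complex.Im (Fh (fun t => phi t * (t - t0)) y))); [exact: cs|exact: ci].
have gE u : cabs (g u) = cabs (Fh (fun t => phi t * (t - t0)) (u - h)).
  rewrite /g !cabsM cabs_cexpi mul1r (_ : cabs (Complex 0 (-1)) = 1) ?mul1r//.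
  by rewrite /cabs /= expr0n sqrrN expr1n add0r sqrtr1.
have gq u : cabs (g u) <= k * q (u - h) by rewrite gE; apply: le_trans (kF _) _; rewrite ler_wpM2l ?q_sqr_le// ltW.
have rq := rintZl k (rint_q1 h).
have tail v : I (fun u => ind (v < u) * g u) = - m v.
  have := @I_ftc_oo _ g m v (fun u => k * q (u - h)) cg dm rq (fun u _ => gq u).
  case=> [u||_ -> //]; first by rewrite mulr_ge0 ?(ltW k0) ?(ltW (q_gt0 _)).
  apply: (squeeze_cvgr _ (cvg_cst 0) (h := fun n : nat => k' * q ((v - h) + n%:R))).
    near=> n; rewrite cabs_ge0 /m cabsM cabs_cexpi mul1r.
    have -> : v + n%:R - h = v - h + n%:R by ring.
    by apply: le_trans (kF' _) _; rewrite ler_wpM2l ?q_sqr_le// ltW.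
  rewrite -[X in _ --> X](mulr0 k'); apply: cvgM; first exact: cvg_cst.
  apply/cvgrPdist_le => e e0; near=> n.
  rewrite sub0r normrN ger0_norm ?(ltW (q_gt0 _))// /q.
  rewrite -[leRHS]invrK lef_pV2 ?posrE ?invr_gt0 ?ltr_pwDl ?sqr_ge0//.
  have h1 : 1 <= v - h + n%:R.
    rewrite -lerBlDl; near: n; exact: nbhs_infty_ger.
  have h2 : e^-1 <= v - h + n%:R.
    rewrite -lerBlDl; near: n; exact: nbhs_infty_ger.
  apply: le_trans h2 _; nra.
have E : conv p phi h = - I (fun u => g u * osc t0 u).
  have mg := ccont_cmf cg.
  (* The Fubini majorant needs one factor of decay in v. As p vanishes left of u0, only u0 <= v < u
     counts, where q(u) <= (1 + u0^2) q(v); one of the two factors q(u - h) is therefore moved from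
     u to v, after [q_shift] has removed h. *)
  pose c1 := K * (1 + u0 ^+ 2) * k * (2 * (1 + h ^+ 2)) ^+ 2.
  have rq0 : rint (@q R) by have := @rint_q1 R 0; under eq_fun do rewrite subr0.
  have -> : I (fun u => g u * osc t0 u) = I (fun v => w v * I (fun u => ind (v < u) * g u)).
    apply: (I_primitive mw mg (rintZl c1 rq0) rq0) => [u v vu|u v]; last first.
      by rewrite !mulr_ge0 ?(ltW (q_gt0 _)) ?sqr_ge0 ?(ltW k0)// addr_ge0 ?sqr_ge0.
    rewrite /w cabsM cabs_cexpi mulr1.
    have [v0|v0] := ltP v u0.
      rewrite p0// cabs0 mul0r.
      by rewrite !mulr_ge0 ?(ltW (q_gt0 _)) ?sqr_ge0 ?(ltW k0)// addr_ge0 ?sqr_ge0.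
    rewrite gE; apply: le_trans (ler_pM (cabs_ge0 _) (cabs_ge0 _) (pK v) (kF _)) _.
    have q1 := q_shift u h.
    have q2 : q u <= (1 + u0 ^+ 2) * q v.
      rewrite /q ler_pdivlMr ?ltr_pwDl ?sqr_ge0// mulrC ler_pdivrMr ?ltr_pwDl ?sqr_ge0//.
      have [v1|v1] := leP 0 v; first by have := sqr_ge0 u0; nra.
      have : v ^+ 2 <= u0 ^+ 2 by nra.
      have := sqr_ge0 u; have := sqr_ge0 u0; nra.
    have qq : q (u - h) ^+ 2 <= (2 * (1 + h ^+ 2)) ^+ 2 * (q u * q u).
      have -> : (2 * (1 + h ^+ 2)) ^+ 2 * (q u * q u) = (2 * (1 + h ^+ 2) * q u) ^+ 2 by ring.
      apply: lerXn2r q1; rewrite nnegrE ?(ltW (q_gt0 _))//.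
      by apply: mulr_ge0; rewrite ?(ltW (q_gt0 _))// mulr_ge0// addr_ge0 ?sqr_ge0.
    have -> : c1 * q v * q u = K * (k * ((2 * (1 + h ^+ 2)) ^+ 2 * (((1 + u0 ^+ 2) * q v) * q u))) by rewrite /c1; ring.
    apply: ler_wpM2l => //; apply: ler_wpM2l; first exact: ltW.
    apply: le_trans qq _; apply: ler_wpM2l; first exact: sqr_ge0.
    by apply: ler_wpM2r => //; exact: ltW (q_gt0 _).
  have cc : ci (fun u => p u * Fh phi (u - h)) by exact: conv_ci ab tp mp pK.
  rewrite -IN; last first.
    have := ciN cc; congr ci; apply/funext => u; rewrite tail /w /m.
    have : cexpi (- (t0 * u)) * cexpi (t0 * u) = 1 :> C by rewrite -cexpiD addNr cexpi0.
    move: (cexpi _) (cexpi _) (p u) (Fh _ _) => x y P F xy.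
    by rewrite -[P in LHS]mulr1 -xy; ring.
  apply: eqI => u; rewrite tail /w /m.
  have : cexpi (- (t0 * u)) * cexpi (t0 * u) = 1 :> C by rewrite -cexpiD addNr cexpi0.
  move: (cexpi _) (cexpi _) (p u) (Fh _ _) => x y P F xy.
  by rewrite -[P in LHS]mulr1 -xy; ring.
have rg : rint (fun u => cabs (Fh (fun t => phi t * (t - t0)) (u - h))).
  apply: (rint_dom _ rq) => [|u]; first by apply: measurable_cabs; exact: cmf_Fh t2.
  by rewrite ger0_norm ?cabs_ge0// -gE.
rewrite E cabsN -(JZl _ rg); apply: cabs_I_le; last 1 first.
- by move=> u; rewrite cabsM gE mulrC; apply: ler_wpM2r; [exact: cabs_ge0|exact: oN].
- apply: cmfM; first exact: ccont_cmf.
  have wK u : cabs (w u) <= K by rewrite /w cabsM cabs_cexpi mulr1.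
  have w0 u : u < u0 -> w u = 0 by move=> uu; rewrite /w p0// mul0r.
  exact: (ccont_cmf (prim_ccont mw wK w0 (fun=> erefl))).
- exact: rintZl.
Unshelve. all: by end_near. Qed.

End Piece.
End Estimates.

(** * Rescaled partitions of unity, and locality of decay *)

Section Partition.
Variable R : realType.
Local Notation C := R[i].

Lemma tst_bounded (a b : R) phi : a <= b -> tst a b phi ->
  exists B, 0 <= B /\ forall t, `|phi t| <= B.
Proof.
move=> ab tp; have td := tst_derive tp; have rd := tst_rint td.
exists (J (fun t => `|derive1 phi t|)); split; first exact: J_ge0.
move=> t; have [h|h] := boolP (a <= t <= b); last by rewrite tp.2// normr0 J_ge0.
have at1 : a - 1 <= t by lra.
have cd := smooth_continuous td.1.
have := J_ftc at1 cd (smooth_is_derive tp.1).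
rewrite (tp.2 (a - 1)) ?subr0; last by apply/negP; lra.
move=> <-; have ri := rint_itv (a - 1) t cd.
rewrite ler_norml; apply/andP; split.
  rewrite -[leLHS]mulN1r -(JZl (-1) (rint_norm rd)); apply: le_J; [exact/rintZl/rint_norm|exact: ri|move=> x].
  rewrite rindE; case: ifP => _; rewrite ?mul1r ?mul0r mulN1r; last by rewrite oppr_le0.
  by rewrite lerNl -normrN ler_norm.
apply: le_J; [exact: ri|exact/rint_norm|move=> x].
by rewrite rindE; case: ifP => _; rewrite ?mul1r ?mul0r// ler_norm.
Qed.

(** A difference of consecutive translates of [step], so that the sum of integer translates
    telescopes. *)
Definition bump (y : R) : R := step (y + 1) - step y.

Lemma bump_tst : tst (-1) 1 bump.
Proof.
split.
  apply: smoothB; last exact: smooth_step.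
  apply: (@smooth_comp R (@step R) (fun y : R => y + 1)); first exact: smooth_step.
  by apply: smoothD; [exact: smooth_id|exact: smooth_cst].
move=> t; rewrite negb_and -!ltNge => /orP[h|h].
  by rewrite /bump !step_le0 ?subrr//; lra.
by rewrite /bump !step_ge1 ?subrr//; lra.
Qed.

Lemma bump_sum (m : nat) (y : R) :
  \sum_(k < m.+1) bump (y - k%:R) = step (y + 1) - step (y - m%:R).
Proof.
elim: m => [|m IH]; first by rewrite big_ord1 /bump subr0.
rewrite big_ord_recr /= IH /bump.
have -> : (m.+1%:R : R) = m%:R + 1 by rewrite -addn1 natrD.
have -> : y - (m%:R + 1) + 1 = y - m%:R by ring.
by ring.
Qed.

Lemma smooth_affine (d c : R) : smooth (fun t : R => (t - c) / d).
Proof.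
apply: smoothM; last exact: smooth_cst.
by apply: smoothB; [exact: smooth_id|exact: smooth_cst].
Qed.

Lemma scaled_tst (a b d c : R) phi xi : 0 < d -> tst a b phi -> tst (-1) 1 xi ->
  tst a b (fun t => phi t * xi ((t - c) / d)) /\
  tst (c - d) (c + d) (fun t => phi t * xi ((t - c) / d)).
Proof.
move=> d0 tp tx.
have sx : smooth (fun t : R => xi ((t - c) / d)).
  by apply: (@smooth_comp R xi) tx.1 _; exact: smooth_affine.
split; first exact: tstM.
split; first exact: smoothM tp.1 sx.
move=> t ht; rewrite tx.2 ?mulr0//; apply: contra ht.
by rewrite ler_pdivlMr// ler_pdivrMr// => /andP[h1 h2]; apply/andP; split; lra.
Qed.

(** The factor d^2 clears every negative power of d that the chain rule produces, so for d <= 1 the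
    right side is bounded independently of d. *)
Lemma derive2_scaled (a b d c : R) phi xi : 0 < d -> tst a b phi -> tst (-1) 1 xi -> forall t,
  d ^+ 2 * derive1 (derive1 (fun t => phi t * xi ((t - c) / d))) t =
  d ^+ 2 * derive1 (derive1 phi) t * xi ((t - c) / d) +
    2 * d * derive1 phi t * derive1 xi ((t - c) / d) + phi t * derive1 (derive1 xi) ((t - c) / d).
Proof.
move=> d0 tp tx y; have dn : d != 0 by rewrite gt_eqF.
have da t : is_derive t (1 : R) (fun t => (t - c) / d) d^-1.
  by apply: der_eq (dM (dB (d_id t) (d_cst c t)) (d_cst d^-1 t)) _; ring.
have dx t := @d_comp _ xi (fun t => (t - c) / d) _ _ _ (smooth_is_derive tx.1 ((t - c) / d)) (da t).
have dx1 t := @d_comp _ (derive1 xi) (fun t => (t - c) / d) _ _ _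
  (smooth_is_derive (smooth_derive1 tx.1) ((t - c) / d)) (da t).
have dp := smooth_is_derive tp.1; have dp1 := smooth_is_derive (smooth_derive1 tp.1).
rewrite (derive1_is_derive (fun t => dM (dp t) (dx t))).
rewrite (derive1_is_derive (fun t => dD (dM (dp t) (dM (dx1 t) (d_cst d^-1 t))) (dM (dx t) (dp1 t)))).
by move: (derive1 _ _) (derive1 _ _) (derive1 _ _) (derive1 _ _) (phi y) (xi _) => *; field.
Qed.

(** Scale invariance of the L1 norm of a transform. In [Fh_decay1] at scale d, the damped function
    is bounded by a constant on a support of length 2d, so its L1 norm is O(d), and the majorant
    [q (d * (u - h))] has integral pi / d. The powers of d cancel. *)
Lemma scaled_norm (a b : R) phi xi : a <= b -> tst a b phi -> tst (-1) 1 xi ->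
  exists B, 0 <= B /\ forall d c h, 0 < d <= 1 ->
   rint (fun u => cabs (Fh (fun t => phi t * xi ((t - c) / d)) (u - h))) /\
   J (fun u => cabs (Fh (fun t => phi t * xi ((t - c) / d)) (u - h))) <= B.
Proof.
move=> ab tp tx.
have [p0 [p00 hp0]] := tst_bounded ab tp.
have [p1 [p10 hp1]] := tst_bounded ab (tst_derive tp).
have [p2 [p20 hp2]] := tst_bounded ab (tst_derive (tst_derive tp)).
have n1 : (-1 : R) <= 1 by lra.
have [x0 [x00 hx0]] := tst_bounded n1 tx.
have [x1 [x10 hx1]] := tst_bounded n1 (tst_derive tx).
have [x2 [x20 hx2]] := tst_bounded n1 (tst_derive (tst_derive tx)).
pose B0 := p0 * x0 + (p2 * x0 + 2 * p1 * x1 + p0 * x2).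
have B00 : 0 <= B0 by rewrite !addr_ge0// !mulr_ge0.
exists (2 * B0 * pi); split; first by rewrite !mulr_ge0 ?pi_ge0.
move=> d c h /andP[d0 d1].
have [ta tc] := scaled_tst c d0 tp tx.
have tc2 := tst_derive (tst_derive tc).
set g := fun t => phi t * xi ((t - c) / d) in ta tc tc2 *.
have cc : c - d <= c + d by lra.
have dn : d != 0 by rewrite gt_eqF.
pose G := J (fun t => `|g t - d ^+ 2 * derive1 (derive1 g) t|).
have GB : G <= 2 * d * B0.
  have ccst : continuous (fun _ : R => B0) by move=> ?; exact: cvg_cst.
  have dt t : is_derive t (1 : R) (fun t => B0 * t) B0.
    by apply: der_eq (dZ B0 (d_id t)) _; rewrite mulr1.
  have -> : 2 * d * B0 = J (fun t => rind (c - d <= t <= c + d) * B0).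
    by rewrite (J_ftc cc ccst dt); ring.
  have tg : tst (c - d) (c + d) (fun t => g t - d ^+ 2 * derive1 (derive1 g) t).
    under eq_fun do rewrite -mulNr; apply: tstD tc _; apply: tstZ.
    exact: tc2.
  apply: le_J; [exact/rint_norm/(tst_rint tg)|exact: rint_itv ccst|move=> t].
  rewrite rindE; case: ifPn => ht; last by rewrite tg.2// normr0 mul0r.
  rewrite /g (derive2_scaled c d0 tp tx) mul1r.
  have d2 : d ^+ 2 <= 1 by rewrite expr_le1// ltW.
  apply: le_trans (ler_normB _ _) _; apply: lerD.
    by rewrite normrM ler_pM.
  apply: le_trans (ler_normD _ _) _; apply: lerD; last by rewrite normrM ler_pM.
  apply: le_trans (ler_normD _ _) _; apply: lerD.
    rewrite normrM (normrM (d ^+ 2)) (ger0_norm (sqr_ge0 d)); apply: ler_pM; [|exact: normr_ge0| |exact: hx0].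
      by apply: mulr_ge0; [exact: sqr_ge0|exact: normr_ge0].
    by rewrite -[leRHS]mul1r; apply: ler_pM; [exact: sqr_ge0|exact: normr_ge0|exact: d2|exact: hp2].
  rewrite !normrM (ger0_norm (ltW d0)) ger0_norm//; apply: ler_pM => //; first by rewrite !mulr_ge0// ltW.
  by apply: ler_pM => //; rewrite ?mulr_ge0 ?(ltW d0)// ler_piMr.
have bd u : cabs (Fh g (u - h)) <= G * q (d * (u - h)) by exact: Fh_decay1 ab ta.
have rq := rint_q h d0.
have rg : rint (fun u => cabs (Fh g (u - h))).
  apply: (rint_dom _ (rintZl G rq)) => [|u]; first by apply: measurable_cabs; exact: cmf_Fh ta.
  by rewrite ger0_norm ?cabs_ge0.
split=> //; apply: (@le_trans _ _ (J (fun u => G * q (d * (u - h))))).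
  by apply: le_J => //; exact: rintZl.
rewrite (JZl _ rq) J_q//; apply: (@le_trans _ _ (2 * d * B0 * (pi / d))).
  by rewrite ler_wpM2r// divr_ge0 ?pi_ge0// ltW.
by rewrite le_eqVlt; apply/orP; left; apply/eqP; field.
Qed.

Section Good.
Variables (p : R -> C) (K u0 : R).
Hypotheses (mp : cmf p) (pK : forall u, cabs (p u) <= K) (p0 : forall u, u < u0 -> p u = 0).

Lemma goodD (a b : R) phi psi : a <= b -> tst a b phi -> tst a b psi ->
  good p phi -> good p psi -> good p (fun t => phi t + psi t).
Proof.
move=> ab t1 t2 /goodP g1 /goodP g2; apply/goodP => e e0.
have e2 : 0 < e / 2 by rewrite divr_gt0.
have [H1 h1] := g1 _ e2; have [H2 h2] := g2 _ e2.
exists (Num.max H1 H2) => h; rewrite ge_max => /andP[l1 l2].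
have -> : conv p (fun t => phi t + psi t) h = conv p phi h + conv p psi h.
  rewrite /conv -ID; [|exact: (conv_ci h ab t1 mp pK)|exact: (conv_ci h ab t2 mp pK)].
  by apply: eqI => u; rewrite (FhD _ t1 t2) mulrDr.
apply: le_trans (ler_cabsD _ _) _; rewrite [e]splitr.
by apply: lerD; [exact: h1|exact: h2].
Qed.

Lemma conv_sum (a b : R) (m : nat) (f : nat -> R -> R) h : a <= b -> (forall k, tst a b (f k)) ->
  conv p (fun t => \sum_(k < m) f k t) h = \sum_(k < m) conv p (f k) h.
Proof.
move=> ab tf.
have ts n : tst a b (fun t => \sum_(k < n) f k t).
  elim: n => [|n IH].
    by split => [|t _]; [under eq_fun do rewrite big_ord0; exact: smooth_cst|rewrite big_ord0].
  by under eq_fun do rewrite big_ord_recr; exact: tstD.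
elim: m => [|m IH].
  rewrite big_ord0 /conv -[RHS]I0; apply: eqI => u; rewrite -[RHS](mulr0 (p u)); congr (_ * _).
  by rewrite /Fh -[RHS]I0; apply: eqI => t; rewrite big_ord0 RtoC0 mulr0.
rewrite big_ord_recr /= -IH /conv -ID; [|exact: (conv_ci h ab (ts m) mp pK)|exact: (conv_ci h ab (tf m) mp pK)].
apply: eqI => u; rewrite -mulrDr -(FhD _ (ts m) (tf m)); congr (_ * _).
by congr Fh; apply/funext => t; rewrite big_ord_recr.
Qed.

Definition locgood t := exists2 e, 0 < e & forall phi, tst (t - e) (t + e) phi -> good p phi.

(** Continuation of the right endpoint. If all test functions on [c, x] are good for some x close to
    the supremum, a smooth step rising between sup - e and x splits a function supported slightly
    further right into one on [c, x] and one in the good neighbourhood of the supremum. *)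
Lemma locgood_itv (c d : R) phi : c <= d -> (forall t, c <= t <= d -> locgood t) ->
  tst c d phi -> good p phi.
Proof.
move=> cd gt.
pose S := [set x | c <= x <= d /\ forall psi, tst c x psi -> good p psi].
have Sc : S c.
  split; first by rewrite lexx cd.
  move=> psi tpsi; have [|e e0 g] := gt c; first by rewrite lexx cd.
  by apply: g; apply: tstW tpsi; lra.
have supS : has_sup S by split; [exists c|exists d => x [/andP[]]].
have cs : c <= sup S by exact: sup_ubound supS.2 _ Sc.
have sd : sup S <= d by apply: ge_sup; [exists c|move=> x [/andP[]]].
have [|e e0 g] := gt (sup S); first by rewrite cs sd.
have e2 : 0 < e / 2 by rewrite divr_gt0.
have [x [Sx gx] xs] := sup_adherent e2 supS.
have xsup : x <= sup S by apply: sup_ubound supS.2 _ _; split.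
(* Membership of y in [S] contradicts the supremum unless the minimum is d. *)
pose y := Num.min d (sup S + e / 2).
have key psi : tst c y psi -> good p psi.
  move=> tpsi.
  pose th t := step ((t - (sup S - e)) / (x - (sup S - e))).
  have den : 0 < x - (sup S - e) by lra.
  have sth : smooth th by apply: (@smooth_comp R (@step R)); [exact: smooth_step|exact: smooth_affine].
  have yd : y <= d by rewrite ge_min lexx.
  have ys : y <= sup S + e / 2 by rewrite ge_min lexx orbT.
  have t1 : tst c x (fun t => psi t * (1 - th t)).
    have s1 : smooth (fun t => 1 - th t) by apply: smoothB; [exact: smooth_cst|exact: sth].
    split; first exact: smoothM tpsi.1 s1.
    move=> t ht; have [ct|ct] := leP c t; last by rewrite tpsi.2 ?mul0r// leNgt ct.
    have xt : x < t by move: ht; rewrite ct /= -ltNge.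
    rewrite /th step_ge1 ?subrr ?mulr0// ler_pdivlMr// mul1r; lra.
  have t2 : tst (sup S - e) (sup S + e) (fun t => psi t * th t).
    split; first exact: smoothM tpsi.1 sth.
    move=> t ht; have [ct|ct] := leP t (sup S - e).
      by rewrite /th step_le0 ?mulr0// pmulr_lle0 ?invr_gt0//; lra.
    have xt : sup S + e < t by move: ht; rewrite (ltW ct) /= -ltNge.
    by rewrite tpsi.2 ?mul0r//; apply/negP => /andP[_]; lra.
  have E : psi = (fun t => psi t * (1 - th t) + psi t * th t) by apply/funext => t; ring.
  rewrite E; apply: (@goodD (c - e) (d + e)); first by lra.
  - by apply: tstW t1; lra.
  - by apply: tstW t2; lra.
  - exact: gx.
  - exact: g.
have Sy : S y.
  split=> //; rewrite le_min cd /= ge_min lexx /= andbT; lra.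
have yS := sup_ubound supS.2 Sy.
suff <- : y = d by exact: key.
move: yS; rewrite /y; case: (leP d (sup S + e / 2)) => [//|h1 h2]; exfalso; lra.
Qed.

End Good.
End Partition.

(** * Crossing the exceptional set: covering, category and assembly of the pieces *)

Section Extension.
Variable R : realType.
Local Notation C := R[i].
Local Notation mu := (@lebesgue_measure R).

(** The half-open cells starting at bad grid points are disjoint and lie in the open neighbourhood
    of E of radius three cells. These neighbourhoods decrease to E, which is closed, so their
    measures tend to 0, and the bound is uniform in the choice of bad points. There are n + 2 grid
    points for n + 1 cells, both ends included. *)
Lemma null_cover (E : set R) (a b e : R) : closed E -> E `<=` `[a, b]%classic -> mu E = 0%E -> a < b -> 0 < e ->
  \forall n \near \oo, forall bad : nat -> bool,
   (forall k, bad k -> exists2 s, E s & `|s - (a + k%:R * ((b - a) / n.+1%:R))| <= (b - a) / n.+1%:R) ->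
   \sum_(k < n.+2) (bad k)%:R * ((b - a) / n.+1%:R) <= e.
Proof.
move=> cE Eab E0 ab e0.
pose d n : R := (b - a) / n.+1%:R.
have d0 n : 0 < d n by rewrite divr_gt0 ?subr_gt0.
have dle n m : (n <= m)%N -> d m <= d n.
  by move=> nm; rewrite ler_wpM2l ?subr_ge0 ?(ltW ab)// lef_pV2 ?posrE// ler_nat ltnS.
pose F n := [set t : R | exists2 s, E s & `|s - t| < 3 * d n].
have oF n : open (F n).
  have -> : F n = \bigcup_(s in E) ball s (3 * d n).
    by apply/seteqP; split => t [s Es h]; exists s.
  by apply: bigcup_open => s _; apply: ball_open; rewrite mulr_gt0.
have mF n : measurable (F n) by exact: open_measurable.
have mI : measurable (\bigcap_n F n) by exact: bigcapT_measurable.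
(* Continuity from above needs finite measure at the start, which the boundedness of E provides. *)
have F0 : (mu (F 0%N) < +oo)%E.
  apply: (@le_lt_trans _ _ (mu (`[a - 4 * d 0%N, b + 4 * d 0%N]%classic))).
    apply: (@le_measure _ _ _ mu); [exact: mem_set (mF 0%N)|by apply: mem_set; exact: measurable_itv|].
    move=> t [s /Eab]; rewrite /= !in_itv /= ltr_distl => /andP[h1 h2] /andP[h3 h4].
    have := d0 0%N; lra.
  by rewrite lebesgue_measure_itv /=; case: ifP => _; rewrite ?ltry// -EFinB ltry.
have IE : \bigcap_n F n `<=` E.
  move=> t Ft; apply: contrapT => nE.
  have oE : open (~` E) by rewrite openC.
  have /nbhs_ballP[r /= r0 rE] := open_nbhs_nbhs (conj oE nE).
  have [n hn] : exists n, 3 * d n < r.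
    exists (Num.truncn (3 * (b - a) / r)); rewrite /d mulrA ltr_pdivrMr// [ltRHS]mulrC -ltr_pdivrMr//.
    exact: truncnS_gt.
  have [s Es h] := Ft n Logic.I; apply: (rE s) => //.
  by rewrite /ball /= distrC (lt_trans h).
have Fdec : {homo F : n m / (n <= m)%N >-> (m <= n)%O}.
  move=> n m nm; apply/subsetPset => t [s Es h]; exists s => //.
  by apply: lt_le_trans h _; rewrite ler_wpM2l// dle.
have cv : (mu \o F) n @[n --> \oo] --> mu (\bigcap_n F n) by exact: nonincreasing_cvg_mu.
have FI0 : mu (\bigcap_n F n) = 0%E.
  apply/eqP; rewrite -measure_le0 -E0; apply: le_measure; rewrite ?inE//.
  exact: closed_measurable.
rewrite FI0 in cv; have [cf /cvgrPdist_le cv0] := (fine_cvgP _ _).1 cv.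
near=> n => bad hbad; change (\sum_(k < n.+2) (bad k)%:R * d n <= e).
pose G k := if bad k then `[a + k%:R * d n, a + k%:R * d n + d n[%classic else set0.
have mG k : measurable (G k) by rewrite /G; case: ifP.
have tG : trivIset setT G.
  have ord i j t : (i < j)%N -> G i t -> G j t -> False.
    rewrite /G => ij; case: ifP => // _; case: ifP => // _.
    rewrite /= !in_itv /= => /andP[h1 h2] /andP[h3 h4].
    have h5 : (i.+1%:R : R) * d n <= j%:R * d n by apply: ler_wpM2r; [exact: ltW|rewrite ler_nat].
    have h6 : (a + j%:R * d n : R) < a + i%:R * d n + d n by exact: le_lt_trans h3 h2.
    by move: h6; rewrite -addrA ltrD2l ltNge -[X in _ + X]mul1r -mulrDl natr1 h5.
  apply/trivIsetP => i j _ _ ij; apply/seteqP; split => // t [Gi Gj].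
  by move: ij; rewrite neq_ltn => /orP[h|h]; [exact: ord h Gi Gj|exact: ord h Gj Gi].
have muG k : mu (G k) = ((bad k)%:R * d n)%:E.
  rewrite /G; case: ifP => _; last by rewrite measure0 mul0r.
  rewrite lebesgue_measure_itv /= lte_fin ltrDl d0 -EFinD mul1r; congr EFin; ring.
have GF : \big[setU/set0]_(k < n.+2) G k `<=` F n.
  apply: (big_ind (fun A => A `<=` F n)) => [|A B' hA hB t [/hA|/hB]|k _ t] //; rewrite /G; case: ifP => // /hbad[s Es hs].
  rewrite /= in_itv /= => /andP[h1 h2]; exists s => //.
  move: hs; rewrite -/(d n) ler_norml ltr_norml => /andP[h3 h4]; have := d0 n => h5.
  by apply/andP; split; lra.
have sG : (mu (\big[setU/set0]_(k < n.+2) G k) <= mu (F n))%E.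
  apply: (@le_measure _ _ _ mu); [apply: mem_set|exact: mem_set (mF n)|exact: GF].
  by apply: bigsetU_measurable => k _; exact: mG.
rewrite measure_bigsetU// in sG; move: sG.
rewrite (eq_bigr (fun k : 'I_n.+2 => ((bad k)%:R * d n)%:E)) => [|k _]; last exact: muG.
rewrite sumEFin => sG; rewrite -lee_fin; apply: le_trans sG _.
have fF : (mu \o F) n \is a fin_num by near: n.
have -> : mu (F n) = (fine ((mu \o F) n))%:E by rewrite fineK.
rewrite lee_fin.
have : `|0 - (fine \o (mu \o F)) n| <= e by near: n; exact: cv0.
by rewrite sub0r normrN; apply: le_trans; exact: ler_norm.
Unshelve. all: by end_near. Qed.

(* A Baire category argument, run by hand on nested intervals. *)
Lemma uniform_portion (E B : set R) (f : R -> R -> R) (lo hi t0 : R) :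
  closed E -> B `<=` E -> B `<=` `]lo, hi[%classic ->
  (forall t, E t -> lo < t < hi -> exists N, forall x, f t x <= N) ->
  (forall x N t, N < f t x -> exists2 r, 0 < r & forall s, `|s - t| <= r -> N < f s x) ->
  B t0 -> exists t r N, [/\ B t, 0 < r & forall s, B s -> `|s - t| <= r -> forall x, f s x <= N].
Proof.
move=> cE BE Bi fE fc Bt0; apply: contrapT => H.
(* One step of the nesting. If no portion has a common bound, half the current interval contains a
   point of B at which some f(., x) exceeds n, and this persists on a closed interval inside the
   current one, of radius at most 1/(n + 1). *)
have step (y : nat * (R * R)) : exists z : R * R, B y.2.1 -> 0 < y.2.2 ->
  [/\ B z.1, 0 < z.2, `|z.1 - y.2.1| + z.2 <= y.2.2, z.2 <= y.1.+1%:R^-1 &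
    exists x, forall s, `|s - z.1| <= z.2 -> y.1%:R < f s x].
  case: y => n [t r] /=; have [[Bt r0]|nt] := pselect (B t /\ 0 < r); last first.
    by exists (0, 0) => Bt r0; exfalso; exact: nt.
  have [t' [Bt' tt [x fx]]] : exists t', [/\ B t', `|t' - t| <= r / 2 & exists x, n%:R < f t' x].
    apply: contrapT => nH; apply: H; exists t, (r / 2), n%:R; split; [exact: Bt|by rewrite divr_gt0|].
    move=> s Bs st x; rewrite leNgt; apply/negP => fx; apply: nH.
    by exists s; split; [exact: Bs|exact: st|exists x].
  have [r' r'0 r'f] := fc _ _ _ fx.
  exists (t', Num.min (Num.min r' (r / 2)) n.+1%:R^-1) => _ _ /=; split.
  - exact: Bt'.
  - by rewrite !lt_min r'0 divr_gt0//= invr_gt0.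
  - by rewrite [r in leRHS]splitr lerD// !ge_min lexx orbT.
  - by rewrite ge_min lexx orbT.
  - by exists x => s hs; apply: r'f; apply: le_trans hs _; rewrite !ge_min lexx.
have [g gP] := choice step.
have /Bi := Bt0; rewrite /= in_itv /= => /andP[lt0 t0h].
(* Half the distance to the endpoints keeps the limit point strictly between lo and hi. *)
pose r0 := Num.min (t0 - lo) (hi - t0) / 2.
have r00 : 0 < r0 by rewrite divr_gt0// lt_min !subr_gt0 lt0.
pose z n := iteri n (fun k st => g (k, st)) (t0, r0).
have inv n : B (z n).1 /\ 0 < (z n).2.
  elim: n => [|n [h1 h2]] //=; by have [] := gP (n, z n) h1 h2.
have zS n : [/\ `|(z n.+1).1 - (z n).1| + (z n.+1).2 <= (z n).2, (z n.+1).2 <= n.+1%:R^-1 &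
    exists x, forall s, `|s - (z n.+1).1| <= (z n.+1).2 -> n%:R < f s x].
  by have [h1 h2] := inv n; have [] := gP (n, z n) h1 h2.
have nest n k : `|(z (n + k)%N).1 - (z n).1| + (z (n + k)%N).2 <= (z n).2.
  elim: k => [|k IH]; first by rewrite addn0 subrr normr0 add0r.
  rewrite addnS; have [h _ _] := zS (n + k)%N.
  apply: le_trans IH; apply: le_trans (lerD (lexx _) h).
  rewrite addrA lerD2r addrC; apply: le_trans (ler_normD _ _).
  by rewrite le_eqVlt; apply/orP; left; apply/eqP; congr (`| _ |); ring.
have cmp m n : (z m).1 - (z m).2 <= (z n).1 + (z n).2.
  have [h|h] := leqP m n.
    have := nest m (n - m)%N; rewrite subnKC// => hh.
    have [_ zn0] := inv n.
    have : (z m).1 - (z n).1 <= `|(z n).1 - (z m).1| by rewrite distrC ler_norm.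
    lra.
  have := nest n (m - n)%N; rewrite subnKC; last exact: ltnW.
  move=> hh; have [_ zm0] := inv m.
  have : (z m).1 - (z n).1 <= `|(z m).1 - (z n).1| by rewrite ler_norm.
  lra.
pose S := [set (z m).1 - (z m).2 | m in [set: nat]].
have supS : has_sup S.
  split; first by exists ((z 0%N).1 - (z 0%N).2), 0%N.
  by exists ((z 0%N).1 + (z 0%N).2) => _ [m _ <-].
pose T := sup S.
have Tn n : `|T - (z n).1| <= (z n).2.
  rewrite ler_distl; apply/andP; split.
    by apply: sup_ubound supS.2 _ _; exists n.
  by apply: ge_sup; [exact: supS.1|move=> _ [m _ <-]].
(* The limit is not claimed to lie in B; the centres belong to the closed set E, and the pointwise
   bounds are available on all of E. *)
have ET : E T.
  apply: contrapT => nE; have oE : open (~` E) by rewrite openC.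
  have /nbhs_ballP[e /= e0 eE] := open_nbhs_nbhs (conj oE nE).
  pose n := Num.truncn e^-1.
  have ne : n.+1%:R^-1 < e by rewrite -[ltRHS]invrK ltf_pV2 ?posrE ?invr_gt0//; exact: truncnS_gt.
  have [_ h _] := zS n; apply: (eE (z n.+1).1); last by apply: BE; have [] := inv n.+1.
  exact: (le_lt_trans (le_trans (Tn n.+1) h) ne).
have [N fN] : exists N, forall x, f T x <= N.
  apply: fE => //; have := Tn 0%N; rewrite /= ler_norml => /andP[h1 h2].
  have m1 : Num.min (t0 - lo) (hi - t0) <= t0 - lo by rewrite ge_min lexx.
  have m2 : Num.min (t0 - lo) (hi - t0) <= hi - t0 by rewrite ge_min lexx orbT.
  by apply/andP; split; move: h1 h2 r00; rewrite /r0; lra.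
have [_ _ [x hx]] := zS (Num.truncn N).+1; have := hx T (Tn _).
apply/negP; rewrite -leNgt; apply: le_trans (fN x) _; apply: ltW; exact: truncnS_gt.
Qed.

Lemma overlap_le (a b c d : R) : a <= c -> c <= b -> 0 < d ->
  Num.max a (c - d) <= Num.min b (c + d).
Proof. by move=> *; rewrite ge_max !le_min; apply/andP; split; apply/andP; split; lra. Qed.

Lemma overlap_in (a b c d s : R) :
  (Num.max a (c - d) <= s <= Num.min b (c + d)) = (a <= s <= b) && (`|s - c| <= d).
Proof. by rewrite ge_max le_min ler_distl andbACA. Qed.

Variables (p : R -> C) (K u0 : R).
Hypotheses (mp : cmf p) (pK : forall u, cabs (p u) <= K) (p0 : forall u, u < u0 -> p u = 0).

Let K0 : 0 <= K. Proof. by apply: le_trans (pK 0); exact: cabs_ge0. Qed.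

(** For fixed x the integral is Lipschitz in t, with constant [L], because p vanishes left of u0 and
    only [u0, x] contributes. This is the lower semicontinuity that the category argument
    requires. *)
Lemma osc_open x N t : N < cabs (osc p t x) ->
  exists2 r, 0 < r & forall s, `|s - t| <= r -> N < cabs (osc p s x).
Proof.
move=> Nt; pose m := `|u0| + `|x|; pose L := J (fun u => rind (u0 <= u <= x) * (K * m)).
have ccst : continuous (fun _ : R => K * m) by move=> ?; exact: cvg_cst.
have ccK : continuous (fun _ : R => K) by move=> ?; exact: cvg_cst.
have rL := rint_itv u0 x ccst.
have L0 : 0 <= L.
  apply: J_ge0 => u; rewrite rindE; case: ifP => _; rewrite ?mul0r// mul1r mulr_ge0//.
  by rewrite addr_ge0.
have cio s : ci (fun u => ind (u < x) * (p u * cexpi (- (s * u)))).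
  apply: (ci_dom _ (rint_itv u0 x ccK)) => [|u].
    apply: cmfM; first by apply: cmf_ind; exact: measurable_fun_ltr.
    by apply: cmfM mp _; exact: cmf_osc.
  rewrite !cabsM cabs_cexpi mulr1 indE rindE; case: ifPn => ux; last first.
    by rewrite cabs0 mul0r mulr_ge0//; case: (_ && _).
  rewrite cabs1 mul1r; have [uu|uu] := leP u0 u; first by rewrite (ltW ux) mul1r.
  by rewrite p0// cabs0 mul0r.
have lip s : cabs (osc p t x - osc p s x) <= `|s - t| * L.
  rewrite /osc -(IB (cio t) (cio s)) -(JZl _ rL); apply: cabs_I_le.
  - exact: (ciB (cio t) (cio s)).1.
  - exact: rintZl.
  move=> u; rewrite -mulrBr -mulrBr !cabsM indE rindE; case: ifPn => ux; last first.
    rewrite cabs0 mul0r; apply: mulr_ge0 => //; apply: mulr_ge0; first by case: (_ && _).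
    by rewrite mulr_ge0// addr_ge0.
  rewrite cabs1 mul1r; have [uu|uu] := leP u0 u; last by rewrite p0// cabs0 !mul0r mulr0.
  rewrite (ltW ux) mul1r mulrCA; apply: ler_pM; [exact: cabs_ge0|exact: cabs_ge0|exact: pK|].
  apply: le_trans (cexpi_lip _ _) _.
  have -> : - (t * u) - - (s * u) = (s - t) * u by ring.
  rewrite normrM ler_wpM2l// /m.
  have := ler_norm (- u0); rewrite normrN; have := ler_norm x; have := normr_ge0 x; have := normr_ge0 u0.
  by move=> *; rewrite ler_norml; apply/andP; split; lra.
exists ((cabs (osc p t x) - N) / (2 * (L + 1))).
  by rewrite divr_gt0 ?subr_gt0 ?mulr_gt0// ltr_wpDl.
move=> s; rewrite ler_pdivlMr ?mulr_gt0 ?ltr_wpDl// => hs.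
have h1 : cabs (osc p t x) <= cabs (osc p t x - osc p s x) + cabs (osc p s x).
  by apply: le_trans (ler_cabsD _ _); rewrite subrK.
have := lip s; have := normr_ge0 (s - t); nra.
Qed.

Lemma extension (lam : R) (E : set R) : closed E -> mu E = 0%E ->
  (forall t, - lam < t < lam -> ~ E t -> locgood p t) ->
  (forall t, E t -> - lam < t < lam -> exists N, forall x, cabs (osc p t x) <= N) ->
  forall t, - lam < t < lam -> locgood p t.
Proof.
move=> cE E0 out oscE t0 t0l; apply: contrapT => nl.
pose B := [set t | - lam < t < lam /\ ~ locgood p t].
have BE : B `<=` E by move=> t [tl nt]; apply: contrapT => nE; exact/nt/out.
have Bi : B `<=` `]- lam, lam[%classic by move=> t [tl _]; rewrite /= in_itv.
have [t [r [N [Bt r0 HN]]]] := uniform_portion cE BE Bi oscE osc_open (conj t0l nl : B t0).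
have [tl nlt] := Bt; apply: nlt; have [tl1 tl2] := andP tl.
have N0 : 0 <= N by apply: le_trans (HN t Bt _ 0); rewrite ?cabs_ge0// subrr normr0 ltW.
(* The closed interval of radius [e] stays inside the portion with the common bound [N] and strictly
   inside ]-lam, lam[. *)
pose e := Num.min r (Num.min (t + lam) (lam - t)) / 2.
have mm1 : Num.min r (Num.min (t + lam) (lam - t)) <= r by rewrite ge_min lexx.
have mm2 : Num.min r (Num.min (t + lam) (lam - t)) <= t + lam by rewrite !ge_min lexx !orbT.
have mm3 : Num.min r (Num.min (t + lam) (lam - t)) <= lam - t by rewrite !ge_min lexx !orbT.
have mm4 : 0 < Num.min r (Num.min (t + lam) (lam - t)) by rewrite !lt_min r0/=; apply/andP; split; lra.
have e0 : 0 < e by rewrite divr_gt0.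
exists e => // phi tp.
have er : e <= r by rewrite /e; lra.
have al : - lam < t - e by rewrite /e; lra.
have bl : t + e < lam by rewrite /e; lra.
clear mm1 mm2 mm3 mm4.
set a := t - e in tp al; set b := t + e in tp bl.
have ab : a < b by rewrite /a /b; lra.
have tx1 : tst (-1) 1 (fun y : R => bump y * y) by apply: tstM (@bump_tst R) _; exact: smooth_id.
have [B1 [B10 H1]] := scaled_norm (ltW ab) tp (@bump_tst R).
have [B2 [B20 H2]] := scaled_norm (ltW ab) tp tx1.
apply/goodP => eps eps0.
pose Q := N * (B1 + B2); have Q0 : 0 <= Q by rewrite mulr_ge0// addr_ge0.
(* The total length allowed to bad cells: a bad piece costs d Q, so together they cost at most eta Q
   <= eps / 2. The added 1 avoids a division by 0. *)
pose eta := eps / 2 / (Q + 1).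
have eta0 : 0 < eta by rewrite !divr_gt0// ltr_wpDl.
have cE' : closed (E `&` `[a, b]%classic) by apply: closedI => //; exact: itv_closed.
have E'0 : mu (E `&` `[a, b]%classic) = 0%E.
  apply/eqP; rewrite -measure_le0 -E0; apply: (@le_measure _ _ _ mu); [apply: mem_set|apply: mem_set|].
  - exact: closed_measurable.
  - exact: closed_measurable.
  - by move=> ? [].
have [n [d1 cov]] : exists n, (b - a) / n.+1%:R <= 1 /\ forall bad : nat -> bool,
   (forall k, bad k -> exists2 s, (E `&` `[a, b]%classic) s &
      `|s - (a + k%:R * ((b - a) / n.+1%:R))| <= (b - a) / n.+1%:R) ->
   \sum_(k < n.+2) (bad k)%:R * ((b - a) / n.+1%:R) <= eta.
  have sub : E `&` `[a, b]%classic `<=` `[a, b]%classic by move=> ? [].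
  have nc := null_cover cE' sub E'0 ab eta0.
  have nl1 : \forall n \near \oo, (b - a) / n.+1%:R <= 1.
    near=> n; rewrite ler_pdivrMr// mul1r; apply: (@le_trans _ _ n%:R); last by rewrite ler_nat.
    by near: n; exact: nbhs_infty_ger.
  have [n [h1 h2]] := filter_ex (filterI nl1 nc).
  by exists n; split; [exact: h1|exact: h2].
set d := (b - a) / n.+1%:R in d1 cov *.
have d0 : 0 < d by rewrite divr_gt0 ?subr_gt0.
have dn : d != 0 by rewrite gt_eqF.
have nd : n.+1%:R * d = b - a by rewrite /d; field.
pose c k := a + k%:R * d.
pose f (k : nat) s := phi s * bump ((s - c k) / d).
have tf k : tst a b (f k) /\ tst (c k - d) (c k + d) (f k) by exact: scaled_tst d0 tp (@bump_tst R).
have sumE : phi = (fun s => \sum_(k < n.+2) f k s).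
  apply/funext => s; rewrite /f -mulr_sumr.
  have [/andP[h1 h2]|h] := boolP (a <= s <= b); last by rewrite tp.2// mul0r.
  have -> : \sum_(k < n.+2) bump ((s - c k) / d) = \sum_(k < n.+2) bump ((s - a) / d - k%:R).
    by apply: eq_bigr => k _; congr bump; rewrite /c; field.
  rewrite bump_sum step_ge1; last by rewrite lerDr divr_ge0 ?subr_ge0// ltW.
  rewrite step_le0 ?subr0 ?mulr1// subr_le0 ler_pdivrMr// nd; lra.
(* Badness refers to [B] and not to [E]: a piece that meets [E] only in locally good points is
   handled by [locgood_itv]. *)
pose bad k := `[< exists2 s, B s & a <= s <= b /\ `|s - c k| <= d >].
have good_piece k : (k < n.+2)%N -> ~~ bad k -> good p (f k).
  move=> kn /asboolPn nb.
  have ck1 : a <= c k by rewrite lerDl mulr_ge0// ltW.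
  have ck2 : c k <= b by rewrite /c -lerBrDl -nd; apply: ler_wpM2r; [exact: ltW|rewrite ler_nat].
  apply: (@locgood_itv _ _ _ mp pK (Num.max a (c k - d)) (Num.min b (c k + d))).
  - exact: overlap_le.
  - move=> s; rewrite overlap_in => /andP[sab sd].
    apply: contrapT => ns; apply: nb; exists s; last by [].
    split=> //; case/andP: sab => s1 s2.
    by rewrite (lt_le_trans al s1) (le_lt_trans s2 bl).
  - split; first exact: (tf k).1.1.
    move=> s; rewrite overlap_in negb_and => /orP[h|]; first exact: (tf k).1.2.
    by rewrite ler_distl; exact: (tf k).2.2.
have bad_piece k h : bad k -> cabs (conv p (f k) h) <= d * Q.
  move=> /asboolP[s Bs [sab sd]].
  have sN x : cabs (osc p s x) <= N.
    by apply: HN => //; apply: le_trans er; rewrite ler_distl.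
  apply: le_trans (conv_piece mp pK p0 h (ltW ab) (tf k).1 sN) _.
  rewrite /Q mulrCA; apply: ler_wpM2l => //.
  have dd : 0 < d <= 1 by rewrite d0.
  have [r1 j1] := H1 d (c k) h dd; have [r2 j2] := H2 d (c k) h dd.
  set g := fun t => phi t * (bump ((t - c k) / d) * ((t - c k) / d)) in r2 j2.
  have tg : tst a b g by exact: (scaled_tst (c k) d0 tp tx1).1.
  (* The common bound holds at s, not at the centre of the piece. With y = (t - c k) / d one has t -
     s = d (y + kap), so (t - s) times the piece is d times a combination of the two fixed profiles
     bump(y) and y bump(y), whose transforms have L1 norms at most [B1] and [B2]. *)
  pose kap := (c k - s) / d.
  have k1 : `|kap| <= 1 by rewrite normrM normfV (gtr0_norm d0) ler_pdivrMr// mul1r distrC.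
  have gE : (fun t => f k t * (t - s)) = (fun t => d * (g t + kap * f k t)).
    by apply/funext => x; rewrite /g /f /kap; move: (phi x) (bump _) => *; field.
  have tkf := tstZ kap (tf k).1.
  apply: (@le_trans _ _ (J (fun u => d * (cabs (Fh (f k) (u - h)) + cabs (Fh g (u - h)))))).
    apply: le_J; [|exact/rintZl/rintD|].
      have t2 : tst a b (fun t => f k t * (t - s)).
        by apply: tstM (tf k).1 _; apply: smoothB; [exact: smooth_id|exact: smooth_cst].
      have [k2 [k20 hk2]] := Fh_rint h (ltW ab) t2.
      apply: (rint_dom _ (rintZl k2 (rint_q1 h))) => [|u].
        by apply: measurable_cabs; exact: cmf_Fh t2.
      by rewrite ger0_norm ?cabs_ge0.
    move=> u; rewrite gE (FhZ _ _ (tstD tg tkf)) (FhD _ tg tkf) (FhZ _ _ (tf k).1).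
    rewrite cabsM cabs_RtoC gtr0_norm//; apply: ler_wpM2l; first exact: ltW.
    apply: le_trans (ler_cabsD _ _) _; rewrite addrC lerD2r cabsM cabs_RtoC.
    by apply: ler_piMl => //; exact: cabs_ge0.
  rewrite (JZl _ (rintD r1 r2)) (JD r1 r2); apply: ler_wpM2l; first exact: ltW.
  exact: lerD.
(* The grid is fixed before h grows: only n + 2 pieces remain, so each may be given the same share
   of eps / 2 and the largest of their thresholds serves for all. *)
pose w := eps / 2 / n.+2%:R; have w0 : 0 < w by rewrite !divr_gt0.
have piece k : (k < n.+2)%N -> exists H, forall h, H <= h ->
    cabs (conv p (f k) h) <= (bad k)%:R * d * Q + w.
  move=> kn; have [bk|bk] := boolP (bad k).
    by exists 0 => h _; rewrite mul1r; apply: le_trans (bad_piece k h bk) _; rewrite lerDl ltW.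
  have [H HH] := (goodP _ _).1 (good_piece k kn bk) w w0.
  by exists H => h /HH; rewrite !mul0r add0r.
have tot m : (m <= n.+2)%N -> exists H, forall h, H <= h ->
    cabs (\sum_(k < m) conv p (f k) h) <= \sum_(k < m) ((bad k)%:R * d * Q + w).
  elim: m => [|m IH] mn; first by exists 0 => h _; rewrite !big_ord0 cabs0.
  have [Ha ha] := IH (ltnW mn); have [Hb hb] := piece m mn.
  exists (Num.max Ha Hb) => h; rewrite ge_max => /andP[l1 l2]; rewrite !big_ord_recr /=.
  by apply: le_trans (ler_cabsD _ _) _; apply: lerD; [exact: ha|exact: hb].
have [H HH] := tot n.+2 (leqnn _); exists H => h Hh.
rewrite {1}sumE (conv_sum mp pK n.+2 h (ltW ab) (fun k => (tf k).1)).
apply: le_trans (HH h Hh) _; rewrite big_split /= -mulr_suml sumr_const card_ord.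
have covb : \sum_(k < n.+2) (bad k)%:R * d <= eta.
  apply: cov => k /asboolP[s Bs [sab sd]]; exists s => //; split; first exact: BE.
  by rewrite /= in_itv.
have -> : w *+ n.+2 = eps / 2 by rewrite /w -mulr_natr; field.
rewrite [leRHS]splitr lerD2r; apply: (@le_trans _ _ (eta * Q)); first exact: ler_wpM2r.
rewrite /eta mulrAC ler_pdivrMr ?ltr_wpDl// ler_wpM2l ?lerDl// ltW// divr_gt0.
Unshelve. all: by end_near. Qed.

End Extension.

(** * From the boundary behaviour of the Laplace transform to decay of convolutions *)

Section Link.
Variable R : realType.
Local Notation C := R[i].

Lemma continuous_expN (s : R) : continuous (fun u : R => expR (- (s * u))).
Proof.
move=> u; apply: (@continuous_comp _ _ _ (fun u : R => - (s * u)) expR); last exact: continuous_expR.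
by apply: continuousN; exact: continuous_scale.
Qed.

Lemma q_tail (h x X : R) : x <= X -> X <= h -> q (x - h) <= q (X - h).
Proof.
move=> xX Xh; rewrite /q lef_pV2 ?posrE ?ltr_pwDl ?sqr_ge0//; nra.
Qed.

Lemma q_vanish (X e : R) : 0 < e -> exists H, forall h, H <= h -> q (X - h) <= e.
Proof.
move=> e0; exists (`|X| + 1 + e^-1) => h hh.
have e1 : 0 < e^-1 by rewrite invr_gt0.
rewrite -[e]invrK /q lef_pV2 ?posrE ?ltr_pwDl ?sqr_ge0//.
have := ler_norm X; have := normr_ge0 X; nra.
Qed.

(** Split at a point X beyond which f is small. To the left of X, f is only bounded, but there one
    of the two factors q(u - h) is at most q(X - h), which tends to 0 as h grows. *)
Lemma good_vanish (f : R -> C) (B a b : R) phi : a <= b -> tst a b phi -> cmf f ->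
  (forall u, cabs (f u) <= B) ->
  (forall e, 0 < e -> exists X, forall u, X <= u -> cabs (f u) <= e) -> good f phi.
Proof.
move=> ab tp mf fB f0; have B0 : 0 <= B by apply: le_trans (fB 0); exact: cabs_ge0.
have [k [k0 kF]] := Fh_decay ab tp.
have kp : 0 < k * pi by rewrite mulr_gt0 ?pi_gt0.
apply/goodP => e e0.
have e1 : 0 < e / 2 / (k * pi) by rewrite !divr_gt0.
have [X fX] := f0 _ e1.
have e2 : 0 < e / 2 / (k * pi) / (B + 1) by rewrite divr_gt0// ltr_wpDl.
have [H qH] := q_vanish X e2.
exists (Num.max X H) => h; rewrite ge_max => /andP[Xh Hh].
have rq := rintZl (e / pi) (rint_q1 h).
have -> : e = J (fun u => e / pi * q (u - h)).
  by rewrite (JZl _ (rint_q1 h)) J_q1 mulfVK// gt_eqF// pi_gt0.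
apply: cabs_I_le => [||u]; [by apply: cmfM mf _; exact: cmf_Fh tp|exact: rq|].
rewrite cabsM.
have qu := ltW (q_gt0 (u - h)).
have pe : e / pi = k * (e / 2 / (k * pi)) + k * (e / 2 / (k * pi)).
  have pn : (pi : R) != 0 by rewrite gt_eqF// pi_gt0.
  have kn : k != 0 by rewrite gt_eqF.
  by move: (pi : R) (k : R) pn kn => P K Pn Kn; field; rewrite ?Pn ?Kn.
have [uX|uX] := leP X u.
  apply: le_trans (ler_pM (cabs_ge0 _) (cabs_ge0 _) (fX _ uX) (kF _)) _.
  rewrite mulrA; apply: ler_pM; [by rewrite mulr_ge0// ltW|exact: sqr_ge0| |exact: q_sqr_le].
  by rewrite pe mulrC lerDl mulr_ge0// ltW.
apply: le_trans (ler_pM (cabs_ge0 _) (cabs_ge0 _) (fB _) (kF _)) _.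
have qe : q (u - h) <= e / 2 / (k * pi) / (B + 1).
  by apply: le_trans (q_tail (ltW uX) Xh) _; exact: qH.
rewrite expr2 !mulrA; apply: ler_wpM2r => //; rewrite pe.
rewrite ler_pdivlMr in qe; last by rewrite ltr_wpDl.
have ek : 0 <= k * (e / 2 / (k * pi)) by rewrite mulr_ge0// ltW.
apply: (@le_trans _ _ (k * (e / 2 / (k * pi)))); last by rewrite lerDl.
rewrite mulrC mulrCA mulrA mulrC mulrA -mulrA ler_pM2l// mulrC.
by apply: le_trans qe; rewrite mulrDr mulr1 lerDl.
Qed.

Lemma smooth_osc (h : R) : smooth (fun t : R => cos (h * t)) /\ smooth (fun t : R => sin (h * t)).
Proof.
have [sc ss] := smooth_cos R; have sh : smooth (fun t : R => h * t) by apply: smoothZ; exact: smooth_id.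
by split; [exact: (@smooth_comp R (@cos R))|exact: (@smooth_comp R (@sin R))].
Qed.

Lemma test_mod (U : set R) (a b h : R) phi : `[a, b]%classic `<=` U -> tst a b phi ->
  test_function U (fun t => cexpi (h * t) * RtoC (phi t)).
Proof.
move=> abU [sp p0]; have [sc ss] := smooth_osc h; split; last split.
- by under eq_fun do rewrite ReM /= mulr0 subr0; exact: smoothM.
- by under eq_fun do rewrite ImM /= mulr0 add0r; exact: smoothM.
exists `[a, b]%classic; split; [exact: segment_compact|exact: abU|move=> t nt].
by rewrite p0 ?RtoC0 ?mulr0//; apply/negP => h1; apply: nt; rewrite /= in_itv.
Qed.

Variables (rho r p : R -> C) (rho0 : C) (M u0 x0 : R).
Hypotheses (mrho : cmf rho) (rho_neg : forall v, v < 0 -> rho v = 0)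
  (mr : cmf r) (rM : forall v, cabs (r v) <= M) (r0 : forall v, v < u0 -> r v = 0)
  (pE : forall u, p u = I (fun v => ind (v < u) * r v))
  (cD : ci (fun v => r v - rho v)) (rE : forall v, x0 <= v -> r v = rho v) (x00 : 0 < x0)
  (ID0 : I (fun v => r v - rho v) = - rho0).

Let D v := r v - rho v.
Let M0 : 0 <= M. Proof. by apply: le_trans (rM 0); exact: cabs_ge0. Qed.
Let rhoE v : rho v = r v - D v. Proof. by rewrite /D; ring. Qed.

(** The constant is subtracted only for u > 0, so that [tau] vanishes on the negative axis and its
    Laplace transform may be written over the whole line. *)
Definition tau u : C := I (fun v => ind (v < u) * rho v) - ind (0 < u) * rho0.

Let mlt u : cmf (fun v : R => ind (v < u) : C).
Proof. by apply: cmf_ind; exact: measurable_fun_ltr. Qed.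
Let mgt u : cmf (fun v : R => ind (u < v) : C).
Proof. by apply: cmf_ind; exact: measurable_fun_ltr. Qed.

Let cDu u : ci (fun v => ind (v < u) * D v).
Proof. by apply: (ciM_bnd (B := 1)) cD => // v; exact: cabs_ind_le1. Qed.

Let cru u : ci (fun v => ind (v < u) * r v).
Proof.
have cc : continuous (fun _ : R => M) by move=> ?; exact: cvg_cst.
apply: (ci_dom _ (rint_itv u0 u cc)) => [|v]; first exact: cmfM.
rewrite cabsM indE rindE; case: ifPn => vu; last by rewrite cabs0 mul0r; case: (_ && _); rewrite ?mul1r ?mul0r.
rewrite cabs1 mul1r; have [uv|uv] := leP u0 v; first by rewrite (ltW vu) mul1r.
by rewrite r0// cabs0 mul0r.
Qed.

Let crhou u : ci (fun v => ind (v < u) * rho v).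
Proof.
have := ciB (cru u) (cDu u); congr ci; apply/funext => v; rewrite rhoE; ring.
Qed.

Lemma tau_sub u : tau u - p u = - I (fun v => ind (v < u) * D v) - ind (0 < u) * rho0.
Proof.
rewrite /tau pE (_ : I (fun v => ind (v < u) * rho v) =
  I (fun v => ind (v < u) * r v) - I (fun v => ind (v < u) * D v)); first by ring.
by rewrite -(IB (cru u) (cDu u)); apply: eqI => v; rewrite rhoE; ring.
Qed.

(** Beyond x0 the difference [D] has been integrated completely, and its total integral, minus rho0,
    cancels the constant in [tau]. *)
Lemma tau_eq u : x0 <= u -> tau u = p u.
Proof.
move=> xu; apply/eqP; rewrite -subr_eq0 tau_sub indE (lt_le_trans x00 xu) mul1r.
have -> : I (fun v => ind (v < u) * D v) = I D.
  apply: eqI => v; rewrite indE; case: ltP => [_|uv]; first by rewrite mul1r.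
  by rewrite /D rE ?subrr ?mulr0//; exact: le_trans uv.
by rewrite ID0 opprK subrr.
Qed.

Let A0 := J (fun v => cabs (D v)) + cabs rho0.

Let A00 : 0 <= A0.
Proof. by rewrite addr_ge0 ?cabs_ge0//; apply: J_ge0 => v; exact: cabs_ge0. Qed.

Lemma tau_sub_le u : cabs (tau u - p u) <= A0.
Proof.
rewrite tau_sub; apply: le_trans (ler_cabsB _ _) _; rewrite cabsN; apply: lerD.
  apply: cabs_I_le; [exact: (cDu u).1|exact: cD.2|move=> v].
  by rewrite cabsM ler_piMl ?cabs_ge0// cabs_ind_le1.
by rewrite cabsM ler_piMl ?cabs_ge0// cabs_ind_le1.
Qed.

Let plip := prim_lip mr rM r0 pE.
Let mp : cmf p := prim_cmf mr rM r0 pE.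

Let plin h u : cabs (p u) <= M * `|h - u0| + M * `|u - h|.
Proof.
have pu0 : p u0 = 0 by exact: (prim0 r0 pE).
have := plip u u0; rewrite pu0 subr0 => /le_trans; apply.
rewrite -mulrDr; apply: ler_wpM2l => //; rewrite addrC.
apply: le_trans (ler_normD _ _); rewrite le_eqVlt; apply/orP; left; apply/eqP; congr (`| _ |); ring.
Qed.

Let taulin h u : cabs (tau u) <= (A0 + M * `|h - u0|) + M * `|u - h|.
Proof.
rewrite -[tau u](subrK (p u)); apply: le_trans (ler_cabsD _ _) _; rewrite -[leRHS]addrA; apply: lerD.
  exact: tau_sub_le.
exact: plin.
Qed.

Let rhoint : cmf (fun u : R => I (fun v => ind (v < u) * rho v)).
Proof.
have -> : (fun u : R => I (fun v => ind (v < u) * rho v)) =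
    (fun u => p u - I (fun v => ind (v < u) * D v)).
  apply/funext => u; rewrite pE -(IB (cru u) (cDu u)); apply: eqI => v; rewrite rhoE; ring.
apply: cmfB mp _.
(* Measurability in u is drawn from Fubini, which asks for an integrable factor in u; [q] is
   inserted for this purpose and divided out again. *)
have rJ : rint (fun x : R => q (x - 0)) by exact: rint_q1.
have mk : cmf (fun z : R * R => RtoC (q (z.1 - 0)) * (ind (z.2 < z.1) * D z.2)).
  apply: cmfM.
    apply: (@cmf_comp _ _ _ _ R (fun x : R => RtoC (q (x - 0))) fst _ measurable_fst).
    by apply: cmf_RtoC; exact: rint_meas rJ.
  apply: cmfM; first by apply: cmf_ind; exact: measurable_fun_ltr.
  exact: (cmf_comp cD.1 measurable_snd).
have := I_fubini_prod_cmf mk rJ cD.2.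
move=> h; have {}h : cmf (fun x : R => I (fun y => RtoC (q (x - 0)) * (ind (y < x) * D y))).
  apply: h => x y; rewrite !cabsM cabs_RtoC ger0_norm ?(ltW (q_gt0 _))//.
  apply: ler_wpM2l; first exact: ltW (q_gt0 _).
  by rewrite ler_piMl ?cabs_ge0// cabs_ind_le1.
have -> : (fun u : R => I (fun v => ind (v < u) * D v)) =
   (fun u => RtoC (q (u - 0))^-1 * I (fun y => RtoC (q (u - 0)) * (ind (y < u) * D y))).
  apply/funext => u; rewrite (IZl (RtoC (q (u - 0))) (cDu u)) mulrA -RtoCM mulVf ?gt_eqF ?q_gt0//.
  by rewrite RtoC1 mul1r.
apply: cmfM h; apply: cmf_RtoC.
under eq_fun do rewrite /q invrK; apply: continuous_measurable_fun => x.
apply: cvgD; first exact: cvg_cst.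
by apply: (@cvgM _ _ _ _ (fun x : R => x - 0) (fun x : R => x - 0)); apply: cvgB; [exact: cvg_id|exact: cvg_cst|exact: cvg_id|exact: cvg_cst].
Qed.

Lemma tau_cmf : cmf tau.
Proof.
apply: cmfB rhoint _; apply: cmfM; [exact: mgt|exact: cmf_cst].
Qed.

Lemma tau_neg u : u <= 0 -> tau u = 0.
Proof.
move=> h; rewrite /tau indE ltNge h mul0r subr0 -[RHS]I0; apply: eqI => v; rewrite indE.
by case: ltP => vu; rewrite ?mul0r// rho_neg ?mulr0// (lt_le_trans vu).
Qed.

Lemma good_tau (a b : R) phi : a <= b -> tst a b phi -> good tau phi -> good p phi.
Proof.
move=> ab tp /goodP gt.
have md : cmf (fun u => tau u - p u) by apply: cmfB mp; exact: tau_cmf.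
have v0 e : 0 < e -> exists X, forall u, X <= u -> cabs (tau u - p u) <= e.
  by move=> e0; exists x0 => u xu; rewrite tau_eq// subrr cabs0 ltW.
have /goodP gd := good_vanish ab tp md tau_sub_le v0.
apply/goodP => e e0; have e2 : 0 < e / 2 by rewrite divr_gt0.
have [H1 h1] := gt _ e2; have [H2 h2] := gd _ e2.
exists (Num.max H1 H2) => h; rewrite ge_max => /andP[l1 l2].
have A1 : 0 <= A0 + M * `|h - u0| by rewrite addr_ge0// mulr_ge0.
have A2 : 0 <= M * `|h - u0| by rewrite mulr_ge0.
have [_ [_ [c1 _]]] := conv_lip_ci ab tp tau_cmf (taulin h) A1 M0.
have [_ [_ [c2 _]]] := conv_lip_ci ab tp mp (plin h) A2 M0.
have -> : conv p phi h = conv tau phi h - conv (fun u => tau u - p u) phi h.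
  rewrite /conv [X in _ - X](_ : _ = I (fun u => tau u * Fh phi (u - h) - p u * Fh phi (u - h))).
    by rewrite (IB c1 c2); ring.
  by apply: eqI => u; ring.
apply: le_trans (ler_cabsB _ _) _; rewrite [e]splitr.
by apply: lerD; [exact: h1|exact: h2].
Qed.

Section Frequency.
Variables (s t : R).
Hypothesis s0 : 0 < s.
Let z : C := Complex s t.
Let g u : C := RtoC (expR (- (s * u))) * cexpi (- (t * u)).

Lemma cexp_split u : cexp (- (z * RtoC u)) = g u.
Proof. by apply: eqC; rewrite /g ?(ReM, ImM) /= ?(ReN, ImN) ?(ReM, ImM) /= ?mulr0 ?mul0r ?subr0 ?addr0 ?add0r. Qed.

Let zn0 : z != 0.
Proof. by apply/eqP => -[h]; move: s0; rewrite h ltxx. Qed.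

Let dexp : cderive (fun u => - z^-1 * g u) g.
Proof.
have e1 : cderive (fun u : R => RtoC (expR (- (s * u)))) (fun u => RtoC (expR (- (s * u)) * - s)).
  apply: cderive_RtoC => u.
  by apply: der_eq (d_comp (is_derive_expR _) (dN (dZ s (d_id u)))) _; rewrite mulr1.
have e2 : cderive (fun u : R => cexpi (- (t * u))) (fun u => Complex 0 (- t) * cexpi (- (t * u))).
  by apply: cderive_cexpi => u; apply: der_eq (dN (dZ t (d_id u))) _; rewrite mulr1.
have e3 : cderive (fun=> - z^-1) (fun=> 0) by move=> u; split; exact: d_cst.
have := cderiveM e3 (cderiveM e1 e2); congr cderive; apply/funext => u; rewrite /g.
have zE : z = RtoC s - Complex 0 (- t) by apply: eqC; rewrite !(ReD, ImD, ReN, ImN) /=; ring.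
rewrite RtoCM RtoCN; move: (RtoC (expR _)) (cexpi _) => x y.
have : z^-1 * z = 1 by rewrite mulVf.
rewrite {2}zE; move: (z^-1) (Complex 0 (- t)) (RtoC s) => w v b wz.
by rewrite mul0r add0r -[RHS]mul1r -wz; ring.
Qed.

Let cg : ccont g.
Proof.
apply: ccontM.
  exact: ccont_RtoC (@continuous_expN s).
by apply: ccont_cexpi => u; apply: continuousN; exact: continuous_scale.
Qed.

Lemma cabs_g u : cabs (g u) = expR (- (s * u)).
Proof. by rewrite cabsM cabs_cexpi mulr1 cabs_RtoC ger0_norm ?expR_ge0. Qed.

Let tail v : 0 <= v -> I (fun u => ind (v < u) * g u) = z^-1 * g v.
Proof.
move=> v0; have [re _] := exp_integral s0.
have [|||_ ->] := @I_ftc_oo _ g _ v _ cg dexp re.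
- by move=> u vu; rewrite cabs_g rindE (le_lt_trans v0 vu) mul1r.
- by move=> u; rewrite rindE; case: ifP => _; rewrite ?mul0r// mul1r expR_ge0.
- have -> : (fun n : nat => cabs (- z^-1 * g (v + n%:R))) = (fun n => cabs (- z^-1) * expR (- (s * (v + n%:R)))).
    by apply/funext => n; rewrite cabsM cabs_g.
  rewrite -[X in _ --> X](mulr0 (cabs (- z^-1))); apply: cvgM; first exact: cvg_cst.
  apply: (@cvg_comp _ _ _ (fun n : nat => s * (v + n%:R)) (fun y => expR (- y)) _ +oo); last exact: cvgr_expR.
  apply/cvgryPge => A; near=> n.
  rewrite mulrC -ler_pdivrMr// -lerBlDl; near: n; exact: nbhs_infty_ger.
by rewrite mulNr opprK.
Unshelve. all: by end_near. Qed.

Let e2 : 0 < s / 2. Proof. by rewrite divr_gt0. Qed.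

(** Exchanging the integrations over v < u turns the transform of the primitive of rho into the
    integral of rho against the tail of the exponential, which is the exponential itself divided by
    z. The constant rho0 on u > 0 contributes rho0 / z in the same way. *)
Lemma laplace_tau : (laplace rho z - rho0) / z = I (fun u => tau u * cexp (- (z * RtoC u))).
Proof.
have [re1 _] := exp_integral e2.
(* For v < u, exp(-s u) <= exp(-s v / 2) exp(-s u / 2) supplies the product majorant; rho itself is
   controlled by M plus the integrable modulus of [D]. *)
have ra : rint (fun v => cabs (rho v) * (rind (0 <= v) * expR (- (s / 2 * v)))).
  have co : continuous (fun _ : R => 1 : R) by move=> ?; exact: cvg_cst.
  apply: (rint_dom _ (rintD (rintD (rintZl M re1) cD.2) (rintZl M (rint_itv 0 0 co)))) => [|v].
    apply: measurable_funM; first exact: measurable_cabs.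
    apply: measurable_funM; first by apply: measurable_rind; exact: measurable_fun_ler.
    exact: continuous_measurable_fun (@continuous_expN _).
  rewrite ger0_norm; last by rewrite mulr_ge0 ?cabs_ge0// mulr_ge0 ?expR_ge0// rindE; case: ifP.
  rewrite !rindE -/(D v); have [v0|v0] := ltP v 0.
    by rewrite (lt_gtF v0) /= !mul0r !mulr0 add0r addr0 cabs_ge0.
  have rb : cabs (rho v) <= M + cabs (D v).
    by rewrite rhoE; apply: le_trans (ler_cabsB _ _) _; rewrite lerD2r.
  have ex1 : expR (- (s / 2 * v)) <= 1 by rewrite -[leRHS]expR0 ler_expR oppr_le0; exact: mulr_ge0 (ltW e2) v0.
  have ex0 := expR_ge0 (- (s / 2 * v)); have d0 := cabs_ge0 (D v); have rr0 := cabs_ge0 (rho v).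
  case: (ltP 0 v) => v1 /=; move: rb ex1 ex0 d0 rr0; move: (cabs (rho v)) (cabs (D v)) (expR _) => x y w *; nra.
have E : I (fun u => g u * I (fun v => ind (v < u) * rho v)) = I (fun v => rho v * I (fun u => ind (v < u) * g u)).
  apply: (I_primitive mrho (ccont_cmf cg) ra re1) => [u v vu|u v].
    rewrite cabs_g; have [v0|v0] := ltP v 0.
      by rewrite rho_neg// cabs0 !mul0r.
    rewrite !rindE (le_lt_trans v0 vu) !mul1r -mulrA ler_wpM2l ?cabs_ge0// -expRD ler_expR.
    by have := ler_wpM2l (ltW s0) (ltW vu); lra.
  by rewrite mulr_ge0// ?mulr_ge0 ?cabs_ge0 ?expR_ge0// rindE; case: ifP.
have E2 : I (fun v => rho v * I (fun u => ind (v < u) * g u)) = z^-1 * laplace rho z.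
  have cl : ci (fun v => ind (v \in `[0%R, +oo[) * (rho v * cexp (- (z * RtoC v)))).
    apply: (ci_dom _ ra) => [|v].
      apply: cmfM.
        by apply: cmf_ind; under eq_fun do rewrite in_itv /= andbT; exact: measurable_fun_ler.
      by apply: cmfM mrho _; under eq_fun do rewrite cexp_split; exact: ccont_cmf.
    rewrite in_itv /= andbT cexp_split cabsM (cabsM (rho v)) cabs_g indE rindE; case: ifPn => v0; last first.
      by rewrite cabs0 !mul0r mulr0.
    rewrite cabs1 !mul1r; apply: ler_wpM2l; first exact: cabs_ge0.
    by rewrite ler_expR; have := mulr_ge0 (ltW s0) v0; lra.
  rewrite /laplace (_ : [set x : R | 0 <= x] = `[0%R, +oo[%classic); last first.
    by apply/seteqP; split => x /=; rewrite in_itv /= andbT.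
  rewrite cint_itv -(IZl z^-1 cl); apply: eqI => v; rewrite in_itv /= andbT indE.
  case: leP => v0; last by rewrite (rho_neg v0) !mul0r !mulr0.
  by rewrite (tail v0) cexp_split mul1r; ring.
have cg1 : ci (fun u => ind (0 < u) * g u).
  have [re _] := exp_integral s0; apply: (ci_dom _ re) => [|u].
    by apply: cmfM; [exact: mgt|exact: ccont_cmf].
  by rewrite cabsM cabs_g indE rindE; case: ifP => _; rewrite ?cabs1 ?cabs0.
have cg2 : ci (fun u => g u * I (fun v => ind (v < u) * rho v)).
  (* The primitive of rho grows at most linearly, and u exp(-s u / 2) <= 2 / s absorbs the growth
     into half of the exponential. *)
  pose B0 : R := A0 + M * `|u0| + M * (s / 2)^-1 + cabs rho0.
  apply: (ci_dom _ (rintZl B0 re1)) => [|u]; first by apply: cmfM rhoint; exact: ccont_cmf.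
  rewrite cabsM cabs_g rindE; case: ltP => u1; last first.
    rewrite (_ : I _ = tau u); first by rewrite (tau_neg u1) cabs0 !mul0r !mulr0.
    by rewrite /tau indE ltNge u1 mul0r subr0.
  have -> : I (fun v => ind (v < u) * rho v) = tau u + rho0.
    by rewrite /tau indE u1 mul1r subrK.
  have tl : cabs (tau u + rho0) <= A0 + M * `|u0| + M * u + cabs rho0.
    apply: le_trans (ler_cabsD _ _) _; rewrite lerD2r.
    by have := taulin 0 u; rewrite sub0r normrN subr0 (gtr0_norm u1).
  rewrite mul1r; have -> : - (s * u) = - (s / 2 * u) + - (s / 2 * u) by field.
  rewrite expRD -mulrA mulrCA mulrC; apply: ler_wpM2r; first exact: expR_ge0.
  have ex1 : expR (- (s / 2 * u)) <= 1 by rewrite -[leRHS]expR0 ler_expR oppr_le0; exact: mulr_ge0 (ltW e2) (ltW u1).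
  have ex0 := expR_ge0 (- (s / 2 * u)).
  have eu : u * expR (- (s / 2 * u)) <= (s / 2)^-1.
    rewrite expRN ler_pdivrMr; last exact: expR_gt0.
    rewrite -ler_pdivrMl; last by rewrite invr_gt0.
    rewrite invrK.
    by apply: le_trans (expR_ge1Dx _); rewrite lerDr.
  apply: (@le_trans _ _ (expR (- (s / 2 * u)) * (A0 + M * `|u0| + M * u + cabs rho0))).
    by apply: ler_wpM2l.
  have c1 : 0 <= A0 + M * `|u0| by apply: addr_ge0; [exact: A00|apply: mulr_ge0; [exact: M0|exact: normr_ge0]].
  have c2 := cabs_ge0 rho0; rewrite /B0.
  have : M * (u * expR (- (s / 2 * u))) <= M * (s / 2)^-1 by rewrite ler_wpM2l.
  nra.
have -> : I (fun u => tau u * cexp (- (z * RtoC u))) =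
    I (fun u => g u * I (fun v => ind (v < u) * rho v)) - rho0 * I (fun u => ind (0 < u) * g u).
  rewrite -(IZl rho0 cg1) -(IB cg2 (ciZ _ cg1)); apply: eqI => u; rewrite cexp_split /tau; ring.
rewrite E E2 (tail (lexx 0)) /g !mulr0 oppr0 expR0 cexpi0 RtoC1; ring.
Qed.

End Frequency.

Let tau_exp (s : R) : 0 < s -> rint (fun u => cabs (tau u) * expR (- (s * u))).
Proof.
move=> s0; have e2 : 0 < s / 2 by rewrite divr_gt0.
have [re1 _] := exp_integral e2.
pose A := A0 + M * `|u0|; have A1 : 0 <= A by apply: addr_ge0; [exact: A00|apply: mulr_ge0; [exact: M0|exact: normr_ge0]].
apply: (rint_dom _ (rintZl (A + M * (s / 2)^-1) re1)) => [|u].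
  apply: measurable_funM; first exact: measurable_cabs tau_cmf.
  exact: continuous_measurable_fun (@continuous_expN _).
rewrite ger0_norm; last by apply: mulr_ge0; [exact: cabs_ge0|exact: expR_ge0].
rewrite rindE; case: ltP => u1; last by rewrite (tau_neg u1) cabs0 !mul0r mulr0.
have tl : cabs (tau u) <= A + M * u.
  by have := taulin 0 u; rewrite sub0r normrN subr0 (gtr0_norm u1).
have -> : - (s * u) = - (s / 2 * u) + - (s / 2 * u) by field.
rewrite mul1r expRD mulrA; apply: ler_wpM2r; first exact: expR_ge0.
have ex1 : expR (- (s / 2 * u)) <= 1 by rewrite -[leRHS]expR0 ler_expR oppr_le0; exact: mulr_ge0 (ltW e2) (ltW u1).
have ex0 := expR_ge0 (- (s / 2 * u)).
have eu : u * expR (- (s / 2 * u)) <= (s / 2)^-1.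
  rewrite expRN ler_pdivrMr; last exact: expR_gt0.
  rewrite -ler_pdivrMl; last by rewrite invr_gt0.
  rewrite invrK.
  by apply: le_trans (expR_ge1Dx _); rewrite lerDr.
apply: le_trans (ler_wpM2r ex0 tl) _; rewrite mulrDl -(mulrA M).
by apply: lerD; [rewrite ler_piMr|exact: ler_wpM2l].
Qed.

(** Fubini in t and u followed by [Fh_mod]. As [tau] is only known to grow at most linearly, the
    factor exp(-s u) is what makes the double integral converge absolutely. *)
Lemma laplace_pairing (s a b h : R) phi : 0 < s -> tst a b phi ->
  I (fun t => (laplace rho (Complex s t) - rho0) / Complex s t * (cexpi (h * t) * RtoC (phi t))) =
  I (fun u => tau u * RtoC (expR (- (s * u))) * Fh phi (u - h)).
Proof.
move=> s0 tp; have rp := rint_norm (tst_rint tp); have rt := tau_exp s0.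
pose K (y : R * R) := tau y.2 * (RtoC (expR (- (s * y.2))) * cexpi (- (y.1 * y.2))) * (cexpi (h * y.1) * RtoC (phi y.1)).
have me : measurable_fun setT (fun u : R => expR (- (s * u))).
  exact: continuous_measurable_fun (@continuous_expN _).
have mK : cmf K.
  apply: cmfM.
    apply: cmfM; first exact: (cmf_comp tau_cmf measurable_snd).
    apply: cmfM; first exact: (@cmf_comp _ _ _ _ R (fun u => RtoC (expR (- (s * u)))) snd (cmf_RtoC me) measurable_snd).
    by apply: cmf_cexpi; apply: measurableT_comp => //; apply: measurable_funM; [exact: measurable_fst|exact: measurable_snd].
  apply: cmfM; first by apply: cmf_cexpi; apply: measurable_funM => //; exact: measurable_fst.
  exact: (@cmf_comp _ _ _ _ R (fun t => RtoC (phi t)) fst (cmf_RtoC (smooth_meas tp.1)) measurable_fst).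
have KB x y : cabs (K (x, y)) <= `|phi x| * (cabs (tau y) * expR (- (s * y))).
  rewrite /K /= cabsM (cabsM (tau y)) (cabsM (RtoC _)) (cabsM (cexpi _)) !cabs_cexpi !cabs_RtoC.
  by rewrite mul1r mulr1 (ger0_norm (expR_ge0 _)) mulrC.
have := I_fubini_prod mK rp rt KB; rewrite /K /= => E.
transitivity (I (fun x => I (fun y => tau y * (RtoC (expR (- (s * y))) * cexpi (- (x * y))) * (cexpi (h * x) * RtoC (phi x))))).
  apply: eqI => t; rewrite (laplace_tau t s0).
  have ct : ci (fun u => tau u * (RtoC (expR (- (s * u))) * cexpi (- (t * u)))).
    split.
      by apply: cmfM tau_cmf _; apply: cmfM; [exact: cmf_RtoC|exact: cmf_osc].
    apply: rint_dom rt _ => [|u].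
      by apply: measurable_cabs; apply: cmfM tau_cmf _; apply: cmfM; [exact: cmf_RtoC|exact: cmf_osc].
    rewrite (ger0_norm (cabs_ge0 _)) cabsM (cabsM (RtoC _)) cabs_cexpi mulr1 cabs_RtoC.
    by rewrite (ger0_norm (expR_ge0 _)).
  rewrite [RHS](IZr _ ct); congr (_ * _); apply: eqI => u; by rewrite cexp_split.
rewrite E; apply: eqI => u.
rewrite -[Fh _ _]Fh_mod -(IZl _ (f := fun t => cexpi (- (u * t)) * (cexpi (h * t) * RtoC (phi t)))).
  by apply: eqI => t; rewrite [t * u]mulrC; move: (cexpi _) (cexpi _) (RtoC _) (RtoC _) (tau u) => *; ring.
apply: (ci_dom _ rp) => [|t].
  apply: cmfM; first exact: cmf_osc.
  apply: cmfM; first by apply: cmf_cexpi; exact: measurable_funM.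
  exact: cmf_RtoC (smooth_meas tp.1).
by rewrite cabsM (cabsM (cexpi (h * t))) !cabs_cexpi !mul1r cabs_RtoC.
Qed.

(** Dominated convergence along s = 1 / (n + 1). Once the integration in t is done, the decay of the
    transform alone makes the integrand absolutely integrable, and exp(-s u) <= 1 where [tau]
    lives. *)
Lemma boundary_conv (a b h : R) phi (L : C) : a <= b -> tst a b phi ->
  let T s := cint setT (fun t => (laplace rho (Complex s t) - rho0) / Complex s t * (cexpi (h * t) * RtoC (phi t))) in
  (fun s => complex.Re (T s)) @ 0^'+ --> complex.Re L ->
  (fun s => complex.Im (T s)) @ 0^'+ --> complex.Im L ->
  L = conv tau phi h.
Proof.
move=> ab tp T lr li.
pose sg (n : nat) : R := harmonic n.
have sg0 n : 0 < sg n by exact: harmonic_gt0.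
have sgl : sg @ \oo --> (0 : R) by exact: cvg_harmonic.
have lr' := (cvg_at_rightP _ _ _).1 lr sg (conj sg0 sgl).
have li' := (cvg_at_rightP _ _ _).1 li sg (conj sg0 sgl).
have A1 : 0 <= A0 + M * `|h - u0| by apply: addr_ge0; [exact: A00|apply: mulr_ge0; [exact: M0|exact: normr_ge0]].
have [k [k0 [c1 kq]]] := conv_lip_ci ab tp tau_cmf (taulin h) A1 M0.
pose f_ n u := tau u * RtoC (expR (- (sg n * u))) * Fh phi (u - h).
have me n : measurable_fun setT (fun u : R => expR (- (sg n * u))).
  exact: continuous_measurable_fun (@continuous_expN _).
have fE n u : f_ n u = RtoC (expR (- (sg n * u))) * (tau u * Fh phi (u - h)).
  by rewrite /f_; ring.
have lim : cabs (I (f_ n) - conv tau phi h) @[n --> \oo] --> (0 : R).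
  apply: (I_dct (b := fun u => k * q (u - h))).
  - move=> n; have -> : f_ n = (fun u => RtoC (expR (- (sg n * u))) * (tau u * Fh phi (u - h))).
      by apply/funext => u; exact: fE.
    by apply: cmfM c1.1; exact: cmf_RtoC.
  - exact: c1.1.
  - exact: rintZl (rint_q1 h).
  - move=> n u; have [u1|u1] := leP u 0.
      rewrite /f_ (tau_neg u1) !mul0r cabs0; apply: mulr_ge0 => //; exact: ltW (q_gt0 _).
    apply: le_trans (kq u); rewrite fE cabsM cabs_RtoC (ger0_norm (expR_ge0 _)).
    apply: ler_piMl; first exact: cabs_ge0.
    by rewrite -[leRHS]expR0 ler_expR oppr_le0; exact: mulr_ge0 (ltW (sg0 n)) (ltW u1).
  - exact: kq.
  move=> u.
  have -> : (fun n => cabs (f_ n u - tau u * Fh phi (u - h))) =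
      (fun n => `|expR (- (sg n * u)) - 1| * cabs (tau u * Fh phi (u - h))).
    apply/funext => n; rewrite fE -cabs_RtoC -cabsM; congr cabs.
    by rewrite RtoCB RtoC1; move: (tau u * _) (RtoC _) => *; ring.
  rewrite -[X in _ --> X](mul0r (cabs (tau u * Fh phi (u - h)))); apply: cvgM; last exact: cvg_cst.
  rewrite -[X in _ --> X](@normr0 _ R); apply: (@cvg_norm _ R).
  rewrite -[X in _ --> X](subrr (1 : R)); apply: cvgB; last exact: cvg_cst.
  rewrite -[X in _ --> X](@expR0 R); apply: (@cvg_comp _ _ _ (fun n => - (sg n * u)) expR); last exact: continuous_expR.
  have su : (fun n => sg n * u) @ \oo --> (0 * u : R) by apply: cvgM; [exact: sgl|exact: cvg_cst].
  have su' : (fun n => - (sg n * u)) @ \oo --> (- (0 * u) : R) by apply: cvgN.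
  by rewrite mul0r oppr0 in su'; exact: su'.
have TE n : T (sg n) = I (f_ n) by exact: laplace_pairing (sg0 n) tp.
have key (P : C -> R) : (forall z w, P (z - w) = P z - P w) -> (forall z, `|P z| <= cabs z) ->
    (P (T (sg n)) @[n --> \oo] --> P L) -> P L = P (conv tau phi h).
  move=> PB Pc PL; have l2 : P (T (sg n)) @[n --> \oo] --> P (conv tau phi h).
    apply/cvgrPdist_le => e e0; move/cvgrPdist_le : lim => /(_ e e0); apply: filterS => n.
    rewrite sub0r normrN (ger0_norm (cabs_ge0 _)) TE distrC -PB; exact: le_trans.
  rewrite -(cvg_lim (@norm_hausdorff _ R) PL); exact: (cvg_lim (@norm_hausdorff _ R) l2).
apply: eqC; [apply: (key (@complex.Re R)) => //; [by move=> z w; rewrite ReD ReN|exact: Re_le_cabs]|apply: (key (@complex.Im R)) => //; [by move=> z w; rewrite ImD ImN|exact: Im_le_cabs]].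
Qed.

(** Near t1 the boundary distribution is the pseudofunction with transform g. Testing it against
    [cexpi (h * t) * phi t] and reflecting the variable gives the convolution of g(-u) with the
    transform of phi, up to the factor 1 / (2 pi). As h tends to +oo this reads g near -oo, where it
    vanishes. *)
Lemma boundary_good (U : set R) t1 : U t1 ->
  local_pf_boundary (fun s => (laplace rho s - rho0) / s) U -> locgood p t1.
Proof.
move=> Ut [G [Glim Gloc]].
have [V [oV Vt VU [g [[gmr gmi [B gB] _ ginf] Gg]]]] := Gloc t1 Ut.
have /nbhs_ballP[e /= e0 eV] := open_nbhs_nbhs (conj oV Vt).
exists (e / 2); first by rewrite divr_gt0.
move=> phi tp; set a := t1 - e / 2 in tp; set b := t1 + e / 2 in tp.
have ab : a <= b by rewrite /a /b; lra.
have abV : `[a, b]%classic `<=` V.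
  move=> x /=; rewrite in_itv /= => /andP[x1 x2]; apply: eV; rewrite /ball /= ltr_norml.
  by apply/andP; split; move: x1 x2 e0; rewrite /a /b; lra.
apply: (good_tau ab tp).
have mg : cmf (fun u : R => g (- u)).
  by split; [apply: (measurableT_comp gmr)|apply: (measurableT_comp gmi)].
have gv e' : 0 < e' -> exists X, forall u, X <= u -> cabs (g (- u)) <= e'.
  move=> e'0; have [X [_ HX]] := (cvgrPdist_le _ _).1 ginf e' e'0.
  exists (1 - X) => u hu; have := HX (- u); rewrite sub0r normrN (ger0_norm (cabs_ge0 _)); apply.
  lra.
have /goodP gg := good_vanish ab tp mg (fun u => gB (- u)) gv.
have c0 : 0 < (2 * pi : R)^-1 by rewrite invr_gt0 mulr_gt0 ?pi_gt0.
have key h : conv tau phi h = RtoC (2 * pi)^-1 * conv (fun u => g (- u)) phi h.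
  have tV := test_mod h abV tp.
  have tU : test_function U (fun t => cexpi (h * t) * RtoC (phi t)).
    exact: test_mod (subset_trans abV VU) tp.
  have [l1 l2] := Glim _ tU.
  rewrite -(boundary_conv ab tp l1 l2) (Gg _ tV) /pseudofunction.
  have cc := conv_ci h ab tp mg (fun u => gB (- u)).
  rewrite /conv; have [cco EI] := I_opp cc; rewrite -EI.
  rewrite -(IZl _ cco); apply: eqI => x; rewrite /inv_fourierC opprK.
  have -> : cint setT (fun t => cexpi (x * t) * (cexpi (h * t) * RtoC (phi t))) = Fh phi (- x - h).
    by rewrite -Fh_mod; apply: eqI => t; rewrite mulNr opprK.
  by move: (g x) (Fh _ _) (RtoC _) => *; ring.
apply/goodP => e' e'0; have e2 : 0 < e' / (2 * pi)^-1 by rewrite divr_gt0.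
have [H HH] := gg _ e2; exists H => h hh; rewrite key cabsM cabs_RtoC (gtr0_norm c0).
by rewrite mulrC -ler_pdivlMr//; exact: HH.
Qed.

(** Integration by parts with the primitive [kap * e u] of e^{-itu}, where [kap] is 1 / (-it). The
    boundary term is bounded by K, and the integral of r e^{-itv} by Mt plus the L1 norm of r - rho.
    The division by t is why the frequency 0 must stay outside E. *)
Lemma osc_bounded (K t Mt : R) : t != 0 -> (forall u, cabs (p u) <= K) ->
  (forall x, 0 < x -> cabs (cint `[0, x]%classic (fun u => rho u * cexpi (- (t * u)))) <= Mt) ->
  forall x, cabs (osc p t x) <= (K + (Mt + J (fun v => cabs (D v)))) / `|t|.
Proof.
move=> tn pK HMt x.
pose e (u : R) : C := cexpi (- (t * u)).
pose w v : C := ind (v < x) * r v.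
pose g u : C := ind (u0 <= u < x) * e u.
pose kap : C := (Complex 0 (- t))^-1.
have itn : Complex 0 (- t) != 0 :> C by apply/eqP => -[h]; move: tn; rewrite -oppr_eq0 h eqxx.
have me : cmf e by exact: cmf_osc.
have ce : ccont e by apply: ccont_cexpi => u; apply: continuousN; exact: continuous_scale.
have mg : cmf g.
  apply: cmfM me; apply: cmf_ind; apply: measurable_and; [exact: measurable_fun_ler|exact: measurable_fun_ltr].
have mw : cmf w by exact: cmfM.
have cM : continuous (fun _ : R => M) by move=> ?; exact: cvg_cst.
have c1 : continuous (fun _ : R => 1 : R) by move=> ?; exact: cvg_cst.
have ra := rint_itv u0 x cM; have rb := rint_itv u0 x c1.
have oE : osc p t x = I (fun u => g u * I (fun v => ind (v < u) * w v)).
  apply: eqI => u; rewrite /g /w !indE; case: (ltP u x) => ux; last by rewrite andbF !mul0r.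
  rewrite andbT mul1r; case: leP => uu; last by rewrite (prim0 r0 pE (ltW uu)) !mul0r.
  rewrite mul1r mulrC pE; congr (_ * _); apply: eqI => v; rewrite !indE; case: ltP => vu; rewrite ?mul0r//.
  by rewrite (lt_trans vu ux) !mul1r.
have dE : cderive (fun u => kap * e u) e.
  have e3 : cderive (fun=> kap) (fun=> 0) by move=> u; split; exact: d_cst.
  have e2 : cderive e (fun u => Complex 0 (- t) * e u).
    by apply: cderive_cexpi => u; apply: der_eq (dN (dZ t (d_id u))) _; rewrite mulr1.
  have := cderiveM e3 e2; congr cderive; apply/funext => u.
  by rewrite mul0r add0r mulrA /kap mulVf// mul1r.
have inner v : u0 <= v -> v < x -> I (fun u => ind (v < u) * g u) = kap * e x - kap * e v.
  move=> uv vx; rewrite -(I_ftc (ltW vx) ce dE).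
  have cI := ci_itv v x ce.
  have cv : ci (fun u => ind (v < u) * (ind (v <= u <= x) * e u)).
    by apply: (ciM_bnd (B := 1) _ _ cI) => // u; exact: cabs_ind_le1.
  have cx : ci (fun u => ind (v < u) * g u).
    have := ciM_bnd (B := 1) (g := fun u : R => ind (u < x)) (mlt x) (fun u => cabs_ind_le1 _ _) cv.
    congr ci; apply/funext => u; rewrite /g !indE; case: (ltP v u) => vu; last by rewrite !mul0r mulr0.
    rewrite (ltW vu) (le_trans uv (ltW vu)) /=; case: ltP => ux; last by rewrite !mul0r mulr0.
    by rewrite (ltW ux) !mul1r.
  rewrite (@I_ae1 _ _ (fun u => ind (v < u) * (ind (v <= u <= x) * e u)) x cx cv).
    apply: (@I_ae1 _ _ _ v cv cI) => u uvn.
    rewrite !indE; case: (ltP v u) => vu; first by rewrite mul1r.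
    by rewrite leNgt lt_neqAle uvn vu /= !mul0r.
  move=> u uxn; rewrite /g !indE; case: (ltP v u) => vu; last by rewrite !mul0r.
  by rewrite (ltW vu) (le_trans uv (ltW vu)) /= le_eqVlt (negbTE uxn).
have wE : osc p t x = kap * (e x * p x) - kap * I (fun v => ind (v < x) * (r v * e v)).
  have cwe : ci (fun v => ind (v < x) * (r v * e v)).
    have := ciM_bnd (B := 1) me _ (cru x); move=> h; have {}h := h (fun u => _).
    have : ci (fun v => e v * (ind (v < x) * r v)) by apply: h => u; rewrite cabs_cexpi.
    by congr ci; apply/funext => v; ring.
  rewrite oE (I_primitive mw mg ra rb) => [|u v vu|u v]; last first.
  - by rewrite !rindE; case: ifP => _; case: ifP => _; rewrite ?mul0r ?mulr0 ?mul1r ?mulr1.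
  - rewrite /w /g cabsM (cabsM (ind _) (e u)) cabs_cexpi !indE !rindE.
    have [vx|vx] := ltP v x; last by rewrite cabs0 !mul0r; case: ifP => _; case: ifP => _; rewrite ?mul0r ?mulr0 ?mul1r ?mulr1.
    have [uv|uv] := leP u0 v; last by rewrite (r0 uv) cabs0 !mulr0 !mul0r.
    rewrite (ltW vx) (le_trans uv (ltW vu)) /= cabs1 !mul1r; have [ux|ux] := ltP u x.
      by rewrite (ltW ux) cabs1 !mulr1.
    by rewrite cabs0 mul0r mulr0; case: (u <= x); rewrite ?mul1r ?mul0r ?mulr0 ?mulr1.
  rewrite pE -(IZl (e x) (cru x)) -(IZl kap (ciZ _ (cru x))) -(IZl kap cwe) -(IB (ciZ _ (ciZ _ (cru x))) (ciZ _ cwe)).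
  apply: eqI => v; rewrite /w !indE; case: ltP => vx; last by rewrite !(mul0r, mulr0) subrr.
  have [uv|uv] := leP u0 v; last by rewrite (r0 uv) !(mul0r, mulr0) subrr.
  by rewrite (inner v uv vx) !mul1r; move: (r v) (e x) (e v) => *; ring.
have kn : cabs kap = `|t|^-1.
  by rewrite /kap cabsV /cabs /= expr0n add0r sqrrN sqrtr_sqr.
have Mt0 : 0 <= Mt by apply: le_trans (HMt 1 ltr01); exact: cabs_ge0.
have crx : ci (fun v => ind (v < x) * (rho v * e v)).
  have h := @ciM_bnd R (fun v => ind (v < x) * rho v) e 1 me _ (crhou x).
  have : ci (fun v => e v * (ind (v < x) * rho v)) by apply: h => u; rewrite cabs_cexpi.
  by congr ci; apply/funext => v; ring.
have cdx : ci (fun v => ind (v < x) * (D v * e v)).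
  have h := @ciM_bnd R (fun v => ind (v < x) * D v) e 1 me _ (cDu x).
  have : ci (fun v => e v * (ind (v < x) * D v)) by apply: h => u; rewrite cabs_cexpi.
  by congr ci; apply/funext => v; ring.
have b1 : cabs (I (fun v => ind (v < x) * (rho v * e v))) <= Mt.
  have [x1|x1] := ltP 0 x; last first.
    rewrite (_ : I _ = 0) ?cabs0// -[RHS]I0; apply: eqI => v; rewrite indE; case: ltP => vx; rewrite ?mul0r//.
    by rewrite rho_neg ?mul0r ?mulr0// (lt_le_trans vx).
  apply: le_trans (HMt x x1); rewrite cint_itv.
  rewrite (@I_ae1 _ _ (fun v => ind (v \in `[0, x]) * (rho v * e v)) x crx)//.
    have -> : (fun v => ind (v \in `[0, x]) * (rho v * e v)) = (fun v => ind (v <= x) * (ind (v < x + 1) * rho v * e v)).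
      apply/funext => v; rewrite in_itv /= !indE; have [v0|v0] := ltP v 0; first by rewrite rho_neg// mul0r !mulr0 mul0r mulr0.
      rewrite andTb; case: (leP v x) => vx; last by rewrite !mul0r.
      by rewrite (le_lt_trans vx) ?ltrDl// !mul1r.
    apply: (@ciM_bnd _ _ _ 1) => [|u|]; [by apply: cmf_ind; exact: measurable_fun_ler|exact: cabs_ind_le1|].
    have h := @ciM_bnd R (fun v => ind (v < x + 1) * rho v) e 1 me _ (crhou (x + 1)).
    have : ci (fun v => e v * (ind (v < x + 1) * rho v)) by apply: h => u; rewrite cabs_cexpi.
    by congr ci; apply/funext => v; ring.
  move=> v vxn; rewrite in_itv /= !indE; have [v0|v0] := ltP v 0; first by rewrite rho_neg// mul0r !mulr0.
  by rewrite /= le_eqVlt (negbTE vxn).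
have b2 : cabs (I (fun v => ind (v < x) * (D v * e v))) <= J (fun v => cabs (D v)).
  apply: cabs_I_le; [exact: cdx.1|exact: cD.2|move=> v].
  rewrite cabsM (cabsM (D v)) cabs_cexpi mulr1; apply: ler_piMl; [exact: cabs_ge0|exact: cabs_ind_le1].
have -> : osc p t x = kap * (e x * p x - (I (fun v => ind (v < x) * (rho v * e v)) + I (fun v => ind (v < x) * (D v * e v)))).
  rewrite wE -mulrBr; congr (_ * (_ - _)); rewrite -(ID crx cdx); apply: eqI => v.
  by rewrite rhoE; ring.
rewrite cabsM kn mulrC; apply: ler_wpM2r; first by rewrite invr_ge0.
apply: le_trans (ler_cabsB _ _) _; apply: lerD; first by rewrite cabsM cabs_cexpi mul1r.
by apply: le_trans (ler_cabsD _ _) _; apply: lerD.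
Qed.

End Link.

(** * Modification of rho on a bounded set, and the choice of parameters *)

Section Ramp.
Variable R : realType.
Local Notation C := R[i].
Local Notation mu := (@lebesgue_measure R).

Lemma locint_rint (f : R -> R) (a b : R) : locally_integrable setT f ->
  rint (fun v => rind (a <= v <= b) * f v).
Proof.
move=> lf; have [mf _ If] := lf.
have h : mu.-integrable `[a, b] (EFin \o f).
  apply/integrableP; split.
    by apply/measurable_EFinP; exact: measurable_funTS.
  by apply: If; [exact: subsetT|exact: segment_compact].
have := (@integrable_mkcond _ _ R mu `[a, b]%classic (EFin \o f) (measurable_itv _)).1 h.
rewrite (_ : (EFin \o f) \_ _ = (EFin \o (fun x => rind (a <= x <= b) * f x)))//.
apply/funext => x; rewrite /patch /= mem_setE in_itv /=.
by case: ifPn; rewrite ?mul1r ?mul0r.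
Qed.

Lemma locint_ci (rho : R -> C) (x0 : R) : loc_integrableC rho -> (forall x, x < 0 -> rho x = 0) ->
  ci (fun v => ind (v < x0) * rho v).
Proof.
move=> [lr li] rn.
have c0 : ci (fun v => ind (0 <= v <= x0) * rho v).
  by apply: ci_ReIm; [under eq_fun do rewrite ReM /= mul0r subr0; exact: locint_rint|under eq_fun do rewrite ImM /= mul0r addr0; exact: locint_rint].
have mi : cmf (fun v : R => ind (v < x0) : C) by apply: cmf_ind; exact: measurable_fun_ltr.
have := ciM_bnd (B := 1) mi (fun v => cabs_ind_le1 _ _) c0; congr ci; apply/funext => v.
rewrite !indE; case: ltP => vx; last by rewrite !mul0r.
by have [v0|v0] := ltP v 0; [rewrite rn// !mulr0|rewrite (ltW vx) /= !mul1r].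
Qed.

(* The values of rho before x0 are replaced by a constant of modulus at most M
   on a long interval, chosen so that the primitives agree from x0 on. *)
Lemma ramp (rho : R -> C) (rho0 : C) (M x0 : R) : loc_integrableC rho ->
  (forall x, x < 0 -> rho x = 0) -> 0 < M -> (forall x, x0 <= x -> cabs (rho x) <= M) ->
  exists (r : R -> C) (u0 : R), [/\ cmf r, forall v, cabs (r v) <= M, forall v, v < u0 -> r v = 0 &
    [/\ ci (fun v => r v - rho v), forall v, x0 <= v -> r v = rho v & I (fun v => r v - rho v) = - rho0]].
Proof.
move=> lrho rn M0 rM; have cR := locint_ci x0 lrho rn.
have mrho : cmf rho by case: lrho => [[m1 _ _] [m2 _ _]].
(* The value that the new primitive has to reach at x0. *)
pose T := I (fun v => ind (v < x0) * rho v) - rho0.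
(* Long enough for the constant T / L to have modulus at most M; the added 1 keeps the length
   positive when T = 0. *)
pose L := cabs T / M + 1.
have L0 : 0 < L by rewrite ltr_wpDl// divr_ge0 ?cabs_ge0// ltW.
pose c := RtoC L^-1 * T.
have cM : cabs c <= M.
  rewrite cabsM cabs_RtoC gtr0_norm ?invr_gt0// mulrC ler_pdivrMr//.
  by rewrite /L mulrDr mulr1 mulrCA divff ?gt_eqF// mulr1 lerDl ltW.
(* The plateau ends strictly before x0, hence does not overlap the half-line on which rho is
   kept. *)
pose y := x0 - 1; pose u0 := y - L.
have ccc : ccont (fun _ : R => c) by exact: ccont_cst.
have cc := ci_itv u0 y ccc.
have Ic : I (fun v => ind (u0 <= v <= y) * c) = T.
  have dc : cderive (fun v : R => c * RtoC v) (fun _ => c).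
    have e1 : cderive (fun _ : R => c) (fun=> 0) by move=> u; split; exact: d_cst.
    have e2 : cderive (fun u : R => RtoC u) (fun=> RtoC 1) by apply: cderive_RtoC => u; exact: d_id.
    by have := cderiveM e1 e2; congr cderive; apply/funext => u; rewrite mul0r add0r RtoC1 mulr1.
  have uy : u0 <= y by rewrite /u0 lerBlDr lerDl ltW.
  rewrite (I_ftc uy ccc dc) -mulrBr -RtoCB (_ : y - u0 = L); last by rewrite /u0; ring.
  by rewrite /c mulrC mulrA -RtoCM divff ?gt_eqF// RtoC1 mul1r.
pose r v := ind (u0 <= v <= y) * c + ind (x0 <= v) * rho v.
have yx : y < x0 by rewrite /y; lra.
have rD v : r v - rho v = ind (u0 <= v <= y) * c - ind (v < x0) * rho v.
  by rewrite /r !indE; case: (ltP v x0) => h; ring.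
exists r, u0; split.
- apply: cmfD cc.1 _; apply: cmfM mrho; apply: cmf_ind; exact: measurable_fun_ler.
- move=> v; rewrite /r !indE; have [h|h] := ltP v x0.
    rewrite mul0r addr0; case: ifP => _; rewrite ?mul1r// mul0r cabs0; exact: ltW.
  by rewrite (lt_geF (lt_le_trans yx h)) andbF mul0r add0r mul1r; exact: rM.
- move=> v vu; rewrite /r !indE leNgt vu /= mul0r add0r (lt_geF _) ?mul0r//.
  by apply: (lt_trans vu); rewrite /u0; move: yx L0; lra.
- split.
  + by have := ciB cc cR; congr ci; apply/funext => v; rewrite rD.
  + by move=> v h; rewrite /r !indE h (lt_geF (lt_le_trans yx h)) andbF mul0r add0r mul1r.
  + have -> : I (fun v => r v - rho v) = T - I (fun v => ind (v < x0) * rho v).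
      by rewrite -Ic -(IB cc cR); apply: eqI.
    by rewrite /T; ring.
Qed.

Lemma limsup_lt (f : R -> R) (l : R) : (limsup_pinfty f < l%:E)%E ->
  exists A, forall x, A <= x -> f x <= l.
Proof.
rewrite /limsup_pinfty limf_esupE => /ereal_inf_lt[_ [V [A [_ AV]] <-]] h.
exists (A + 1) => x hx; rewrite -lee_fin; apply: le_trans (ltW h).
by apply: ereal_sup_ubound; exists x => //; apply: AV; rewrite (lt_le_trans _ hx)// ltrDl.
Qed.

Lemma limsup_le (f : R -> R) (l A : R) : (forall x, A <= x -> f x <= l) -> (limsup_pinfty f <= l%:E)%E.
Proof.
move=> h; rewrite /limsup_pinfty limf_esupE; apply: (@le_trans _ _ (ereal_sup [set (f x)%:E | x in [set x | A <= x]])).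
  apply: ereal_inf_lbound; exists [set x | A <= x] => //.
  by exists A; split; [exact: num_real|move=> x /ltW].
by apply: ge_ereal_sup => _ [x hx <-]; rewrite lee_fin; exact: h.
Qed.

Theorem tauberian (rho : R -> C) (M lambda : R) (E : set R) (rho0 : C) :
    loc_integrableC rho ->
    (forall x, x < 0 -> rho x = 0) ->
    limsup_pinfty (fun x => cabs (rho x)) = M%:E ->
    0 < lambda ->
    closed E -> (lebesgue_measure E = 0)%E -> ~ E 0 ->
    (forall t, E t -> - lambda < t < lambda ->
       exists Mt : R,
         (ereal_sup [set ((cabs (cint (`[0, x]%classic)
                                   (fun u => rho u * cexpi (- (t * u)))))%R)%:E
                    | x in [set x : R | (0 < x)%R]] < Mt%:E)%E) ->
    local_pf_boundary (fun s => (laplace rho s - rho0) / s)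
                      (`](- lambda), lambda[%classic `\` E) ->
    (limsup_pinfty (fun x : R =>
                      (cabs (cint (`[0, x]%classic) rho - rho0))%R)
       <= ((2 * M / lambda)%R)%:E)%E.
Proof.
move=> lrho rn lM lam0 cE E0 nE0 oE bd.
have M0 : 0 <= M.
  rewrite -lee_fin -lM; apply: limf_esup_ge0 => [[A [_ AV]]|x]; first by apply: (AV (A + 1)); rewrite ltrDl.
  by rewrite lee_fin cabs_ge0.
apply/lee_addgt0Pr => e e0; rewrite -EFinD.
(* The excess is small enough that 2 M' < lambda (2 M / lambda + e / 2), which will place the radius
   [a] below lambda. *)
pose M' := M + e * lambda / 8.
have el : 0 < e * lambda by rewrite mulr_gt0.
have M'0 : 0 < M' by rewrite /M'; lra.
have [x1 hx1] : exists A, forall x, A <= x -> cabs (rho x) <= M'.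
  by apply: limsup_lt; rewrite lM lte_fin /M'; lra.
pose x0 := Num.max x1 1.
have x00 : 0 < x0 by rewrite lt_max ltr01 orbT.
have rx0 x : x0 <= x -> cabs (rho x) <= M' by rewrite ge_max => /andP[h _]; exact: hx1.
have [r [u0 [mr rM r0 [cD rE ID0]]]] := ramp rho0 lrho rn M'0 rx0.
have mrho : cmf rho by case: lrho => [[m1 _ _] [m2 _ _]].
pose p u := I (fun v => ind (v < u) * r v).
have pE u : p u = I (fun v => ind (v < u) * r v) by [].
have mp := prim_cmf mr rM r0 pE.
have p0 u : u < u0 -> p u = 0 by move=> /ltW; exact: prim0 r0 pE _.
have out t : - lambda < t < lambda -> ~ E t -> locgood p t.
  move=> tl nE; apply: (boundary_good mrho rn mr rM r0 pE cD rE x00 ID0 _ bd).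
  by split=> //; rewrite /= in_itv.
(* As 0 is not in E, the boundary hypothesis applies around it. The bound on p obtained here is an
   ingredient of the estimates at points of E, so it has to come before them. *)
have [e1 e10 g0] : locgood p 0 by apply: out => //; rewrite oppr_lt0 lam0.
have he1 : 0 < e1 / 2 by rewrite divr_gt0.
have he2 : e1 / 2 < e1 by lra.
have gp0 : good p (phib (e1 / 2) e1).
  by apply: g0; rewrite sub0r add0r; exact: phib_tst.
have [K pK] := prim_bounded mr rM r0 pE he1 he2 gp0.
have oscE t : E t -> - lambda < t < lambda -> exists N, forall x, cabs (osc p t x) <= N.
  move=> Et tl; have [Mt hMt] := oE t Et tl.
  have tn : t != 0 by apply/eqP => t0; apply: nE0; rewrite -t0.
  exists ((K + (Mt + J (fun v => cabs (r v - rho v)))) / `|t|).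
  apply: (osc_bounded rn mr rM r0 pE cD tn pK) => x x_gt0.
  rewrite -lee_fin; apply: le_trans (ltW hMt); apply: ereal_sup_ubound.
  by exists x.
have ext := extension mp pK p0 cE E0 out oscE.
(* Chosen so that 2 M' / a equals 2 M / lambda + e / 2 exactly; the other e / 2 is the tolerance of
   [prim_limsup]. *)
pose a := 2 * M' / (2 * M / lambda + e / 2).
have den : 0 < 2 * M / lambda + e / 2.
  by apply: ltr_wpDl; [rewrite divr_ge0 ?mulr_ge0// ltW|rewrite divr_gt0].
have a0 : 0 < a by rewrite divr_gt0// mulr_gt0.
have al : a < lambda.
  have lE : lambda * (2 * M / lambda) = 2 * M by field; rewrite gt_eqF.
  rewrite /a ltr_pdivrMr// [ltRHS]mulrDr lE /M'; lra.
pose b := (a + lambda) / 2.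
have ab : a < b by rewrite /b; lra.
have bl : b < lambda by rewrite /b; lra.
have bb : - b <= b by lra.
have gp : good p (phib a b).
  apply: (locgood_itv mp pK bb _ (phib_tst a0 ab)) => t /andP[t1 t2].
  by apply: ext; apply/andP; split; lra.
have e2 : 0 < e / 2 by rewrite divr_gt0.
have [H hH] := prim_limsup mr rM r0 pE a0 ab gp e2.
apply: (@limsup_le _ _ (Num.max H x0)) => x; rewrite ge_max => /andP[hx xx0].
have -> : cint `[0, x]%classic rho - rho0 = p x.
  rewrite -(tau_eq mr rM r0 pE cD rE x00 ID0 xx0) /tau indE (lt_le_trans x00 xx0) mul1r; congr (_ - _).
  rewrite cint_itv; apply: (@I_ae1 _ _ _ x).
  - have := locint_ci (x + 1) lrho rn => h.
    have mi : cmf (fun v : R => ind (v <= x) : C) by apply: cmf_ind; exact: measurable_fun_ler.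
    have := ciM_bnd (B := 1) mi (fun v => cabs_ind_le1 _ _) h; congr ci; apply/funext => v.
    rewrite in_itv /= !indE; have [v0|v0] := ltP v 0; first by rewrite rn// !mulr0.
    by rewrite andTb; case: (leP v x) => vx; rewrite ?mul0r// (le_lt_trans vx) ?ltrDl// !mul1r.
  - exact: locint_ci.
  move=> v vx; rewrite in_itv /= !indE; have [v0|v0] := ltP v 0; first by rewrite rn// !mulr0.
  by rewrite /= le_eqVlt (negbTE vx).
have -> : 2 * M / lambda + e = 2 * M' / a + e / 2.
  have XY (X Y : R) : X != 0 -> X / (X / Y) = Y by move=> X0; rewrite invf_div mulrC divfK.
  by rewrite /a XY; [rewrite -addrA -splitr|rewrite gt_eqF// mulr_gt0].
exact: hH.
Qed.

End Ramp.

From mathcomp Require Import Rstruct Rstruct_topology.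

Theorem theorem5p8 :
  exists C : Rdefinitions.R, 0 < C <= 2 /\
  forall (rho : Rdefinitions.R -> Rdefinitions.R[i]) (M lambda : Rdefinitions.R)
         (E : set Rdefinitions.R) (rho0 : Rdefinitions.R[i]),
    loc_integrableC rho ->
    (forall x, x < 0 -> rho x = 0) ->
    limsup_pinfty (fun x => cabs (rho x)) = M%:E ->
    0 < lambda ->
    closed E -> (lebesgue_measure E = 0)%E -> ~ E 0 ->
    (forall t, E t -> - lambda < t < lambda ->
       exists Mt : Rdefinitions.R,
         (ereal_sup [set ((cabs (cint (`[0, x]%classic)
                                   (fun u => rho u * cexpi (- (t * u)))))%R)%:E
                    | x in [set x : Rdefinitions.R | (0 < x)%R]] < Mt%:E)%E) ->
    local_pf_boundary (fun s => (laplace rho s - rho0) / s)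
                      (`](- lambda), lambda[%classic `\` E) ->
    (limsup_pinfty (fun x : Rdefinitions.R =>
                      (cabs (cint (`[0, x]%classic) rho - rho0))%R)
       <= ((C * M / lambda)%R)%:E)%E.
Proof.
exists 2; split; first by rewrite ltr0n lexx.
move=> rho M lambda E rho0; exact: tauberian.
Qed.
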